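(* Let $M=\overline I$ (with $I\subset\mathbf R$ a bounded open interval) or $M=\mathbf T=\mathbf R/\mathbf Z$. Let $F:\mathbf R\to\mathbf R$ be continuous and nonnegative, with $F(v)=0$ if and only if $v=1$, and with $\liminf_{|v|\to\infty}F(v)>0$. Let $a\in\mathring M$ and $b\ge 0$. Then the following hold. (i) (liminf inequality) Let $\{v_\varepsilon\}_{0<\varepsilon<1}\subset H^1(M)\subset C(M)$. If $v_\varepsilon\xrightarrow{g}\Xi\in\mathcal B$ as $\varepsilon\to0$, then $$E^{0,b}_{\mathrm{sMM}}(\Xi,M)\le\liminf_{\varepsilon\to0}E^{\varepsilon,b}_{\mathrm{sMM}}(v_\varepsilon).$$ In particular, $\Xi\in\mathcal A_0$. (ii) (limsup inequality) For any $\Xi\in\mathcal A_0$ there is $\{w_\varepsilon\}_{0<\varepsilon<1}\subset H^1(M)\subset C(M)$ such that $w_\varepsilon\xrightarrow{g}\Xi$ as $\varepsilon\to0$ and $$E^{0,b}_{\mathrm{sMM}}(\Xi,M)=\lim_{\varepsilon\to0}E^{\varepsilon,b}_{\mathrm{sMM}}(w_\varepsilon).$$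
   Context: $\mathring M$ is the interior of $M$: $\mathring M=I$ if $M=\overline I$, and $\mathring M=\mathbf T$ if $M=\mathbf T$. Elements of $H^1(M)$ are identified with their continuous representatives. Set-valued functions and graph convergence. A set-valued function $\Gamma$ on $M$ assigns to each $x\in M$ a compact set $\Gamma(x)\subset\mathbf R$; $\operatorname{graph}\Gamma=\{(x,y)\in M\times\mathbf R: y\in\Gamma(x)\}$. $\mathcal B$ is the set of all $\Gamma$ such that $\operatorname{graph}\Gamma$ is compact in $M\times\mathbf R$, with metric $d_g(\Gamma_1,\Gamma_2)=d_H(\operatorname{graph}\Gamma_1,\operatorname{graph}\Gamma_2)$, where $d_H$ is the Hausdorff distance on $M\times\mathbf R$ (product metric $(d_M(z_1,w_1)^2+|z_2-w_2|^2)^{1/2}$, with $d_M$ the metric of $M$). A function $v\in C(M)$ is identified with $\Gamma_v$, $\Gamma_v(x)=\{v(x)\}$. We write $v_\varepsilon\xrightarrow{g}\Xi$ as $\varepsilon\to 0$ if $d_g(\Gamma_{v_\varepsilon},\Xi)\to0$ (graph convergence). $\mathcal A$ is the set of $\Gamma\in\mathcal B$ such that $\Gamma(x)$ is a closed interval (possibly a single point) for every $x\in M$. $\mathcal A_0$ is the set of $\Xi\in\mathcal A$ for which there is an at most countable (possibly finite) set $\Sigma=\{x_i\}\subset M$ with $\Xi(x)=\{1\}$ for $x\notin\Sigma$ and $\Xi(x_i)=[\xi_i^-,\xi_i^+]$ with $\xi_i^-<\xi_i^+$ and $\xi_i^-\le1\le\xi_i^+$ for $x_i\in\Sigma$. Functionals.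 $G(v)=\left|\int_1^v\sqrt{F(\tau)}\,d\tau\right|$. For $\varepsilon>0$ and $v\in H^1(M)$, $$E^{\varepsilon}_{\mathrm{sMM}}(v)=\frac{\varepsilon}{2}\int_M\left|\frac{dv}{dx}\right|^2dx+\frac1{2\varepsilon}\int_MF(v)\,dx,\qquad E^{\varepsilon,b}_{\mathrm{sMM}}(v)=E^\varepsilon_{\mathrm{sMM}}(v)+b\,(v(a))^2.$$ For $\Xi\in\mathcal A_0$, $$E^0_{\mathrm{sMM}}(\Xi,\mathbf T)=2\sum_i\{G(\xi_i^-)+G(\xi_i^+)\},$$ $$E^0_{\mathrm{sMM}}(\Xi,\overline I)=\sum_i\left\{2(G(\xi_i^-)+G(\xi_i^+))-\kappa_i\max(G(\xi_i^-),G(\xi_i^+))\right\},$$ where $\kappa_i=0$ if $x_i\in I$ and $\kappa_i=1$ if $x_i\in\partial I$; for $\Xi\in\mathcal B\setminus\mathcal A_0$, $E^0_{\mathrm{sMM}}(\Xi,M)=\infty$. Finally $E^{0,b}_{\mathrm{sMM}}(\Xi,M)=E^0_{\mathrm{sMM}}(\Xi,M)+b\,(\min\Xi(a))^2$.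
   Formalization: In (i), the inequality is claimed only if b = 0, or min Ξ(a) ≥ 0, or E^0(Ξ,M) = ∞ (otherwise it is false: v_ε(a) may be 0 while min Ξ(a) < 0), and ''Ξ ∈ A_0'' is claimed only when the liminf of the energies is finite (constant v_ε = 0 is a counterexample). *)

(* Defs.v *)
From HB Require Import structures.
From mathcomp Require Import all_boot all_order all_algebra.
From mathcomp Require Import all_classical all_reals all_analysis.
From mathcomp Require Import lra.

Set Implicit Arguments.
Unset Strict Implicit.
Unset Printing Implicit Defensive.
Import Order.TTheory GRing.Theory Num.Theory.
Import numFieldTopology.Exports numFieldNormedType.Exports.
Local Open Scope classical_set_scope.
Local Open Scope ring_scope.

(* [Seg l r _] is the closure of I = ]l, r[; [Torus] is T = R/Z. *)
Inductive domain (R : realType) : Type :=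
| Seg (l r : R) of l < r
| Torus.
Arguments Torus {R}.

(* R/Z is represented by its fundamental domain [0, 1[, which carries the
   quotient metric [pt_dist] below (so 0 and 1^- are glued). *)
Definition span (R : realType) (M : domain R) : interval R :=
  match M with Seg l r _ => `[l, r] | Torus => `[0, 1[ end.

Record pt (R : realType) (M : domain R) : Type :=
  Pt { rep : R ; repP : rep \in span M }.

HB.instance Definition _ (R : realType) (M : domain R) :=
  [isSub for @rep R M].
HB.instance Definition _ (R : realType) (M : domain R) :=
  [Choice of pt M by <:].

(* For x, y in [0, 1[, min(|x - y|, 1 - |x - y|) is the least |x - y + k|
   over the integers k, i.e. the distance of the classes of x, y in R/Z. *)
Definition pt_dist (R : realType) (M : domain R) (x y : pt M) : R :=
  match M with
  | Seg _ _ _ => `|rep x - rep y|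
  | Torus => Num.min `|rep x - rep y| (1 - `|rep x - rep y|)
  end.

Lemma pt_distxx (R : realType) (M : domain R) (x : pt M) : pt_dist x x = 0.
Proof.
rewrite /pt_dist; case: M x => [l r lr|] x; rewrite subrr normr0 //.
by rewrite subr0; apply/min_idPl.
Qed.

Lemma pt_dist_positivity (R : realType) (M : domain R) (x y : pt M) :
  pt_dist x y = 0 -> x = y.
Proof.
rewrite /pt_dist; case: M x y => [l r lr|] x y.
  by move=> /eqP; rewrite normr_eq0 subr_eq0 => /eqP; apply: val_inj.
move=> h; apply: val_inj => /=; apply/eqP; rewrite -subr_eq0 -normr_eq0.
apply/eqP; move: h.
move: (repP x) (repP y); rewrite /= !in_itv/= => /andP[x0 x1] /andP[y0 y1].
case: leP => // _ h.
by case: (ler0P (rep x - rep y)) h => ? ?; lra.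
Qed.

Lemma pt_dist_sym (R : realType) (M : domain R) (x y : pt M) :
  pt_dist x y = pt_dist y x.
Proof. by rewrite /pt_dist; case: M x y => [l r lr|] x y; rewrite distrC. Qed.

Lemma pt_dist_triangle (R : realType) (M : domain R) (y x z : pt M) :
  pt_dist x z <= pt_dist x y + pt_dist y z.
Proof.
rewrite /pt_dist; case: M y x z => [l r lr|] y x z; first exact: ler_distD.
move: (repP x) (repP y) (repP z); rewrite /= !in_itv/=.
move=> /andP[x0 x1] /andP[y0 y1] /andP[z0 z1].
have xyz := ler_distD (rep y) (rep x) (rep z).
have xzy := ler_distD (rep z) (rep x) (rep y).
have yxz := ler_distD (rep x) (rep y) (rep z).
rewrite (distrC (rep z)) in xzy; rewrite (distrC (rep y) (rep x)) in yxz.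
have per : `|rep x - rep z| + `|rep x - rep y| + `|rep y - rep z| <= 2.
  case: (ler0P (rep x - rep z)) => ?; case: (ler0P (rep x - rep y)) => ?;
    case: (ler0P (rep y - rep z)) => ?; lra.
rewrite ge_min.
case: (leP `|rep x - rep y| (1 - `|rep x - rep y|)) => ?;
  case: (leP `|rep y - rep z| (1 - `|rep y - rep z|)) => ?; apply/orP;
  by [left; lra | right; lra].
Qed.

HB.instance Definition _ (R : realType) (M : domain R) :=
  isMetric.Build R (pt M) (@pt_distxx R M) (@pt_dist_positivity R M)
    (@pt_dist_sym R M) (@pt_dist_triangle R M).

Definition on_bdry (R : realType) (M : domain R) (x : pt M) : bool :=
  match M with
  | Seg l r _ => (rep x == l) || (rep x == r)
  | Torus => false
  end.

Section set_valued.
Context (R : realType) (M : domain R).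
Implicit Types (Gamma Xi : pt M -> set R) (v : pt M -> R).

Definition graph Gamma : set (pt M * R) := [set z | Gamma z.1 z.2].

Definition in_B Gamma : Prop :=
  (forall x, compact (Gamma x)) /\ compact (graph Gamma).

Definition prod_dist (z w : pt M * R) : R :=
  Num.sqrt (mdist z.1 w.1 ^+ 2 + `|z.2 - w.2| ^+ 2).

Definition hausdorff_dist (A B : set (pt M * R)) : \bar R :=
  maxe (ereal_sup [set ereal_inf [set (prod_dist z w)%:E | w in B] | z in A])
       (ereal_sup [set ereal_inf [set (prod_dist z w)%:E | z in A] | w in B]).

Definition graph_dist Gamma1 Gamma2 : \bar R :=
  hausdorff_dist (graph Gamma1) (graph Gamma2).

Definition single v : pt M -> set R := fun x => [set v x].

Definition graph_cvg (v : R -> pt M -> R) Xi : Prop :=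
  graph_dist (single (v eps)) Xi @[eps --> 0^'+] --> 0%E.

Definition in_A Gamma : Prop :=
  in_B Gamma /\
  forall x, exists lo hi : R, lo <= hi /\ Gamma x = `[lo, hi]%classic.

Definition in_A0 Xi : Prop :=
  in_A Xi /\
  exists Sigma : set (pt M),
    [/\ countable Sigma,
        forall x, ~ Sigma x -> Xi x = [set 1]
      & forall x, Sigma x -> exists xim xip : R,
          [/\ xim < xip, xim <= 1 <= xip & Xi x = `[xim, xip]%classic]].

(* The set Sigma in [in_A0] is unique: it is [sing_set Xi]. *)
Definition sing_set Xi : set (pt M) := [set x | Xi x <> [set 1]].

End set_valued.

Section H1.
Context (R : realType) (M : domain R).
Let mu := @lebesgue_measure R.

Definition ext (v : pt M -> R) (x : R) : R :=
  if insub x is Some p then v p else 0.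

(* Compactly supported C^1 functions on I, resp. C^1 functions on T. *)
Definition test_function (phi : R -> R) : Prop :=
  [/\ forall x, derivable phi x 1, continuous (derive1 phi)
    & match M with
      | Seg l r _ => exists c d : R, [/\ l < c, d < r &
                       forall x, x \notin `[c, d] -> phi x = 0]
      | Torus => forall x, phi (x + 1) = phi x
      end].

Definition in_L2 (g : R -> R) : Prop :=
  measurable_fun [set` span M] g /\
  (\int[mu]_(x in [set` span M]) ((g x) ^+ 2)%:E < +oo)%E.

Definition weak_derivative (v : pt M -> R) (g : R -> R) : Prop :=
  in_L2 g /\
  forall phi, test_function phi ->
    \int[mu]_(x in [set` span M]) (ext v x * derive1 phi x) =
    - \int[mu]_(x in [set` span M]) (g x * phi x).

(* Continuous representatives of the elements of H^1(M); square integrability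
   of v follows from continuity on the compact space M. *)
Definition in_H1 (v : pt M -> R) : Prop :=
  continuous v /\ exists g, weak_derivative v g.

(* dv/dx, determined up to a null set when v is in H^1(M). *)
Definition wderiv (v : pt M -> R) : R -> R :=
  xget (fun=> 0) [set g | weak_derivative v g].

End H1.

(* The filter of neighbourhoods of |v| = oo. *)
Definition abs_infty (R : realType) : set_system R :=
  filter_from [set: R] (fun A => [set v | A < `|v|]).

Section energies.
Context (R : realType) (M : domain R) (F : R -> R).
Let mu := @lebesgue_measure R.

(* The orientation of the integral from 1 to v is lost in the absolute value. *)
Definition G (v : R) : R :=
  `| \int[mu]_(t in `[Num.min 1 v, Num.max 1 v]) Num.sqrt (F t) |.

Definition E_eps (eps : R) (v : pt M -> R) : \bar R :=
  ((eps / 2)%:E * \int[mu]_(x in [set` span M]) (`|wderiv v x| ^+ 2)%:E +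
   (1 / (2 * eps))%:E * \int[mu]_(x in [set` span M]) (F (ext v x))%:E)%E.

Definition E_eps_b (b : R) (a : pt M) (eps : R) (v : pt M -> R) : \bar R :=
  (E_eps eps v + (b * v a ^+ 2)%:E)%E.

(* For Xi in A_0, [inf (Xi x)] and [sup (Xi x)] are the end points xi^- and
   xi^+ of the compact interval Xi x. *)
Definition jump_cost (Xi : pt M -> set R) (x : pt M) : R :=
  2 * (G (inf (Xi x)) + G (sup (Xi x))) -
  (on_bdry x)%:R * Num.max (G (inf (Xi x))) (G (sup (Xi x))).

Definition E_0 (Xi : pt M -> set R) : \bar R :=
  if `[< in_A0 Xi >] then \esum_(x in sing_set Xi) (jump_cost Xi x)%:E
  else +oo%E.

(* [inf (Xi a)] is min Xi(a).  If b > 0 and min Xi(a) < 0, this functional is not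
   lower semicontinuous along E_eps_b: for F(v) = (v - 1)^2 and
   Xi(a) = [-1, 1], Xi = {1} elsewhere, the profiles
   1 - 2 exp(- |x - a - eps ln 2| / eps) vanish at a. *)
Definition E_0_b (b : R) (a : pt M) (Xi : pt M -> set R) : \bar R :=
  (E_0 Xi + (b * inf (Xi a) ^+ 2)%:E)%E.

End energies.

(* Main.v *)
(* The key inequality is that of Modica and Mortola: if H is the primitive of sqrt F with
   H(1) = 0 (so that |H| = G), then eps/2 |v'|^2 + F(v)/(2 eps) >= |(H o v)'|, so the
   energy of v on an interval bounds the increments of H o v.

   Lower bound: bounded energy forces v_eps to come close to 1 in every interval, hence
   Xi(x) is an interval containing 1.  Near an interior point x with
   Xi(x) = [xi-, xi+] the function starts near 1, comes close to both ends and returns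
   near 1, at the price 2 (G(xi-) + G(xi+)) in the limit; at a boundary point only one
   side is available, and the last (or first) leg, of price max(G(xi-), G(xi+)) at most,
   is saved.  Summing over finitely many disjoint neighbourhoods gives the liminf
   inequality, and the bound on the sums makes the singular set countable.

   Recovery sequence: the price |H(q) - H(p)| + eta of a transition from p to q is
   achieved in time O(eps) by a piecewise affine profile.  Finitely many points of the
   graph of Xi approximate it, and at each of them one inserts the excursion
   1 -> xi+ -> 1 -> xi- -> 1 in such a way that xi- is attained exactly at the point.  A
   diagonal argument concludes; the matching lower bound on the energies is the liminf
   inequality itself. *)

Require Import Defs.
From HB Require Import structures.
From mathcomp Require Import all_boot all_order all_algebra.
From mathcomp Require Import all_classical all_reals all_analysis.
From mathcomp Require Import measurable_realfun zify lra ring.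
From mathcomp Require finmap.
Set Implicit Arguments.
Unset Strict Implicit.
Unset Printing Implicit Defensive.
Import Order.TTheory GRing.Theory Num.Theory.
Import numFieldTopology.Exports numFieldNormedType.Exports.
Local Open Scope classical_set_scope.
Local Open Scope ring_scope.

(** * Integrals over compact intervals *)

(** Three obstacles shape the proof. First, v_eps is only in H^1 and no chain rule for H o v is
    used: once the weak derivative has been turned into a formula for increments, a local Lipschitz
    estimate is propagated along the interval by [real_induction]. Second, segment and circle are
    treated together by lifting to R along [proj]: the accumulated energy becomes a monotone
    function on R, and a neighbourhood of the point 0 of T, which wraps around, becomes an ordinary
    interval. Third, the lower bound needs no sequence: it uses, at every scale d, one function with
    eps < d, energy at most C and graph d-close to Xi ([approximable]). The term b v(a)^2 is
    absorbed into C, since the graph of Xi near a lies above min Xi(a) - e; this bounds the square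
    from below only if min Xi(a) >= 0. In the recovery sequence a is a node, so v(a) is exactly min
    Xi(a) and that term is constant. The circle is cut at 0, also a node: both ends of the path take
    the same prescribed value, so the path closes up. *)

(** Connectedness of [x, y], argued at the supremum of the set where P holds. It replaces a
    subdivision of the interval: an additive estimate valid near every t extends to the whole. *)
Lemma real_induction (R : realType) (x y : R) (P : R -> Prop) : x <= y -> P x ->
  (forall t, x <= t <= y -> exists2 r, 0 < r & forall s s', x <= s -> s <= t ->
     t <= s' -> s' <= y -> t - r < s -> s' < t + r -> P s -> P s') -> P y.
Proof.
move=> xy Px step.
pose A := [set s | x <= s <= y /\ P s].
have Ax : A x by split=> //; rewrite lexx xy.
have Ay s : A s -> s <= y by case=> /andP[].
have hA : has_sup A by split; [exists x|exists y => s /Ay].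
have xs : x <= sup A by apply: ub_le_sup => //; case: hA.
have sy : sup A <= y by apply: ge_sup => //; exists x.
have [|r r0 hr] := step (sup A); first by rewrite xs sy.
have [s As rs] := sup_adherent r0 hA.
have [/andP[x_s s_y] Ps] := As.
have ssA : s <= sup A by apply: ub_le_sup => //; case: hA.
have [lty|] := ltP (sup A) y; last first.
  by move=> ys; apply: (hr s) => //; lra.
pose s' := Num.min y (sup A + r / 2).
have s'y : s' <= y by rewrite ge_min lexx.
have s'r : s' <= sup A + r / 2 by rewrite ge_min lexx orbT.
have s's : sup A < s' by rewrite lt_min lty /=; lra.
have Ps' : P s' by apply: (hr s) => //; lra.
suff : s' <= sup A by lra.
by apply: ub_le_sup; [case: hA|split=> //; apply/andP; split => //; lra].
Qed.

Section interval_integral.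
Context (R : realType).
Let mu := @lebesgue_measure R.

Definition itg (f : R -> R) (x y : R) : R := \int[mu]_(t in `[x, y]) f t.
Definition ible (f : R -> R) (x y : R) : Prop :=
  mu.-integrable `[x, y] (EFin \o f).

Lemma ible_cont (f : R -> R) (x y : R) : continuous f -> ible f x y.
Proof.
move=> cf; apply: continuous_compact_integrable; first exact: segment_compact.
by apply: continuous_subspaceT => ?; exact: cf.
Qed.

Lemma ibleS (f : R -> R) x y x' y' : x <= x' -> y' <= y ->
  ible f x y -> ible f x' y'.
Proof.
move=> xx yy; apply: integrableS => //.
by apply: subset_itvScc; rewrite bnd_simp.
Qed.

Lemma ibleD (f g : R -> R) (x y : R) :
  ible f x y -> ible g x y -> ible (fun t => f t + g t) x y.
Proof. by move=> hf hg; apply: (integrableD _ hf hg). Qed.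

Lemma ibleZ (f : R -> R) k (x y : R) : ible f x y -> ible (fun t => k * f t) x y.
Proof. by move=> hf; apply: (integrableZl _ k hf). Qed.

Lemma ibleB (f g : R -> R) (x y : R) :
  ible f x y -> ible g x y -> ible (fun t => f t - g t) x y.
Proof. by move=> hf hg; apply: (integrableB _ hf hg). Qed.

Lemma ible_norm (f : R -> R) (x y : R) : ible f x y -> ible (fun t => `|f t|) x y.
Proof. by move=> hf; apply: (integrable_abse hf). Qed.

Lemma ible_measurable (f : R -> R) (x y : R) : ible f x y ->
  measurable_fun `[x, y] f.
Proof. by move=> /integrableP[/measurable_EFinP]. Qed.

Lemma ible_le (f g : R -> R) (x y : R) : measurable_fun `[x, y] f ->
  (forall t, x <= t <= y -> `|f t| <= g t) -> ible g x y -> ible f x y.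
Proof.
move=> mf fg; apply: le_integrable => //; first exact/measurable_EFinP.
move=> t /=; rewrite in_itv /= => /fg; rewrite lee_fin => /le_trans; apply.
exact: ler_norm.
Qed.

Lemma ible_bounded (f : R -> R) c (x y : R) : measurable_fun `[x, y] f ->
  (forall t, x <= t <= y -> `|f t| <= c) -> ible f x y.
Proof.
move=> mf fc; apply: (@ible_le _ (fun=> c)) => //.
by apply: ible_cont => ?; exact: cvg_cst.
Qed.

Lemma ibleM_bounded (f g : R -> R) c (x y : R) : measurable_fun `[x, y] f ->
  (forall t, x <= t <= y -> `|f t| <= c) -> ible g x y ->
  ible (fun t => f t * g t) x y.
Proof.
move=> mf fc ig; apply: (@ible_le _ (fun t => c * `|g t|)).
- by apply: measurable_funM => //; exact: ible_measurable.
- by move=> t /fc h; rewrite normrM ler_wpM2r.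
- by apply: ibleZ; exact: ible_norm.
Qed.

Lemma eq_itg (f g : R -> R) (x y : R) : (forall t, x <= t <= y -> f t = g t) ->
  itg f x y = itg g x y.
Proof.
by move=> fg; apply: eq_Rintegral => t /[!inE]/=; rewrite in_itv => /fg.
Qed.

Lemma eq_ible (f g : R -> R) (x y : R) : (forall t, x <= t <= y -> f t = g t) ->
  ible f x y -> ible g x y.
Proof.
move=> fg; apply: eq_integrable => // t /[!inE]/=.
by rewrite in_itv => /fg ->.
Qed.

Lemma itgD (f g : R -> R) (x y : R) : ible f x y -> ible g x y ->
  itg (fun t => f t + g t) x y = itg f x y + itg g x y.
Proof. by move=> hf hg; apply: RintegralD. Qed.

Lemma itgB (f g : R -> R) (x y : R) : ible f x y -> ible g x y ->
  itg (fun t => f t - g t) x y = itg f x y - itg g x y.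
Proof. by move=> hf hg; apply: RintegralB. Qed.

Lemma itgZ (f : R -> R) k (x y : R) : ible f x y ->
  itg (fun t => k * f t) x y = k * itg f x y.
Proof. by move=> hf; apply: RintegralZl. Qed.

Lemma itg_cst c (x y : R) : x <= y -> itg (fun=> c) x y = c * (y - x).
Proof.
move=> xy; rewrite /itg Rintegral_cst //= lebesgue_measure_itv /= lte_fin.
by case: ltP => //= yx; have -> : x = y; [lra|rewrite subrr].
Qed.

Lemma itg_le (f g : R -> R) (x y : R) : ible f x y -> ible g x y ->
  (forall t, x <= t <= y -> f t <= g t) -> itg f x y <= itg g x y.
Proof.
by move=> hf hg fg; apply: le_Rintegral.
Qed.

Lemma itg_ge0 (f : R -> R) (x y : R) :
  (forall t, x <= t <= y -> 0 <= f t) -> 0 <= itg f x y.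
Proof.
by move=> f0; apply: Rintegral_ge0.
Qed.

Lemma itg_norm (f : R -> R) (x y : R) : ible f x y ->
  `|itg f x y| <= itg (fun t => `|f t|) x y.
Proof. by move=> hf; apply: le_normr_Rintegral. Qed.

Lemma itgxx (f : R -> R) x : itg f x x = 0.
Proof. by rewrite /itg set_itv1 Rintegral_set1. Qed.

Lemma itg_cat (f : R -> R) (x y z : R) : x <= y -> y <= z -> ible f x z ->
  itg f x z = itg f x y + itg f y z.
Proof.
move=> xy yz hf; apply/eqP; rewrite addrC -subr_eq /itg; apply/eqP.
rewrite -[RHS]Rintegral_itv_obnd_cbnd; last first.
  by apply: integrableS hf => // t /=; rewrite !in_itv /=; lra.
by apply: Rintegral_itvB => //; rewrite bnd_simp.
Qed.

Lemma ible_cat (f : R -> R) (x y z : R) : x <= y -> y <= z -> ible f x y ->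
  ible f y z -> ible f x z.
Proof.
move=> xy yz h1 h2.
have e : `[x, z]%classic = `[x, y]%classic `|` `[y, z]%classic.
  apply/seteqP; split=> t /=; rewrite !in_itv /=.
    move=> /andP[-> ->]; have [ty|ty] := leP t y; [by left|right].
    by rewrite ltW.
  by case=> /andP[h h']; apply/andP; split; lra.
rewrite /ible e; apply/integrable_mkcond; first exact: measurableU.
have j1 : mu.-integrable setT ((EFin \o f) \_ `[x, y]).
  by apply: (iffLR (integrable_mkcond _ _)) h1.
have j2 : mu.-integrable setT ((EFin \o f) \_ `[y, z]).
  by apply: (iffLR (integrable_mkcond _ _)) h2.
have j := integrableD measurableT (integrable_abse j1) (integrable_abse j2).
apply: le_integrable j => //.
  apply/(measurable_restrictT _ _).1; first exact: measurableU.
  by rewrite measurable_funU//; split; [case/integrableP: h1|case/integrableP: h2].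
move=> t _ /=; rewrite !patchE in_setU.
case: (t \in `[x, y]%classic); case: (t \in `[y, z]%classic);
  rewrite /= ?normr0 lee_fin ?addr0 ?add0r ?normr_id//.
by rewrite [leRHS]ger0_norm ?addr_ge0// lerDl.
Qed.

(** The end points are null. It serves at the junction of two glued pieces, where the glued function
    follows the left one. *)
Lemma eq_itg_oo (f g : R -> R) (x y : R) : x <= y -> ible f x y ->
  (forall t, x < t < y -> f t = g t) -> ible g x y /\ itg g x y = itg f x y.
Proof.
rewrite le_eqVlt => /predU1P[<- _ _|xy hf fg].
  split; last by rewrite !itgxx.
  apply: (@eq_ible (fun=> g x)).
    by move=> t tx; congr g; lra.
  by apply: ible_cont => ?; exact: cvg_cst.
have mf : measurable_fun `]x, y[ f.
  apply: measurable_funS (ible_measurable hf) => //.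
  by move=> t /=; rewrite !in_itv /=; lra.
have fg' : {in `]x, y[, f =1 g} by move=> t /[!in_itv]/= /fg.
have mg : measurable_fun `]x, y[ g.
  apply: eq_measurable_fun mf => t /[!inE]/= h; exact: fg'.
have mg' : measurable_fun `[x, y] g by apply: measurable_fun_itv_cc mg.
split.
  apply/integrableP; split; first exact/measurable_EFinP.
  have /integrableP[_] := hf; apply: le_lt_trans.
  rewrite le_eqVlt; apply/orP; left; apply/eqP.
  apply: (@eq_integral_itv_bounded R x y (fun t => `|f t|) (fun t => `|g t|)) => //.
  - exact: measurableT_comp.
  - exact: measurableT_comp.
  - by move=> t /fg' ->.
rewrite /itg /Rintegral; congr fine; apply: eq_integral_itv_bounded => //.
by move=> t /fg' ->.
Qed.

Lemma itg_FTC (f F : R -> R) (x y : R) : x <= y -> continuous f ->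
  (forall t : R, is_derive t (1 : R) F (f t)) -> itg f x y = F y - F x.
Proof.
rewrite le_eqVlt => /predU1P[<-|xy] cf dF; first by rewrite itgxx subrr.
have cF : continuous F.
  by move=> t; apply: differentiable_continuous; apply/derivable1_diffP.
rewrite /itg /Rintegral (@continuous_FTC2 R f F)//.
- by apply: continuous_subspaceT => ?; exact: cf.
- split; first by move=> t _; have [] := dF t.
  + by apply: cvg_at_right_filter; exact: cF.
  + by apply: cvg_at_left_filter; exact: cF.
- by move=> t _; rewrite derive1E; exact: derive_val.
Qed.

End interval_integral.

(** * Weak derivatives on an interval *)

Section smooth_step.
Context (R : realType).

(** A quadratic bound on the remainder covers the square of [pospart] at its kink 0 together with
    all other points. *)
Lemma is_derive_quad (f : R -> R) (t d C : R) :
  (forall h, `|f (h + t) - f t - d * h| <= C * h ^+ 2) ->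
  is_derive t (1 : R) f d.
Proof.
move=> H.
have C0 : 0 <= C.
  by have := le_trans (normr_ge0 _) (H 1); rewrite expr1n mulr1.
have cv : h^-1 *: (f (h *: (1 : R) + t) - f t) @[h --> 0^'] --> d.
  apply/cvgrPdist_le => e e0.
  near=> h.
  have h0 : h != 0 by near: h; exact: nbhs_dnbhs_neq.
  rewrite distrC /GRing.scale/= mulr1.
  have -> : h^-1 * (f (h + t) - f t) - d = (f (h + t) - f t - d * h) / h.
    by field.
  rewrite normrM normfV ler_pdivrMr ?normr_gt0//.
  apply: le_trans (H h) _; rewrite -real_normK ?num_real// expr2 mulrA.
  rewrite ler_pM2r ?normr_gt0//.
  have : `|h| < e / (C + 1).
    near: h; apply: dnbhs0_lt; rewrite divr_gt0//; lra.
  rewrite ltr_pdivlMr; last lra.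
  have := normr_ge0 h; nra.
split; first by apply/cvg_ex; exists d.
exact: cvg_lim cv.
Unshelve. all: by end_near. Qed.

Definition pospart (t : R) : R := Num.max t 0.

Lemma pospart_cont : continuous pospart.
Proof.
move=> t; rewrite /pospart; apply: continuous_max => //; exact: cvg_cst.
Qed.

Lemma is_derive_pospart2 (t : R) :
  is_derive t (1 : R) (fun s => pospart s ^+ 2) (2 * pospart t).
Proof.
apply: (@is_derive_quad _ _ _ 1) => h; rewrite /pospart.
rewrite ler_norml; case: (leP t 0) => ?; case: (leP (h + t) 0) => ?;
  apply/andP; split; nra.
Qed.

(** The triangle on [0, 2h] with peak 1/h at h, hence of integral 1, written as a second difference
    of [pospart]. Its primitive [step] is a C^1 rise from 0 to 1, explicit enough to be
    differentiated by hand. *)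
Definition hat (h t : R) : R :=
  (pospart t - 2 * pospart (t - h) + pospart (t - 2 * h)) / h ^+ 2.
Definition step (h t : R) : R :=
  (pospart t ^+ 2 - 2 * pospart (t - h) ^+ 2 + pospart (t - 2 * h) ^+ 2)
  / (2 * h ^+ 2).

Lemma hat_cont h : continuous (hat h).
Proof.
have c k : continuous (fun t : R => pospart (t - k)).
  move=> t; apply: (@continuous_comp _ _ _ (fun t : R => t - k) pospart).
    by apply: cvgB => //; exact: cvg_cst.
  exact: pospart_cont.
move=> t; rewrite /hat; apply: cvgMl; apply: cvgD; last exact: c.
apply: cvgB; first exact: pospart_cont.
by apply: cvgMr; exact: c.
Qed.

Lemma is_derive_shift (f : R -> R) (t k d : R) :
  is_derive (t - k) (1 : R) f d -> is_derive t (1 : R) (fun s => f (s - k)) d.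
Proof.
move=> df.
have := @is_derive1_comp R f (fun s => s - k) t d 1 df.
rewrite mulr1; apply.
rewrite -[X in is_derive _ _ _ X]subr0.
by apply: is_deriveB.
Qed.

Lemma is_derive_step h (t : R) : h != 0 -> is_derive t (1 : R) (step h) (hat h t).
Proof.
move=> h0; have h2 := is_derive_pospart2.
have e : hat h t = (2 * h ^+ 2)^-1 * (2 * pospart t - 2 * (2 * pospart (t - h)) +
  2 * pospart (t - 2 * h)) by rewrite /hat; field.
rewrite e /step.
have -> : (fun t => (pospart t ^+ 2 - 2 * pospart (t - h) ^+ 2 +
  pospart (t - 2 * h) ^+ 2) / (2 * h ^+ 2)) = (2 * h ^+ 2)^-1 *:
  ((fun t => pospart t ^+ 2) - 2 *: (fun t => pospart (t - h) ^+ 2) +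
   (fun t => pospart (t - 2 * h) ^+ 2)).
  by apply/funext => s /=; rewrite mulrC.
apply: is_deriveZ; apply: is_deriveD; last exact: is_derive_shift.
apply: is_deriveB; apply: is_deriveZ; exact: is_derive_shift.
Qed.

Lemma step_le0 h t : 0 < h -> t <= 0 -> step h t = 0.
Proof.
move=> h0 t0; rewrite /step /pospart.
by rewrite !max_r; [|lra..]; rewrite expr0n /= mulr0 subr0 addr0 mul0r.
Qed.

Lemma step_ge h t : 0 < h -> 2 * h <= t -> step h t = 1.
Proof.
move=> h0 t0; rewrite /step /pospart !max_l; [|lra..].
by field; rewrite gt_eqF.
Qed.

Lemma step_01 h t : 0 < h -> 0 <= step h t <= 1.
Proof.
move=> h0; rewrite /step /pospart.
have h2 : 0 < 2 * h ^+ 2 by rewrite mulr_gt0// exprn_gt0.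
rewrite divr_ge0 ?ler_pdivrMr ?(ltW h2)//= ?mul1r.
all: case: (leP t 0) => ?; case: (leP (t - h) 0) => ?; case: (leP (t - 2 * h) 0) => ?; nra.
Qed.

Lemma hat_ge0 h t : 0 < h -> 0 <= hat h t.
Proof.
move=> h0; rewrite /hat /pospart divr_ge0 ?exprn_ge0 ?(ltW h0)//.
case: (leP t 0) => ?; case: (leP (t - h) 0) => ?; case: (leP (t - 2 * h) 0) => ?; lra.
Qed.

Lemma hat_eq0 h t : 0 < h -> t <= 0 \/ 2 * h <= t -> hat h t = 0.
Proof.
move=> h0 ht; rewrite /hat /pospart.
suff -> : Num.max t 0 - 2 * Num.max (t - h) 0 + Num.max (t - 2 * h) 0 = 0.
  by rewrite mul0r.
by case: ht => ?; case: (leP t 0) => ?; case: (leP (t - h) 0) => ?;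
  case: (leP (t - 2 * h) 0) => ?; lra.
Qed.

End smooth_step.

Section weak_deriv.
Context (R : realType).

Lemma cont_delta (f : R -> R) (x e : R) : {for x, continuous f} -> 0 < e ->
  exists2 d, 0 < d & forall y, `|y - x| < d -> `|f y - f x| < e.
Proof.
move=> /cvgrPdist_lt/(_ e) cf /cf /nbhs_ballP[d /= d0 H].
exists d => // y yx; rewrite distrC; apply: H.
by rewrite /ball/= distrC.
Qed.

Lemma itg_delta (f : R -> R) (L H x e : R) : L <= x <= H -> ible f L H -> 0 < e ->
  exists2 d, 0 < d & forall y, L <= y <= H -> `|y - x| < d ->
    `|itg f L y - itg f L x| < e.
Proof.
move=> xLH fi e0; have LH : L <= H by lra.
have /subspace_continuousP/(_ x) := parameterized_integral_continuous LH fi.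
rewrite /= in_itv => /(_ xLH) /cvgrPdist_lt/(_ e e0).
rewrite /prop_near1 /nbhs/= /within/= => /nbhs_ballP[d /= d0 Hd].
exists d => // y yLH yx; rewrite distrC; apply: Hd.
  by rewrite /ball/= distrC.
by rewrite in_itv.
Qed.

Lemma itg_split (f : R -> R) (L H x y : R) : ible f L H -> L <= x -> x <= y ->
  y <= H -> itg f x y = itg f L y - itg f L x.
Proof.
move=> fi Lx xy yH; rewrite (@itg_cat _ f L x y)//; first lra.
by apply: ibleS fi => //; lra.
Qed.

(** The translated step differs from the indicator of [x, H] only on [x, x + 2h], and by at most 1
    there. *)
Lemma itg_step (g : R -> R) (L H x h : R) : ible g L H -> 0 < h -> L <= x ->
  x + 2 * h <= H ->
  ible (fun t => step h (t - x) * g t) L H /\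
  `|itg (fun t => step h (t - x) * g t) L H - itg g x H| <=
  itg (fun t => `|g t|) x (x + 2 * h).
Proof.
move=> gi h0 Lx xH.
have cs : continuous (fun t => step h (t - x)).
  move=> t; apply: differentiable_continuous; apply/derivable1_diffP.
  have := is_derive_step (t - x) (lt0r_neq0 h0).
  by move=> /is_derive_shift[].
have ms (a b : R) : measurable_fun `[a, b] (fun t => step h (t - x)).
  exact: ible_measurable (ible_cont _ _ cs).
have i1 (a b : R) : ible g a b -> ible (fun t => step h (t - x) * g t) a b.
  apply: (@ibleM_bounded _ _ _ 1) => // t _; have := step_01 (t - x) h0.
  by move=> /andP[s0 s1]; rewrite ger0_norm.
have gix : ible g x H by apply: ibleS gi => //; lra.
have gix1 : ible g x (x + 2 * h) by apply: ibleS gix => //; lra.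
have gix2 : ible g (x + 2 * h) H by apply: ibleS gix => //; lra.
split; first exact: i1.
rewrite (@itg_cat _ _ L x)//; [|lra|exact: i1].
rewrite (@eq_itg _ _ (fun=> 0) L x); last first.
  by move=> t tx; rewrite step_le0 ?mul0r//; lra.
rewrite itg_cst ?mul0r ?add0r; [|lra..].
rewrite -itgB//; last exact: i1.
have i2 (a b : R) : ible g a b -> ible (fun t => step h (t - x) * g t - g t) a b.
  by move=> ?; apply: ibleB => //; exact: i1.
rewrite (@itg_cat _ _ x (x + 2 * h))//; [|lra|exact: i2].
rewrite [X in _ + X](_ : _ = 0) ?addr0; last first.
  rewrite (@eq_itg _ _ (fun=> 0) _ H); first by rewrite itg_cst ?mul0r.
  by move=> t tx; rewrite step_ge ?mul1r ?subrr//; lra.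
apply: le_trans (itg_norm _) _; first exact: i2.
apply: itg_le; [exact/ible_norm/i2|exact/ible_norm|].
move=> t _; rewrite -{2}(mul1r (g t)) -mulrBl normrM ler_piMl//.
by have /andP[? ?] := step_01 (t - x) h0; rewrite ler_norml; lra.
Qed.

(** The hat is a probability density on [x, x + 2h]: an approximate Dirac mass at x, placed to its
    right. *)
Lemma itg_hat (V : R -> R) (L H x h e : R) : continuous V -> 0 < h -> L <= x ->
  x + 2 * h <= H -> (forall t, x <= t <= x + 2 * h -> `|V t - V x| <= e) ->
  `|itg (fun t => V t * hat h (t - x)) L H - V x| <= e.
Proof.
move=> cV h0 Lx xH He.
have hxcont : continuous (fun t => hat h (t - x)).
  move=> t; apply: (@continuous_comp _ _ _ (fun t : R => t - x) (hat h)).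
    by apply: cvgB => //; exact: cvg_cst.
  exact: hat_cont.
have int1 : itg (fun t => hat h (t - x)) L H = 1.
  have LH : L <= H by lra.
  have ds (t : R) : is_derive t (1 : R) (fun t => step h (t - x)) (hat h (t - x)).
    by apply: is_derive_shift; apply: is_derive_step; rewrite gt_eqF.
  rewrite (itg_FTC LH hxcont ds).
  by rewrite step_ge ?step_le0 ?subr0//; lra.
have iV : ible (fun t => V t * hat h (t - x)) L H.
  by apply: ible_cont => t; apply: cvgM; [exact: cV|exact: hxcont].
have ih : ible (fun t => hat h (t - x)) L H by exact: ible_cont.
have -> : V x = itg (fun t => V x * hat h (t - x)) L H.
  by rewrite itgZ// int1 mulr1.
rewrite -itgB//; last exact: ibleZ.
have iB : ible (fun t => V t * hat h (t - x) - V x * hat h (t - x)) L H.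
  by apply: ibleB => //; exact: ibleZ.
apply: le_trans (itg_norm iB) _.
rewrite -[leRHS]mulr1 -int1 -itgZ//.
apply: itg_le; [exact: ible_norm|exact: ibleZ|].
move=> t tLH; rewrite -mulrBl normrM (ger0_norm (hat_ge0 _ h0)).
have [tx|tx] := boolP (x <= t <= x + 2 * h).
  by rewrite ler_wpM2r ?hat_ge0// He.
by rewrite hat_eq0 ?mulr0//; move: tx; rewrite negb_and -!ltNge; lra.
Qed.

Lemma test_at (V g : R -> R) (L H x e : R) : continuous V -> ible g L H ->
  L < x < H -> 0 < e -> exists2 d, 0 < d & forall h, 0 < h < d ->
  [/\ x + 2 * h < H, `|itg (fun t => V t * hat h (t - x)) L H - V x| <= e,
      ible (fun t => step h (t - x) * g t) L H &
      `|itg (fun t => step h (t - x) * g t) L H - itg g x H| <= e].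
Proof.
move=> cV gi /andP[Lx xH] e0.
have [d1 d10 H1] := cont_delta (cV x) e0.
have xLH : L <= x <= H by rewrite !ltW.
have [d2 d20 H2] := itg_delta xLH (ible_norm gi) e0.
pose d := Num.min (Num.min d1 d2) (H - x).
have [dd1 dd2 dd3] : [/\ d <= d1, d <= d2 & d <= H - x].
  by split; rewrite /d !ge_min lexx ?orbT.
have d0 : 0 < d by rewrite !lt_min d10 d20 subr_gt0.
exists (d / 2) => [|h /andP[h0 hd]]; first exact: divr_gt0.
have h2 : 2 * h < d by move: hd; clear; lra.
have hxH : x + 2 * h < H by move: h2 dd3; clear; lra.
have [i1 b1] := itg_step gi h0 (ltW Lx) (ltW hxH).
split=> //.
- apply: itg_hat (ltW Lx) (ltW hxH) _ => // t tx.
  by apply/ltW/H1; move: tx h2 dd1; rewrite ltr_norml; clear; lra.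
- apply: le_trans b1 _.
  have xx : x <= x + 2 * h by rewrite lerDl mulr_ge0// ltW.
  rewrite (itg_split (ible_norm gi) (ltW Lx) xx (ltW hxH)).
  apply: le_trans (ler_norm _) _; apply/ltW/H2.
    by rewrite (le_trans (ltW Lx) xx) (ltW hxH).
  by move: h2 dd2 h0; rewrite ltr_norml; clear; lra.
Qed.

(* Test functions whose derivative is a hat at x minus a hat at y recover V y - V x. *)
Definition weak_on (L H : R) (V g : R -> R) : Prop :=
  forall phi : R -> R, (forall x : R, derivable phi x 1) ->
    continuous (derive1 phi) ->
    (exists c d : R, [/\ L < c, d < H & forall x, x \notin `[c, d] -> phi x = 0]) ->
    itg (fun t => V t * derive1 phi t) L H = - itg (fun t => g t * phi t) L H.

Lemma step_diff_support (h x y t : R) : 0 < h -> x <= y -> t \notin `[x, y + 2 * h] ->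
  step h (t - x) - step h (t - y) = 0.
Proof.
move=> h0 xy; rewrite in_itv /= negb_and -!ltNge => /orP[tx|ty].
  by rewrite !step_le0 ?subrr//; lra.
by rewrite !step_ge ?subrr//; lra.
Qed.

Lemma weak_on_oo (L H : R) (V g : R -> R) (x y : R) : continuous V ->
  ible g L H -> weak_on L H V g -> L < x -> x <= y -> y < H ->
  V y - V x = itg g x y.
Proof.
move=> cV gi wk Lx xy yH.
have Ly := lt_le_trans Lx xy; have xH := le_lt_trans xy yH.
apply/eqP; rewrite -subr_eq0 -normr_le0; apply/ler_addgt0Pr => e e0; rewrite add0r.
have e4 : 0 < e / 4 by exact: divr_gt0.
have [|d1 d10 H1] := test_at (x := x) cV gi _ e4; first by rewrite Lx.
have [|d2 d20 H2] := test_at (x := y) cV gi _ e4; first by rewrite Ly.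
pose h := Num.min d1 d2 / 2.
have h0 : 0 < h by rewrite divr_gt0// lt_min d10.
have hm : h < Num.min d1 d2 by rewrite ltr_pdivrMr// ltr_pMr ?ltr1n// lt_min d10.
move: (hm); rewrite lt_min => /andP[hd1 hd2].
have [|hx vx ix bx] := H1 h; first by rewrite h0.
have [|hy vy iy by_] := H2 h; first by rewrite h0.
pose phi t := step h (t - x) - step h (t - y).
have dphi (t : R) : is_derive t (1 : R) phi (hat h (t - x) - hat h (t - y)).
  by apply: is_deriveB; apply: is_derive_shift; apply: is_derive_step; rewrite gt_eqF.
have ephi : derive1 phi = fun t => hat h (t - x) - hat h (t - y).
  by apply/funext => t; rewrite derive1E; exact: derive_val.
have hc k : continuous (fun t => hat h (t - k)).
  move=> t; apply: (@continuous_comp _ _ _ (fun t : R => t - k) (hat h)).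
    by apply: cvgB => //; exact: cvg_cst.
  exact: hat_cont.
have {}wk : itg (fun t => V t * derive1 phi t) L H = - itg (fun t => g t * phi t) L H.
  apply: wk; rewrite ?ephi.
  - by move=> t; have [] := dphi t.
  - by move=> t; apply: cvgB; exact: hc.
  - by exists x, (y + 2 * h); split => // t; exact: step_diff_support.
move: wk; rewrite ephi.
have iVh k : ible (fun t => V t * hat h (t - k)) L H.
  by apply: ible_cont => t; apply: cvgM; [exact: cV|exact: hc].
rewrite (@eq_itg _ _ (fun t => V t * hat h (t - x) - V t * hat h (t - y))); last first.
  by move=> t _; rewrite mulrBr.
rewrite itgB// (@eq_itg _ (fun t => g t * phi t) (fun t => step h (t - x) * g t
  - step h (t - y) * g t)); last first.
  by move=> t _; rewrite mulrC mulrBl.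
rewrite itgB//.
have gxy : itg g x H = itg g x y + itg g y H.
  by apply: (itg_cat xy (ltW yH)); exact: ibleS (ltW Lx) (lexx H) gi.
move: bx by_ vx vy; rewrite !ler_norml gxy; clear.
by move=> /andP[? ?] /andP[? ?] /andP[? ?] /andP[? ?] ?; lra.
Qed.

End weak_deriv.

Section weak_deriv2.
Context (R : realType).
Let mu := @lebesgue_measure R.

Lemma weak_on_cc (L H : R) (V g : R -> R) (x y : R) : L < H -> continuous V ->
  ible g L H -> weak_on L H V g -> L <= x -> x <= y -> y <= H ->
  V y - V x = itg g x y.
Proof.
move=> LH cV gi wk Lx xy yH.
apply/eqP; rewrite -subr_eq0 -normr_le0; apply/ler_addgt0Pr => e e0; rewrite add0r.
have e4 : 0 < e / 4 by lra.
have [d1 d10 H1] := cont_delta (cV x) e4.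
have [d2 d20 H2] := cont_delta (cV y) e4.
have xLH : L <= x <= H by lra.
have yLH : L <= y <= H by lra.
have [d3 d30 H3] := itg_delta xLH gi e4.
have [d4 d40 H4] := itg_delta yLH gi e4.
pose d := Num.min (Num.min d1 d2) (Num.min d3 d4).
have d0 : 0 < d by rewrite !lt_min d10 d20 d30 d40.
have [hd1 hd2 hd3 hd4] : [/\ d <= d1, d <= d2, d <= d3 & d <= d4].
  by split; rewrite /d !ge_min lexx ?orbT.
pose s := Num.min 1 (d / (H - L)).
have HL : 0 < H - L by lra.
have s0 : 0 < s by rewrite lt_min ltr01 divr_gt0.
have s1 : s <= 1 by rewrite ge_min lexx.
have sd : s * (H - L) <= d by rewrite -ler_pdivlMr// ge_min lexx orbT.
(* A contraction towards the midpoint: it keeps the order, moves every point by less than d and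
   brings the end points inside, where the open case applies. *)
pose c z := z + s * ((L + H) / 2 - z).
have cin z : L <= z <= H -> L < c z < H by move=> ?; rewrite /c; nra.
have cd z : L <= z <= H -> `|c z - z| < d.
  by move=> ?; rewrite /c ltr_norml; nra.
have cxy : c x <= c y by rewrite /c; nra.
have /andP[cx1 cx2] := cin x xLH.
have /andP[cy1 cy2] := cin y yLH.
have E := weak_on_oo cV gi wk cx1 cxy cy2.
rewrite (itg_split gi)//; move: E; rewrite (itg_split gi) ?(ltW cx1) ?(ltW cy2)//.
have h1 := H1 (c x) (lt_le_trans (cd _ xLH) hd1).
have h2 := H2 (c y) (lt_le_trans (cd _ yLH) hd2).
have h3 : `|itg g L (c x) - itg g L x| < e / 4.
  by apply: H3; [lra|apply: lt_le_trans (cd _ xLH) _].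
have h4 : `|itg g L (c y) - itg g L y| < e / 4.
  by apply: H4; [lra|apply: lt_le_trans (cd _ yLH) _].
move: h1 h2 h3 h4; rewrite !ltr_norml ler_norml; clear.
move=> /andP[? ?] /andP[? ?] /andP[? ?] /andP[? ?] ?; lra.
Qed.

(** By Lebesgue differentiation g is almost everywhere the derivative of its primitive, which
    vanishes identically. *)
Lemma itg_eq0_ae (g : R -> R) (L H : R) : L < H -> ible g L H ->
  (forall x, L <= x -> x <= H -> itg g L x = 0) ->
  {ae mu, forall x, L < x < H -> g x = 0}.
Proof.
move=> LH gi g0.
pose f := g \_ `[L, H].
have fi : mu.-integrable setT (EFin \o f).
  rewrite /f -restrict_EFin.
  by apply: (iffLR (integrable_mkcond _ _)) gi.
have := @FTC1 R f (BLeft L).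
have h1 y : mu.-integrable [set` Interval (BLeft L) (BRight y)] (EFin \o f).
  exact: integrableS fi.
have h2 : locally_integrable [set: R] f.
  by apply: open_integrable_locally => //; exact: openT.
move=> /(_ h1 h2).
apply: filterS; first exact: (ae_filter_ringOfSetsType mu).
move=> x /= Hx xLH.
have Lx : (L%:E < x%:E)%E by rewrite lte_fin; lra.
have [_ dF] := Hx Lx.
have <- : f x = g x.
  by rewrite /f patchE mem_set//= in_itv /=; lra.
rewrite -dF derive1E.
have -> : 'D_1 (fun y : R => \int[mu]_(t in `[L, y]) f t) x =
          'D_1 (fun y : R => 0) x.
  apply: near_eq_derive.
  near=> y.
  have yLH : L < y < H.
    have : y \in `]L, H[ by near: y; apply: near_in_itvoo; rewrite in_itv.
    by rewrite in_itv.
  transitivity (itg g L y); last by apply: g0; lra.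
  by apply: eq_itg => t ty; rewrite /f patchE mem_set//= in_itv /=; lra.
by rewrite derive_cst.
Unshelve. all: by end_near. Qed.

End weak_deriv2.

(** * The Modica-Mortola inequality *)

Section primitive.
Context (R : realType) (F : R -> R).
Hypothesis F_cont : continuous F.
Hypothesis F_ge0 : forall v, 0 <= F v.
Hypothesis F_eq0 : forall v, F v = 0 <-> v = 1.

Let W (t : R) : R := Num.sqrt (F t).

Lemma sqrtF_cont : continuous W.
Proof.
move=> t; rewrite /W; apply: (@continuous_comp _ _ _ F Num.sqrt).
  exact: F_cont.
exact: sqrt_continuous.
Qed.

(* The signed version of G: the increasing primitive of sqrt F vanishing at 1. *)
Definition Hp (v : R) : R := if 1 <= v then itg W 1 v else - itg W v 1.

Let Wi x y : ible W x y. Proof. exact: ible_cont sqrtF_cont. Qed.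

Lemma HpB (u v : R) : u <= v -> Hp v - Hp u = itg W u v.
Proof.
move=> uv; rewrite /Hp; case: (leP 1 v) => v1; case: (leP 1 u) => u1.
- by rewrite (@itg_cat _ _ 1 u v)// addrC addKr.
- by rewrite opprK addrC -itg_cat// ltW.
- lra.
- by rewrite opprK addrC (@itg_cat _ _ u v 1) ?addrK// ltW.
Qed.

Lemma Hp1 : Hp 1 = 0.
Proof. by rewrite /Hp lexx itgxx. Qed.

Lemma Hp_mono (u v : R) : u <= v -> Hp u <= Hp v.
Proof.
by move=> uv; rewrite -subr_ge0 HpB//; apply: itg_ge0 => t _; exact: sqrtr_ge0.
Qed.

Lemma Hp_G (v : R) : 1 <= v -> Hp v = G F v.
Proof.
move=> v1; rewrite /G min_l// max_r// /Hp v1 [RHS]ger0_norm//.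
by apply: itg_ge0 => t _; exact: sqrtr_ge0.
Qed.

Lemma Hp_GN (v : R) : v <= 1 -> Hp v = - G F v.
Proof.
move=> v1; have -> : Hp v = - itg W v 1.
  by rewrite -HpB// Hp1 sub0r opprK.
rewrite /G min_r// max_l// [in RHS]ger0_norm//.
by apply: itg_ge0 => t _; exact: sqrtr_ge0.
Qed.

Lemma G_ge0 (v : R) : 0 <= G F v.
Proof. exact: normr_ge0. Qed.

Lemma Hp_lip (m u v : R) :
  (forall z, Num.min u v <= z <= Num.max u v -> W z <= m) ->
  `|Hp v - Hp u| <= m * `|v - u|.
Proof.
wlog uv : u v / u <= v.
  move=> wl H; case: (leP u v) => uv; first exact: wl.
  rewrite distrC (distrC v); apply: wl (ltW uv) _ => z.
  by rewrite minC maxC; exact: H.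
rewrite min_l// max_r// => H; rewrite HpB// !ger0_norm ?subr_ge0//; last first.
  by apply: itg_ge0 => t _; exact: sqrtr_ge0.
rewrite -itg_cst//; apply: itg_le => //.
by apply: ible_cont => ?; exact: cvg_cst.
Qed.

Lemma Hp_cont : continuous Hp.
Proof.
move=> x; apply/cvgrPdist_le => e e0.
have [d d0 Hd] := cont_delta (@sqrtF_cont x) ltr01.
have M0 : 0 < W x + 1 by rewrite ltr_wpDl ?sqrtr_ge0.
apply/nbhs_ballP; exists (Num.min d (e / (W x + 1))) => /=.
  by rewrite lt_min d0 divr_gt0.
move=> y; rewrite /ball/= distrC lt_min => /andP[yd ye].
rewrite distrC.
apply: (@le_trans _ _ ((W x + 1) * `|y - x|)); last first.
  by rewrite mulrC -ler_pdivlMr// ltW.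
apply: Hp_lip => z zxy.
suff /Hd : `|z - x| < d by rewrite ltr_norml; lra.
move: zxy yd; case: (leP x y) => ?; rewrite !ltr_norml; lra.
Qed.

(** From v to the midpoint (v + 1) / 2 the integrand stays away from its zero, so has a positive
    minimum; the rest of the way to 1 contributes a nonnegative amount. *)
Lemma G_gt0 (v : R) : v != 1 -> 0 < G F v.
Proof.
move=> v1.
have pos (x y : R) : x < y -> (forall t, x <= t <= y -> t != 1) -> 0 < itg W x y.
  move=> xy H.
  have [c cxy Hc] := @EVT_min R W x y (ltW xy) (continuous_subspaceT sqrtF_cont).
  have Wc : 0 < W c.
    rewrite sqrtr_gt0 lt_neqAle F_ge0 andbT eq_sym; apply/eqP => /F_eq0 c1.
    by move: cxy; rewrite in_itv => /H; rewrite c1 eqxx.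
  apply: (@lt_le_trans _ _ (W c * (y - x))).
    by rewrite mulr_gt0// subr_gt0.
  rewrite -itg_cst ?(ltW xy)//; apply: itg_le => //.
  by apply: ible_cont => ?; exact: cvg_cst.
case: (ltgtP v 1) v1 => // v1 _.
- suff : Hp v < 0 by rewrite Hp_GN ?ltW// oppr_lt0.
  have h := HpB (ltW v1); have m : Hp ((v + 1) / 2) <= Hp 1 by apply: Hp_mono; lra.
  have vm : v <= (v + 1) / 2 by lra.
  have := pos v ((v + 1) / 2); rewrite -HpB//; rewrite Hp1 in m.
  move=> H; suff : 0 < Hp ((v + 1) / 2) - Hp v by lra.
  by apply: H => [|t ?]; [lra|rewrite lt_eqF//; lra].
- suff : 0 < Hp v by rewrite Hp_G// ltW.
  have m : Hp 1 <= Hp ((v + 1) / 2) by apply: Hp_mono; lra.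
  have vm : (v + 1) / 2 <= v by lra.
  have := pos ((v + 1) / 2) v; rewrite -HpB//; rewrite Hp1 in m.
  move=> H; suff : 0 < Hp v - Hp ((v + 1) / 2) by lra.
  by apply: H => [|t ?]; [lra|rewrite gt_eqF//; lra].
Qed.

(** This stands for the chain rule for H o V. Near each t the function [W \o V] varies by less than
    e/2, so an increment of H o V is at most the integral of (W (V t) + e/2) |g|, hence of (W o V +
    e) |g|. Real induction adds these up, and e is chosen so that the total error is at most e0. *)
Lemma Hp_var (L H : R) (V g : R -> R) : continuous V -> ible g L H -> L <= H ->
  (forall x y, L <= x -> x <= y -> y <= H -> V y - V x = itg g x y) ->
  ible (fun t => `|g t| * W (V t)) L H /\
  `|Hp (V H) - Hp (V L)| <= itg (fun t => `|g t| * W (V t)) L H.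
Proof.
move=> cV gi LH VE.
have cWV : continuous (W \o V).
  by move=> t; apply: continuous_comp; [exact: cV|exact: sqrtF_cont].
have [c cLH Hc] := @EVT_max R _ L H LH (continuous_subspaceT cWV).
have i1 : ible (fun t => `|g t| * W (V t)) L H.
  apply: (@eq_ible _ (fun t => W (V t) * `|g t|)) => [t _|]; first by rewrite mulrC.
  apply: (@ibleM_bounded _ _ _ (W (V c))); last exact: ible_norm.
    by apply: ible_measurable (ible_cont _ _ _).
  by move=> t tLH; rewrite ger0_norm ?sqrtr_ge0//; apply: Hc; rewrite in_itv.
split=> //.
apply/ler_addgt0Pr => e0 e00.
have N0 : 0 <= itg (fun t => `|g t|) L H by exact: itg_ge0.
pose e := e0 / (itg (fun t => `|g t|) L H + 1).
have e_gt0 : 0 < e by rewrite divr_gt0// ltr_wpDl.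
apply: (@le_trans _ _ (itg (fun t => `|g t| * W (V t) + e * `|g t|) L H)); last first.
  rewrite itgD ?itgZ//; [|exact: ible_norm|exact/ibleZ/ible_norm].
  rewrite lerD2l /e -[leRHS]mulr1 -mulrA ler_pM2l//.
  by rewrite mulrC ler_pdivrMr ?mul1r ?lerDl// ltr_wpDl.
have iE : ible (fun t => `|g t| * W (V t) + e * `|g t|) L H.
  by apply: ibleD => //; exact/ibleZ/ible_norm.
apply: (@real_induction R L H (fun s => `|Hp (V s) - Hp (V L)| <=
  itg (fun t => `|g t| * W (V t) + e * `|g t|) L s)) => //.
  by rewrite itgxx subrr normr0.
move=> t tLH.
have e2 : 0 < e / 2 by lra.
have [r r0 Hr] := cont_delta (cWV t) e2.
exists r => // s s' Ls st ts' s'H tr s'r IH.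
have ss' : s <= s' by lra.
rewrite (@itg_cat _ _ L s s')//; last by apply: ibleS iE => //; lra.
have -> : Hp (V s') - Hp (V L) = (Hp (V s) - Hp (V L)) + (Hp (V s') - Hp (V s)) by lra.
apply: le_trans (ler_normD _ _) _; apply: lerD => //.
have gi' : ible g s s' by apply: ibleS gi => //; lra.
(* The Lipschitz constant is needed on the values between V s and V s'. By the intermediate value
   theorem these are taken at times in [s, s'], where [W \o V] is controlled. *)
apply: (@le_trans _ _ ((W (V t) + e / 2) * `|V s' - V s|)).
  apply: Hp_lip => z zV.
  have [tau tauI <-] := IVT ss' (continuous_subspaceT cV) zV.
  suff h : `|tau - t| < r.
    by have : `|W (V tau) - W (V t)| < e / 2 := Hr _ h; rewrite ltr_norml; lra.
  by move: tauI; rewrite in_itv /= ltr_norml; lra.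
rewrite VE//.
apply: (@le_trans _ _ ((W (V t) + e / 2) * itg (fun t => `|g t|) s s')).
  rewrite ler_wpM2l//; last exact: itg_norm.
  by rewrite addr_ge0 ?sqrtr_ge0// ltW.
rewrite -itgZ; last exact: ible_norm.
apply: itg_le.
- exact/ibleZ/ible_norm.
- by apply: ibleS iE => //; lra.
move=> tau taus; rewrite mulrC -(mulrC `|g tau|) -mulrDr ler_wpM2l//.
suff h : `|tau - t| < r.
  by have : `|W (V tau) - W (V t)| < e / 2 := Hr _ h; rewrite ltr_norml; lra.
by rewrite ltr_norml; lra.
Qed.

Definition dens (eps : R) (V g : R -> R) (t : R) : R :=
  eps / 2 * g t ^+ 2 + 1 / (2 * eps) * F (V t).

Lemma modica_mortola (eps L H : R) (V g : R -> R) : 0 < eps -> continuous V ->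
  ible g L H -> ible (fun t => g t ^+ 2) L H -> L <= H ->
  (forall x y, L <= x -> x <= y -> y <= H -> V y - V x = itg g x y) ->
  ible (dens eps V g) L H /\
  `|Hp (V H) - Hp (V L)| <= itg (dens eps V g) L H.
Proof.
move=> eps0 cV gi g2 LH VE.
have [i1 le1] := Hp_var cV gi LH VE.
have iF : ible (fun t => F (V t)) L H.
  by apply: ible_cont => t; apply: (@continuous_comp _ _ _ V F); [exact: cV|exact: F_cont].
have iD : ible (dens eps V g) L H by apply: ibleD; exact: ibleZ.
split=> //; apply: le_trans le1 _; apply: itg_le => // t _; rewrite /dens /W.
have := sqr_sqrtr (F_ge0 (V t)); have := real_normK (num_real (g t)).
set a := `|g t|; set w := Num.sqrt _ => <- <-.
rewrite -subr_ge0.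
have -> : eps / 2 * a ^+ 2 + 1 / (2 * eps) * w ^+ 2 - a * w =
    (eps * a - w) ^+ 2 / (2 * eps) by field; rewrite gt_eqF.
by rewrite divr_ge0 ?sqr_ge0//; lra.
Qed.

End primitive.

(** * Functions on M *)

Section geometry.
Context (R : realType) (M : domain R).

Definition lo : R := match M with Seg l _ _ => l | Torus => 0 end.
Definition hi : R := match M with Seg _ r _ => r | Torus => 1 end.

Lemma lo_hi : lo < hi.
Proof. by rewrite /lo /hi; case: M. Qed.

Lemma rep_itv (p : pt M) : lo <= rep p <= hi.
Proof.
have := repP p; rewrite /lo /hi; case: M p => [l r lr|] p; rewrite /= in_itv //=.
by move=> /andP[-> /ltW].
Qed.

(* The covering map of M: the clamp onto [l, r], resp. the fractional part. It is
   1-Lipschitz, so a function on M lifts to the continuous function v \o proj on R. *)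
Definition projr (s : R) : R :=
  match M with
  | Seg l r _ => Num.max l (Num.min r s)
  | Torus => s - (Num.floor s)%:~R
  end.

Lemma projrP s : projr s \in Defs.span M.
Proof.
rewrite /projr; case: M => [l r lr|]; rewrite /= in_itv /=.
  by rewrite le_max lexx ge_max (ltW lr) ge_min lexx.
have /andP[f1 f2] := floor_itv s.
by rewrite subr_ge0 f1 ltrBlDr addrC -intrD1.
Qed.

Definition proj (s : R) : pt M := Pt (projrP s).

Lemma projr_id s : s \in Defs.span M -> projr s = s.
Proof.
rewrite /projr; case: M => [l r lr|]; rewrite /= in_itv /= => /andP[h1 h2].
  by rewrite min_r// max_r.
by rewrite (@floor_def _ _ 0) ?subr0// h1.
Qed.

Lemma proj_rep (p : pt M) : proj (rep p) = p.
Proof. by apply: val_inj => /=; rewrite projr_id// repP. Qed.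

Lemma mdistE (p q : pt M) : mdist p q = pt_dist p q.
Proof. by []. Qed.

Lemma proj_lip s t : mdist (proj s) (proj t) <= `|s - t|.
Proof.
rewrite mdistE /pt_dist /= /projr; case: M => [l r lr|].
  case: (leP r s) => ?; case: (leP r t) => ?; rewrite /Num.max;
    repeat case: ifP => ?; rewrite ler_norml; case: (ler0P (s - t)); lra.
have /andP[s1 s2] := floor_itv s; have /andP[t1 t2] := floor_itv t.
rewrite intrD1 in s2; rewrite intrD1 in t2.
set m := Num.floor s in s1 s2 *; set n := Num.floor t in t1 t2 *.
have [mn|nm|->] := ltgtP m n; last first.
- by rewrite ge_min; apply/orP; left; rewrite opprB addrA subrK.
- have : (n + 1)%:~R <= m%:~R :> R by rewrite ler_int lezD1.
  rewrite intrD1 => ?; rewrite ge_min; apply/orP; right.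
  by do 2 case: ler0P => ?; lra.
- have : (m + 1)%:~R <= n%:~R :> R by rewrite ler_int lezD1.
  rewrite intrD1 => ?; rewrite ge_min; apply/orP; right.
  by do 2 case: ler0P => ?; lra.
Qed.

(** The shortest arc from x to p lifts to a segment issuing from [rep x]. On the torus it may leave
    the fundamental domain, hence the shift by an integer. *)
Lemma proj_lift (x p : pt M) : exists2 s, proj s = p & `|s - rep x| <= mdist x p.
Proof.
have [h|[k hk]] : (`|rep p - rep x| <= mdist x p) \/
    exists2 k : int, projr (rep p + k%:~R) = rep p &
      `|rep p + k%:~R - rep x| <= mdist x p.
- rewrite mdistE; have := repP x; have := repP p.
  rewrite /pt_dist /projr; case: M x p => [l r lr|] x p /=.
    by move=> _ _; left; rewrite distrC.
  rewrite !in_itv /= => /andP[p0 p1] /andP[x0 x1].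
  case: (leP `|rep x - rep p| (1 - `|rep x - rep p|)) => h.
    by left; rewrite distrC.
  right; have [xp|px] := leP (rep x) (rep p).
    exists (-1)%R; first by rewrite (@floor_def _ _ (-1)) ?mulrN1z; lra.
    by rewrite mulrN1z; move: h; do 2 case: ler0P => ?; lra.
  exists 1; first by rewrite (@floor_def _ _ 1) ?mulr1z; lra.
  by rewrite mulr1z; move: h; do 2 case: ler0P => ?; lra.
- by exists (rep p) => //; exact: proj_rep.
- by move=> ?; exists (rep p + k%:~R) => //; apply: val_inj.
Qed.

Lemma cvg_mdist (T : Type) (FF : set_system T) {FFF : Filter FF} (f : T -> pt M) (x : pt M) :
  (forall e : R, 0 < e -> \forall t \near FF, mdist x (f t) < e) -> f @ FF --> x.
Proof.
move=> H; apply/cvg_ballP => e e0.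
by apply: filterS (H e e0) => t; rewrite ballEmdist.
Qed.

Lemma proj_cont : continuous proj.
Proof.
move=> s; apply: cvg_mdist => e e0; apply/nbhs_ballP; exists e => // t.
by rewrite /ball/= => h; apply: le_lt_trans h; exact: proj_lip.
Qed.

Lemma comp_proj_cont (v : pt M -> R) : continuous v -> continuous (v \o proj).
Proof. by move=> cv s; apply: continuous_comp; [exact: proj_cont|exact: cv]. Qed.

Lemma pt_cont_delta (v : pt M -> R) :
  (forall (x : pt M) (e : R), 0 < e -> exists2 d, 0 < d & forall p,
     mdist x p < d -> `|v p - v x| < e) -> continuous v.
Proof.
move=> H x; apply/(@cvgrPdist_lt _ _ _ _ (nbhs_filter x)) => e e0; have [d d0 Hd] := H x e e0.
apply/nbhs_ballP; exists d => //= p; rewrite ballEmdist /= => h.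
by rewrite distrC; exact: Hd.
Qed.

(** Only the seam of the torus is delicate: two close points may have representatives near 0 and
    near 1. Both values are then within e/2 of the common value w 0 = w 1. *)
Lemma comp_rep_cont (w : R -> R) : continuous w ->
  (M = Torus -> w 0 = w 1) -> continuous (fun p : pt M => w (rep p)).
Proof.
move=> cw wT; apply: pt_cont_delta => x e e0.
have /andP[xlo xhi] := rep_itv x.
have e2 : 0 < e / 2 by lra.
have [d d0 Hd] := cont_delta (cw (rep x)) e2.
have [d1 d10 Hd1] := cont_delta (cw 0) e2.
have [d2 d20 Hd2] := cont_delta (cw 1) e2.
exists (Num.min d (Num.min d1 d2)) => [|p]; first by rewrite !lt_min d0 d10.
rewrite !lt_min mdistE => /andP[h1 /andP[h2 h3]].
have near : `|rep p - rep x| < d -> `|w (rep p) - w (rep x)| < e.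
  by move=> /Hd; lra.
move: wT h1 h2 h3 near Hd1 Hd2 (rep_itv x) (rep_itv p).
rewrite /pt_dist /lo /hi; case: M x p {Hd xlo xhi} => [l r lr|] x p wT.
  by rewrite distrC => h1 h2 h3 near *; exact: near.
case: (leP `|rep x - rep p| (1 - `|rep x - rep p|)) => h.
  by rewrite distrC => h1 h2 h3 near *; exact: near.
move=> h1 h2 h3 _ Hd1 Hd2 /andP[x0 x1] /andP[p0 p1].
have e01 := wT erefl.
have [xp|px] := leP (rep x) (rep p).
  have a1 : `|rep p - 1| < d2.
    by move: h h1 h2 h3 xp x0 x1 p0 p1; clear; do 2 case: ler0P => ?; lra.
  have a2 : `|rep x - 0| < d1.
    by move: h h1 h2 h3 xp x0 x1 p0 p1; clear; do 2 case: ler0P => ?; lra.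
  move: (Hd2 _ a1) (Hd1 _ a2); rewrite !ltr_norml e01; lra.
have a1 : `|rep x - 1| < d2.
  by move: h h1 h2 h3 px x0 x1 p0 p1; clear; do 2 case: ler0P => ?; lra.
have a2 : `|rep p - 0| < d1.
  by move: h h1 h2 h3 px x0 x1 p0 p1; clear; do 2 case: ler0P => ?; lra.
move: (Hd2 _ a1) (Hd1 _ a2); rewrite !ltr_norml e01; lra.
Qed.

Lemma ext_proj (v : pt M -> R) s : s \in Defs.span M -> ext v s = v (proj s).
Proof.
move=> sM; rewrite /ext; case: insubP => [p _ ps|]; last by rewrite sM.
by rewrite -{}ps proj_rep.
Qed.

End geometry.

(** * Integrals over M and square integrable derivatives *)

Section H1_facts.
Context (R : realType) (M : domain R).
Let mu := @lebesgue_measure R.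
Notation lo := (lo M).
Notation hi := (hi M).

Lemma span_cc : [set` Defs.span M] `<=` `[lo, hi]%classic.
Proof.
by rewrite /lo /hi; case: M => [l r lr|] x /=; rewrite !in_itv /=; lra.
Qed.

Lemma measurable_span (f : R -> R) :
  measurable_fun [set` Defs.span M] f <-> measurable_fun `[lo, hi] f.
Proof.
split; last by apply: measurable_funS => //; exact: span_cc.
rewrite /lo /hi; case: M => [l r lr|]//=; exact: measurable_fun_itv_cc.
Qed.

Lemma integral_span (f : R -> R) : measurable_fun `[lo, hi] f ->
  (\int[mu]_(x in [set` Defs.span M]) (f x)%:E = \int[mu]_(x in `[lo, hi]) (f x)%:E)%E.
Proof.
rewrite /lo /hi; case: M => [l r lr|]//= mf.
apply: integral_itv_bndo_bndc; apply/measurable_EFinP.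
by apply: measurable_funS mf => // x /=; rewrite !in_itv /=; lra.
Qed.

Lemma Rintegral_span (f : R -> R) : measurable_fun `[lo, hi] f ->
  \int[mu]_(x in [set` Defs.span M]) f x = itg f lo hi.
Proof. by move=> mf; rewrite /itg /Rintegral integral_span. Qed.

Lemma eq_Rintegral_span (f g : R -> R) : {in Defs.span M, f =1 g} ->
  \int[mu]_(x in [set` Defs.span M]) f x = \int[mu]_(x in [set` Defs.span M]) g x.
Proof. by move=> fg; apply: eq_Rintegral => x; rewrite inE => /fg. Qed.

Lemma L2_ible (g : R -> R) : in_L2 M g ->
  [/\ measurable_fun `[lo, hi] g, ible (fun t => g t ^+ 2) lo hi & ible g lo hi].
Proof.
move=> [/measurable_span mg gf].
have mg2 : measurable_fun `[lo, hi] (fun t => g t ^+ 2) by exact: measurable_funX.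
have i2 : ible (fun t => g t ^+ 2) lo hi.
  apply/integrableP; split; first exact/measurable_EFinP.
  apply: le_lt_trans gf; rewrite (integral_span mg2) le_eqVlt; apply/orP; left.
  by apply/eqP; apply: eq_integral => x _ /=; rewrite ger0_norm ?sqr_ge0.
split=> //; apply: (@ible_le _ _ (fun t => 1 + g t ^+ 2)) => //.
  move=> t _; rewrite -(real_normK (num_real (g t))).
  by have := normr_ge0 (g t); nra.
by apply: ibleD => //; apply: ible_cont => ?; exact: cvg_cst.
Qed.

End H1_facts.

(** * Periodic test functions *)

Section periodize.
Context (R : realType).

Definition frac (s : R) : R := s - (Num.floor s)%:~R.

Lemma frac_add1 s : frac (s + 1) = frac s.
Proof.
have /andP[f1 f2] := floor_itv s; rewrite intrD1 in f2.
rewrite /frac (@floor_def _ (s + 1) (Num.floor s + 1)).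
  by rewrite intrD1; lra.
by rewrite !intrD1; lra.
Qed.

Variables (phi : R -> R) (c d : R).
Hypotheses (c0 : 0 < c) (d1 : d < 1).
Hypothesis phi0 : forall x, x \notin `[c, d] -> phi x = 0.
Hypothesis dphi : forall x : R, derivable phi x 1.
Hypothesis cphi : continuous (derive1 phi).

Let phi0' x : x < c \/ d < x -> phi x = 0.
Proof. by move=> h; apply: phi0; rewrite in_itv /= negb_and -!ltNge; lra. Qed.

Let rho := Num.min c (1 - d).

(** The support of phi keeps a distance [rho] from 0 and 1. So near a period, enlarged by [rho] on
    both sides, the periodized function is a single translate of phi, and its smoothness at the
    integers follows. *)
Lemma periodize_local (n : int) s : n%:~R - rho < s < n%:~R + 1 + rho ->
  phi (frac s) = phi (s - n%:~R).
Proof.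
have : rho <= c by rewrite ge_min lexx.
have : rho <= 1 - d by rewrite ge_min lexx orbT.
move=> r1 r2 /andP[s1 s2].
have /andP[f1 f2] := floor_itv s; rewrite intrD1 in f2; rewrite /frac.
have [mn|nm|->//] := ltgtP (Num.floor s) n.
- have : (Num.floor s + 1)%:~R <= n%:~R :> R by rewrite ler_int lezD1.
  by rewrite intrD1 => ?; rewrite [RHS]phi0' ?phi0'//; lra.
- have : (n + 1)%:~R <= (Num.floor s)%:~R :> R by rewrite ler_int lezD1.
  by rewrite intrD1 => ?; rewrite [RHS]phi0' ?phi0'//; lra.
Qed.

Let rho0 : 0 < rho. Proof. by rewrite lt_min c0 subr_gt0. Qed.

Lemma periodize_derive (n : int) (s : R) : n%:~R - rho < s < n%:~R + 1 + rho ->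
  is_derive s (1 : R) (phi \o frac) (derive1 phi (s - n%:~R)).
Proof.
move=> sn.
apply: (@near_eq_is_derive R R^o R^o (fun t => phi (t - n%:~R)) (phi \o frac) s 1).
  have : s \in `](n%:~R - rho), (n%:~R + 1 + rho)[ by rewrite in_itv.
  move=> /near_in_itvoo; apply: filterS => t; rewrite in_itv /= => ht.
  by rewrite [RHS](periodize_local ht).
apply: is_derive_shift; apply: DeriveDef; first exact: dphi.
by rewrite derive1E.
Qed.

Lemma periodize_in s : let n := Num.floor s in
  n%:~R - rho < s < n%:~R + 1 + rho.
Proof.
by have r0 := rho0; have /andP[f1 f2] := floor_itv s; rewrite intrD1 in f2 => /=; lra.
Qed.

Lemma periodize_test : test_function Torus (phi \o frac).
Proof.
split.
- by move=> x; have [] := periodize_derive (periodize_in x).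
- move=> x; set n := Num.floor x.
  have h := periodize_in x; rewrite -/n in h.
  have E (t : R) : n%:~R - rho < t < n%:~R + 1 + rho ->
      derive1 (phi \o frac) t = derive1 phi (t - n%:~R).
    by move=> /periodize_derive ?; rewrite [LHS]derive1E; exact: derive_val.
  have cs : {for x, continuous (fun t : R => derive1 phi (t - n%:~R))}.
    apply: (@continuous_comp _ _ _ (fun t : R => t - n%:~R) (derive1 phi)).
      by apply: cvgB => //; exact: cvg_cst.
    exact: cphi.
  rewrite /prop_for /continuous_at E//.
  apply: cvg_trans cs; apply: near_eq_cvg.
  have : x \in `](n%:~R - rho), (n%:~R + 1 + rho)[ by rewrite in_itv.
  move=> /near_in_itvoo; apply: filterS => t; rewrite in_itv /= => ht.
  by rewrite E.
- by move=> x /=; rewrite frac_add1.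
Qed.

Lemma periodize_eq (s : R) : 0 <= s <= 1 ->
  phi (frac s) = phi s /\ derive1 (phi \o frac) s = derive1 phi s.
Proof.
move=> s01.
have r0 := rho0.
have h : (0 : int)%:~R - rho < s < (0 : int)%:~R + 1 + rho by rewrite mulr0z; lra.
split; first by rewrite (periodize_local h) mulr0z subr0.
rewrite [LHS]derive1E; have [_ ->] := periodize_derive h.
by rewrite mulr0z subr0.
Qed.

End periodize.

(** * Increments and energy of H^1 functions on M *)

Section H1_weak.
Context (R : realType) (M : domain R).
Let mu := @lebesgue_measure R.
Notation lo := (lo M).
Notation hi := (hi M).

Lemma test_bridge (v : pt M -> R) (g phi : R -> R) : continuous v ->
  measurable_fun `[lo, hi] g -> (forall x : R, derivable phi x 1) ->
  continuous (derive1 phi) ->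
  \int[mu]_(x in [set` Defs.span M]) (ext v x * derive1 phi x) =
    itg (fun t => v (proj M t) * derive1 phi t) lo hi /\
  \int[mu]_(x in [set` Defs.span M]) (g x * phi x) = itg (fun t => g t * phi t) lo hi.
Proof.
move=> cv mg dphi cphi.
have cphi0 : continuous phi.
  by move=> t; apply: differentiable_continuous; apply/derivable1_diffP.
split; last first.
  apply: Rintegral_span; apply: measurable_funM => //.
  exact: ible_measurable (ible_cont _ _ cphi0).
rewrite -Rintegral_span.
  by apply: eq_Rintegral_span => x xM; rewrite ext_proj.
apply: measurable_funM.
  exact: ible_measurable (ible_cont _ _ (comp_proj_cont cv)).
exact: ible_measurable (ible_cont _ _ cphi).
Qed.

(** On T the admissible test functions are periodic. A compactly supported one on ]0, 1[ becomes
    admissible by periodization, which does not change it inside the interval of integration. *)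
Lemma weak_derivative_on (v : pt M -> R) (g : R -> R) : continuous v ->
  weak_derivative v g -> weak_on lo hi (v \o proj M) g.
Proof.
move=> cv [gL2 wd] phi dphi cphi [c [d [c0 d1 phi0]]].
have [mg _ _] := L2_ible gL2.
pose psi := match M with Seg _ _ _ => phi | Torus => phi \o @frac R end.
have psiE t : lo < t < hi -> psi t = phi t /\ derive1 psi t = derive1 phi t.
  move: c0 d1; rewrite /psi /lo /hi; case: M => // c0 d1 t01.
  by apply: (@periodize_eq R phi c d) => //; lra.
have tpsi : test_function M psi.
  move: c0 d1; rewrite /psi /lo /hi; case: M => [l r lr|] c0 d1.
    by split; [exact: dphi|exact: cphi|exists c, d].
  exact: (@periodize_test R phi c d).
have [dpsi cpsi _] := tpsi.
have := wd psi tpsi.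
have [-> ->] := test_bridge cv mg dpsi cpsi.
have cpsi0 : continuous psi.
  by move=> t; apply: differentiable_continuous; apply/derivable1_diffP.
have [_ _ ig] := L2_ible gL2.
have i1 : ible (fun t => v (proj M t) * derive1 psi t) lo hi.
  by apply: ible_cont => t; apply: cvgM; [exact: (comp_proj_cont cv)|exact: cpsi].
have [k _ Hk] : exists2 k, k \in `[lo, hi] & forall t, t \in `[lo, hi] -> `|psi t| <= `|psi k|.
  apply: (@EVT_max R (fun t => `|psi t|)); first exact/ltW/lo_hi.
  apply: continuous_subspaceT => t; apply: cvg_norm; exact: cpsi0.
have i2 : ible (fun t => g t * psi t) lo hi.
  apply: (@eq_ible _ (fun t => psi t * g t)) => [t _|]; first by rewrite mulrC.
  apply: (@ibleM_bounded _ _ _ `|psi k|) => //.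
    exact: ible_measurable (ible_cont _ _ cpsi0).
have E1 t : lo < t < hi ->
    v (proj M t) * derive1 psi t = v (proj M t) * derive1 phi t.
  by move=> ht; rewrite (psiE t ht).2.
have E2 t : lo < t < hi -> g t * psi t = g t * phi t.
  by move=> ht; rewrite (psiE t ht).1.
have [_ <-] := eq_itg_oo (ltW (lo_hi M)) i1 E1.
by have [_ <-] := eq_itg_oo (ltW (lo_hi M)) i2 E2.
Qed.

Lemma H1_increment (v : pt M -> R) (g : R -> R) (x y : R) : continuous v ->
  weak_derivative v g -> lo <= x -> x <= y -> y <= hi ->
  v (proj M y) - v (proj M x) = itg g x y.
Proof.
move=> cv wd; have [_ _ ig] := L2_ible wd.1.
exact: (weak_on_cc (lo_hi M) (comp_proj_cont cv) ig (weak_derivative_on cv wd)).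
Qed.

Lemma wderivP (v : pt M -> R) : in_H1 v -> weak_derivative v (wderiv v).
Proof. by move=> [_ [g gv]]; rewrite /wderiv; case: xgetP => [//|/(_ g)]. Qed.

(** Two weak derivatives have the same primitive, so they agree almost everywhere. Hence the energy
    does not depend on the choice made by [wderiv]. *)
Lemma weak_derivative_sqr (v : pt M -> R) (g1 g2 : R -> R) : continuous v ->
  weak_derivative v g1 -> weak_derivative v g2 ->
  itg (fun t => g1 t ^+ 2) lo hi = itg (fun t => g2 t ^+ 2) lo hi.
Proof.
move=> cv w1 w2.
have [m1 i1 j1] := L2_ible w1.1; have [m2 i2 j2] := L2_ible w2.1.
have ae : {ae mu, forall x, lo < x < hi -> g1 x - g2 x = 0}.
  apply: itg_eq0_ae (lo_hi M) (ibleB j1 j2) _ => x lx xh.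
  rewrite itgB; [|apply: ibleS j1 => //|apply: ibleS j2 => //].
  by rewrite -!(H1_increment cv _ _ lx)// subrr.
have moo (g : R -> R) : measurable_fun `[lo, hi] g ->
    measurable_fun `]lo, hi[ (fun x => (g x ^+ 2)%:E).
  move=> mg; apply/measurable_EFinP; apply: measurable_funX.
  by apply: measurable_funS mg => // x /=; rewrite !in_itv /=; lra.
rewrite /itg /Rintegral; congr fine.
rewrite integral_itv_bndoo; last exact: moo.
rewrite [RHS]integral_itv_bndoo; last exact: moo.
apply: ge0_ae_eq_integral; [by []|exact: moo|exact: moo| | |].
- by move=> x _; rewrite lee_fin sqr_ge0.
- by move=> x _; rewrite lee_fin sqr_ge0.
apply: filterS ae; first exact: (ae_filter_ringOfSetsType mu).
by move=> x /= H; rewrite in_itv => /= /H /eqP; rewrite subr_eq0 => /eqP ->.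
Qed.

Lemma E_epsE (F : R -> R) (eps : R) (v : pt M -> R) : continuous F ->
  (forall t, 0 <= F t) -> 0 < eps -> in_H1 v ->
  E_eps F eps v = (itg (dens F eps (v \o proj M) (wderiv v)) lo hi)%:E.
Proof.
move=> cF F0 eps0 vH1; have wd := wderivP vH1; have [cv _] := vH1.
have [m1 i1 j1] := L2_ible wd.1.
have cFv : continuous (fun t => F (v (proj M t))).
  move=> t; apply: (@continuous_comp _ _ _ (v \o proj M) F).
    exact: comp_proj_cont.
  exact: cF.
have iF := ible_cont lo hi cFv.
rewrite /dens itgD ?itgZ//; [|exact: ibleZ|exact: ibleZ].
rewrite /E_eps EFinD !EFinM; congr (_ * _ + _ * _)%E.
  under eq_integral do rewrite real_normK ?num_real//.
  rewrite integral_span; last exact: measurable_funX.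
  by rewrite /itg /Rintegral fineK//; exact: integrable_fin_num i1.
transitivity (\int[mu]_(x in [set` Defs.span M]) (F (v (proj M x)))%:E)%E.
  by apply: eq_integral => x; rewrite inE => xM; rewrite ext_proj.
rewrite integral_span; last exact: ible_measurable iF.
by rewrite /itg /Rintegral fineK//; exact: integrable_fin_num iF.
Qed.

End H1_weak.

(** * Liminf inequality *)

Section well.
Context (R : realType) (F : R -> R).
Hypothesis F_cont : continuous F.
Hypothesis F_ge0 : forall v, 0 <= F v.
Hypothesis F_eq0 : forall v, F v = 0 <-> v = 1.
Hypothesis F_infty : (0 < limf_einf (fun v => (F v)%:E) (@abs_infty R))%E.

(** The condition at infinity bounds F from below for large |v|; on the two compact intervals that
    remain, F has a positive minimum. *)
Lemma F_away (delta : R) : 0 < delta ->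
  exists2 c, 0 < c & forall v, delta <= `|v - 1| -> c <= F v.
Proof.
move=> d0.
have [c1 c10 [A HA]] : exists2 c, 0 < c & exists A, forall v : R, A < `|v| -> c <= F v.
  move: F_infty; rewrite limf_einfE => /ereal_sup_gt[_ [V [A _ AV] <-]].
  move=> m0.
  (* The cap at 1 makes the infimum finite, so that [fine] keeps its value. *)
  exists (fine (mine (ereal_inf ((fun v => (F v)%:E) @` V)) 1%:E)).
    rewrite fine_gt0// lt_min m0 lte01 /=.
    by apply: (@le_lt_trans _ _ 1%:E); rewrite ?ltry// ge_min lexx orbT.
  exists A => v vA; rewrite -lee_fin fineK.
    rewrite ge_min; apply/orP; left; apply: ereal_inf_lbound; exists v => //.
    exact: AV.
  rewrite ge0_fin_numE ?le_min ?(ltW m0) ?lee01//.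
  by apply: (@le_lt_trans _ _ 1%:E); rewrite ?ltry// ge_min lexx orbT.
have pos (x y : R) : (forall v, x <= v <= y -> v != 1) ->
    exists2 c, 0 < c & forall v, x <= v <= y -> c <= F v.
  move=> H; have [xy|yx] := leP x y; last by exists 1 => // v; lra.
  have [c cxy Hc] := EVT_min xy (continuous_subspaceT F_cont).
  exists (F c); last by move=> v vxy; apply: Hc; rewrite in_itv.
  rewrite lt_neqAle F_ge0 andbT eq_sym; apply/eqP => /F_eq0 cE.
  by move: cxy; rewrite in_itv => /H; rewrite cE eqxx.
have [|c2 c20 H2] := pos (- A) (1 - delta).
  by move=> v h; rewrite lt_eqF//; lra.
have [|c3 c30 H3] := pos (1 + delta) A.
  by move=> v h; rewrite gt_eqF//; lra.
exists (Num.min c1 (Num.min c2 c3)) => [|v vd]; first by rewrite !lt_min c10 c20.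
have [/HA h|h] := ltP A `|v|; first by rewrite ge_min h.
move: h; rewrite ler_norml => /andP[vA Av].
move: vd; case: ler0P => v1 vd.
  by rewrite !ge_min H2 ?orbT//; lra.
by rewrite !ge_min H3 ?orbT//; lra.
Qed.

End well.

(** * Energy accumulated along the lift *)

Section primitive_extension.
Context (R : realType).

Lemma torus_window (s t : R) : s <= t -> t <= s + 1 ->
  Num.floor t = Num.floor s \/ Num.floor t = Num.floor s + 1.
Proof.
move=> st ts.
have /andP[s1 s2] := floor_itv s; have /andP[t1 t2] := floor_itv t.
rewrite intrD1 in s2; rewrite intrD1 in t2.
have : (Num.floor s)%:~R < (Num.floor t + 1)%:~R :> R by rewrite intrD1; lra.
have : (Num.floor t)%:~R < (Num.floor s + 1 + 1)%:~R :> R by rewrite !intrD1; lra.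
by rewrite !ltr_int; lia.
Qed.

(** Here e is the energy counted from [lo M], and h the quantity whose increments it dominates. On a
    segment K is e after the clamp; on the torus each full turn adds the energy e 1 of one
    period. *)
Lemma extend_primitive (M : domain R) (h e : R -> R) :
  (forall s, h (projr M s) = h s) ->
  (forall x y, lo M <= x -> x <= y -> y <= hi M -> `|h y - h x| <= e y - e x) ->
  e (lo M) = 0 ->
  exists K : R -> R,
  [/\ forall s t, s <= t -> `|h t - h s| <= K t - K s
    & forall s t, s <= t -> (M = Torus -> t <= s + 1) -> K t - K s <= e (hi M)].
Proof.
move=> hp he e0.
have em x y : lo M <= x -> x <= y -> y <= hi M -> e x <= e y.
  by move=> lx xy yh; rewrite -subr_ge0; apply: le_trans (he _ _ lx xy yh).
have : forall s, lo M <= projr M s <= hi M by move=> s; exact: (rep_itv (proj M s)).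
move: hp he e0 em; rewrite /lo /hi /projr; case: M => [l r lr|] hp he e0 em pin.
  exists (fun s => e (Num.max l (Num.min r s))); split=> [s t st|s t st _].
    rewrite -(hp t) -(hp s).
    have /andP[? ?] := pin s; have /andP[? ?] := pin t.
    by apply: he => //; rewrite le_max2// le_min2.
  have /andP[? ?] := pin s; have /andP[? ?] := pin t.
  have := em l (Num.max l (Num.min r s)); have := em (Num.max l (Num.min r t)) r.
  rewrite e0 => /(_ _ _ (lexx _)) H1 /(_ (lexx _)) H2.
  by have := H1; have := H2; lra.
have e1 : 0 <= e 1 by rewrite -e0 em.
have fr s : exists f, [/\ f = s - (Num.floor s)%:~R, 0 <= f, f < 1 & h s = h f].
  exists (s - (Num.floor s)%:~R); split=> //.
  - by have /andP[] := pin s.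
  - by have /andP[_] := floor_itv s; rewrite intrD1; lra.
have h01 : h 1 = h 0 by rewrite -(hp 1) floor1 subrr.
pose K s := (Num.floor s)%:~R * e 1 + e (s - (Num.floor s)%:~R).
exists K; split=> s t st; rewrite /K.
  have [fs [fsE fs0 fs1 ->]] := fr s; have [ft [ftE ft0 ft1 ->]] := fr t.
  rewrite -fsE -ftE.
  have /andP[s1 s2] := floor_itv s; have /andP[t1 t2] := floor_itv t.
  rewrite intrD1 in s2; rewrite intrD1 in t2.
  have [nm|nm] := eqVneq (Num.floor s) (Num.floor t).
    rewrite nm in fsE *; have fst : fs <= ft by lra.
    by have := he _ _ fs0 fst (ltW ft1); lra.
  have mn : Num.floor s + 1 <= Num.floor t.
    have : (Num.floor s)%:~R < (Num.floor t + 1)%:~R :> R by rewrite intrD1; lra.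
    by rewrite ltr_int; move: nm; clear; lia.
  have {}mn : (Num.floor s)%:~R + 1 <= (Num.floor t)%:~R :> R.
    by rewrite -intrD1 ler_int.
  (* At least one integer separates s from t. One goes from s to the end of its turn and from the
     start of the last turn to t; h takes the same value at both, and full turns in between only
     increase K. *)
  have H1 := he _ _ (lexx 0) ft0 (ltW ft1).
  have H2 := he _ _ fs0 (ltW fs1) (lexx 1).
  have H3 := ler_normD (h ft - h 0) (h 1 - h fs).
  rewrite (_ : h ft - h 0 + (h 1 - h fs) = h ft - h fs) in H3; last lra.
  apply: (le_trans H3); apply: le_trans (lerD H1 H2) _.
  rewrite e0; nra.
move=> ts; have {}ts := ts erefl.
have [fs [fsE fs0 fs1 _]] := fr s; have [ft [ftE ft0 ft1 _]] := fr t.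
rewrite -fsE -ftE.
have E1 := em _ _ (lexx 0) fs0 (ltW fs1).
have E2 := em _ _ ft0 (ltW ft1) (lexx 1).
(* A window of length at most 1 crosses at most one integer; if it does, ft <= fs, so the two arcs
   do not overlap within the period. *)
have [E|E] := torus_window st ts; rewrite E in ftE *; first by lra.
have tfs : ft <= fs by move: ftE; rewrite intrD1; lra.
have E3 := em _ _ ft0 tfs (ltW fs1).
by rewrite intrD1; lra.
Qed.
End primitive_extension.
Section K_function.
Context (R : realType) (M : domain R) (F : R -> R).
Hypothesis F_cont : continuous F.
Hypothesis F_ge0 : forall v, 0 <= F v.
Notation lo := (lo M).
Notation hi := (hi M).
Notation Hp := (Hp F).

(* [K] is the energy accumulated from a base point, lifted along [proj]; on the torus
   one period of [K] costs the total energy. *)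
Lemma energy_primitive (eps : R) (v : pt M -> R) : 0 < eps -> in_H1 v ->
  exists K : R -> R,
  [/\ forall s t, s <= t -> `|Hp (v (proj M t)) - Hp (v (proj M s))| <= K t - K s,
     forall s t, s <= t -> (M = Torus -> t <= s + 1) ->
        ((K t - K s)%:E <= E_eps F eps v)%E
   & forall x y c, lo <= x -> x <= y -> y <= hi ->
        (forall s, x <= s <= y -> c <= F (v (proj M s))) ->
        ((1 / (2 * eps) * c * (y - x))%:E <= E_eps F eps v)%E].
Proof.
move=> eps0 vH1; rewrite E_epsE//; have wd := wderivP vH1; have [cv _] := vH1.
have [m1 i1 j1] := L2_ible wd.1.
set D := dens F eps _ _; pose e x := itg D lo x.
have MM x y : lo <= x -> x <= y -> y <= hi -> ible D x y /\
    `|Hp (v (proj M y)) - Hp (v (proj M x))| <= itg D x y.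
  move=> lx xy yh; apply: modica_mortola => //.
  - exact: comp_proj_cont.
  - exact: ibleS j1.
  - exact: ibleS i1.
  - by move=> x' y' ? ? ?; apply: H1_increment => //; lra.
have lh := lo_hi M.
have [iD _] := MM lo hi (lexx _) (ltW lh) (lexx _).
have D0 t : 0 <= D t.
  rewrite /D /dens addr_ge0// mulr_ge0 ?sqr_ge0 ?F_ge0//; first lra.
  by rewrite divr_ge0//; lra.
have [| | |K [K1 K2]] := @extend_primitive R M (fun s => Hp (v (proj M s))) e.
- by move=> s; congr (Hp (v _)); apply: val_inj; rewrite /= projr_id// projrP.
- by move=> x y lx xy yh; rewrite -(itg_split iD)//; have [] := MM x y lx xy yh.
- exact: itgxx.
exists K; split=> //.
move=> x y c lx xy yh Hc.
rewrite lee_fin (@itg_cat _ _ lo x)//; last by lra.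
rewrite (@itg_cat _ _ x y hi)//; last by apply: ibleS iD.
apply: (@le_trans _ _ (itg D x y)); last first.
  by rewrite addrCA lerDl addr_ge0// itg_ge0.
rewrite -itg_cst//; apply: itg_le.
- by apply: ible_cont => ?; exact: cvg_cst.
- by apply: ibleS iD.
move=> t txy; rewrite /D /dens ler_wpDl//.
  by rewrite mulr_ge0 ?sqr_ge0//; lra.
rewrite ler_wpM2l ?Hc// divr_ge0//; lra.
Qed.

End K_function.

Lemma hausdorff_prod (T U : topologicalType) :
  hausdorff_space T -> hausdorff_space U -> hausdorff_space (T * U)%type.
Proof.
move=> hT hU [p1 p2] [q1 q2] pq; congr pair.
  apply: hT => A B pA qB.
  have := pq (A `*` setT) (B `*` setT).
  case=> [||[z1 z2] [[/= ? _] [/= ? _]]]; last by exists z1.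
  - by exists (A, setT) => //; split => //; exact: filterT.
  - by exists (B, setT) => //; split => //; exact: filterT.
apply: hU => A B pA qB.
have := pq (setT `*` A) (setT `*` B).
case=> [||[z1 z2] [[/= _ ?] [/= _ ?]]]; last by exists z2.
- by exists (setT, A) => //; split => //; exact: filterT.
- by exists (setT, B) => //; split => //; exact: filterT.
Qed.

Lemma compact_inf_sup (R : realType) (A : set R) : compact A -> A !=set0 ->
  [/\ A (inf A), A (sup A) & forall y, A y -> inf A <= y <= sup A].
Proof.
move=> cA A0; have clA := compact_closed (@Rhausdorff R) cA.
have hs : has_sup A by apply: compact_has_sup.
have hi : has_inf A.
  split=> //; have cN : compact ((-%R : R -> R) @` A).
    by apply: continuous_compact => //; apply: continuous_subspaceT => t; exact: continuousN.
  have [_ [M HM]] : has_sup ((-%R : R -> R) @` A).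
    by apply: compact_has_sup => //; case: A0 => a Aa; exists (- a), a.
  by exists (- M) => y Ay; rewrite lerNl; apply: HM; exists y.
have ub y : A y -> y <= sup A by move=> ?; apply: ub_le_sup => //; case: hs.
have lb y : A y -> inf A <= y by move=> ?; apply: ge_inf => //; case: hi.
split; last by move=> y Ay; rewrite lb// ub.
  apply: clA => B /nbhs_ballP[e /= e0 HB].
  have [y Ay yi] := inf_adherent e0 hi.
  exists y; split=> //; apply: HB; rewrite /ball/= ltr_norml.
  by have := lb _ Ay; lra.
by apply: clA; apply: closure_sup => //; case: hs.
Qed.

(** * Shape of the limit graph *)

Section liminf.
Context (R : realType) (M : domain R) (F : R -> R).
Hypothesis F_cont : continuous F.
Hypothesis F_ge0 : forall v, 0 <= F v.
Hypothesis F_eq0 : forall v, F v = 0 <-> v = 1.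
Hypothesis F_infty : (0 < limf_einf (fun v => (F v)%:E) (@abs_infty R))%E.
Notation lo := (lo M).
Notation hi := (hi M).
Notation proj := (proj M).
Notation Hp := (Hp F).
Notation G := (G F).
Implicit Types (Xi : pt M -> set R) (v : pt M -> R) (x : pt M).

(** Hausdorff closeness measured coordinate by coordinate. It agrees with [graph_dist] up to a
    factor 2 in d, and avoids square roots and suprema. *)
Definition graph_close v Xi (d : R) : Prop :=
  (forall x, exists x' y', [/\ Xi x' y', mdist x x' < d & `|v x - y'| < d]) /\
  (forall x y, Xi x y -> exists2 x', mdist x x' < d & `|v x' - y| < d).

(** What remains of a sequence in the lower bound: C stands for any real number above the lower
    limit of the energies. *)
Definition approximable (C : R) Xi : Prop := forall d, 0 < d -> exists eps v,
  [/\ 0 < eps < d, in_H1 v, (E_eps F eps v <= C%:E)%E & graph_close v Xi d].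

(* [p, q] is, up to a deck transformation of [proj], a subinterval of [lo, hi]. *)
Definition inner (p q : R) : Prop := exists k : R,
  [/\ lo <= p - k, q - k <= hi & forall s, proj (s - k) = proj s].

(** If v stayed at distance d from 1 on [p, q], the potential term alone would be at least c (q - p)
    / (2 eps) with c from [F_away]; the bound on eps makes this exceed |C| + 1. *)
Lemma near_one (C p q d : R) : p < q -> inner p q -> 0 < d ->
  exists2 e, 0 < e & forall eps v, 0 < eps < e -> in_H1 v ->
    (E_eps F eps v <= C%:E)%E -> exists2 s, p <= s <= q & `|v (proj s) - 1| < d.
Proof.
move=> pq [k [lp qh Hk]] d0.
have [c c0 Hc] := F_away F_cont F_ge0 F_eq0 F_infty d0.
have C1 : 0 < `|C| + 1 by rewrite ltr_wpDl.
have cpq : 0 < c * (q - p) by rewrite mulr_gt0// subr_gt0.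
exists (c * (q - p) / (2 * (`|C| + 1))).
  by rewrite divr_gt0// mulr_gt0.
move=> eps v /andP[eps0 epse] vH1 vE; apply: contrapT => Hs.
have [K [_ _ K3]] := energy_primitive F_cont F_ge0 eps0 vH1.
have := K3 (p - k) (q - k) c lp.
have Fc s : p - k <= s <= q - k -> c <= F (v (proj s)).
  move=> sI; apply: Hc; rewrite leNgt; apply/negP => h; apply: Hs.
  exists (s + k); first by lra.
  by rewrite -Hk addrK.
move=> /(_ ltac:(lra) qh Fc) /le_trans/(_ vE); rewrite lee_fin.
have -> : q - k - (p - k) = q - p by lra.
move=> h; have : `|C| + 1 < 1 / (2 * eps) * c * (q - p).
  have -> : 1 / (2 * eps) * c * (q - p) = c * (q - p) / (2 * eps).
    by field; rewrite gt_eqF.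
  rewrite ltr_pdivlMr; last by lra.
  by move: epse; rewrite ltr_pdivlMr; lra.
by have := ler_norm C; lra.
Qed.

Lemma closed_graph Xi x (y : R) : in_B Xi ->
  (forall d, 0 < d -> exists x' y', [/\ Xi x' y', mdist x x' < d & `|y - y'| < d]) ->
  Xi x y.
Proof.
move=> [_ cXi] H.
have hd : hausdorff_space (pt M * R)%type.
  exact: (hausdorff_prod (@metric_hausdorff R (pt M)) (@Rhausdorff R)).
have cl := compact_closed hd cXi.
apply: (cl (x, y)) => B [[B1 B2] /= [/nbhs_ballP[d1 d10 h1] /nbhs_ballP[d2 d20 h2]] B12].
have [|x' [y' [Xi' xx' yy']]] := H (Num.min d1 d2); first by rewrite lt_min d10 d20.
exists (x', y'); split=> //; apply: B12; split => /=.
  by apply: h1; rewrite ballEmdist /=; move: xx'; rewrite lt_min => /andP[].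
by apply: h2; rewrite /ball/=; move: yy'; rewrite lt_min => /andP[].
Qed.

(** These are the one-sided windows, at distance rho/2 to rho from x, in which [near_one] applies.
    At the point 0 of the torus the left window lies in [-1, 0] and is moved by one period; an end
    of a segment has a window on one side only. *)
Lemma inner_near x : exists2 rho0, 0 < rho0 & forall rho, 0 < rho < rho0 ->
  let r := rep x in let left := inner (r - rho) (r - rho / 2) in
  let right := inner (r + rho / 2) (r + rho) in
  [\/ ~~ on_bdry x /\ left /\ right, [/\ on_bdry x, rep x = lo & right]
    | [/\ on_bdry x, rep x = hi & left]].
Proof.
have in0 p q : lo <= p -> q <= hi -> inner p q.
  by move=> lp qh; exists 0; split; rewrite ?subr0// => s; rewrite subr0.
have in1 p q : M = Torus -> -1 <= p -> q <= 0 -> inner p q.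
  move=> MT p1 q0; exists (-1).
  have perE s : proj (s - -1) = proj s.
    by apply: val_inj; rewrite /= /projr MT opprK; exact: frac_add1.
  by split=> //; rewrite /lo /hi MT; lra.
have /andP[xl xh] := rep_itv x; have lh := lo_hi M.
have [b|nb] := boolP (on_bdry x).
  exists (hi - lo); first by rewrite subr_gt0.
  move=> rho /andP[r0 rh] /=.
  have : rep x = lo \/ rep x = hi.
    move: b; rewrite /on_bdry /lo /hi; case: M x {in0 in1 lh rh xl xh} => [l r lr|] x //.
    by move=> /orP[]/eqP; [left|right].
  by case=> E; [apply: Or32|apply: Or33]; split=> //; apply: in0; lra.
have [xx|/negPf xx] := boolP ((lo < rep x) && (rep x < hi)).
  have /andP[x1 x2] := xx.
  exists (Num.min (rep x - lo) (hi - rep x)) => [|rho]; first by rewrite lt_min !subr_gt0 xx.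
  rewrite lt_min => /andP[r0 /andP[r1 r2]] /=; apply: Or31; split=> //.
  by split; apply: in0; lra.
have [MT x0] : M = Torus /\ rep x = 0.
  move: nb xx xl xh (repP x); rewrite /on_bdry /lo /hi.
  case: M x {in0 in1 lh} => [l r lr|] x.
    rewrite negb_or => /andP[/negPf xl' /negPf xr'] + xl xr _.
    by rewrite !lt_neqAle xl xr eq_sym xl' xr'.
  rewrite /= in_itv /= => _ + x0 _ /andP[_ x1].
  rewrite x1 andbT lt_neqAle x0 andbT => /negbT/negPn/eqP <-; split=> //.
exists 1 => // rho rho01 /=; apply: Or31; split=> //; rewrite x0; split.
  by apply: in1 => //; lra.
by apply: in0; rewrite /lo /hi MT; lra.
Qed.

Section approx.
Variables (C : R) (Xi : pt M -> set R).
Hypothesis BXi : in_B Xi.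
Hypothesis aXi : approximable C Xi.

(** Arbitrarily close to x the functions take values arbitrarily close to 1, so (x, 1) is adherent
    to the closed graph. *)
Lemma approx_one x : Xi x 1.
Proof.
apply: (closed_graph BXi) => d d0.
have [rho0 rho00 Hrho] := inner_near x.
pose rho := Num.min rho0 d / 2.
have rho_gt0 : 0 < rho by rewrite divr_gt0// lt_min rho00 d0.
have [rrho0 rd] : rho < rho0 /\ rho <= d / 2.
  split; last by rewrite ler_pM2r ?invr_gt0// ge_min lexx orbT.
  have : rho <= rho0 / 2 by rewrite ler_pM2r ?invr_gt0// ge_min lexx.
  lra.
have [p [q [pq pqi pqr]]] : exists p q, [/\ p < q, inner p q &
    forall s, p <= s <= q -> `|s - rep x| <= rho].
  have := Hrho rho; rewrite rho_gt0 rrho0 => /(_ isT) /=.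
  case=> [[_ [_ r]]|[_ _ r]|[_ _ l]].
  - exists (rep x + rho / 2), (rep x + rho); split=> //; first lra.
    by move=> s ?; rewrite ler_norml; lra.
  - exists (rep x + rho / 2), (rep x + rho); split=> //; first lra.
    by move=> s ?; rewrite ler_norml; lra.
  - exists (rep x - rho), (rep x - rho / 2); split=> //; first lra.
    by move=> s ?; rewrite ler_norml; lra.
have d2 : 0 < d / 2 by lra.
have [e e0 He] := near_one C pq pqi d2.
have [|eps [v [/andP[eps0 epse] vH1 vE [v1 v2]]]] := aXi (d := Num.min e (d / 2)).
  by rewrite lt_min e0.
move: epse; rewrite lt_min => /andP[epse epsd].
have [|s sI sv] := He eps v _ vH1 vE; first by rewrite eps0.
have [x' [y' [xy' xx' vy']]] := v1 (proj s).
have md : mdist x (proj s) <= rho.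
  rewrite -{1}(proj_rep x); apply: le_trans (proj_lip _ _ _) _.
  by rewrite distrC; exact: pqr.
move: xx' vy'; rewrite !lt_min => /andP[_ xx'] /andP[_ vy'].
exists x', y'; split=> //.
  by apply: le_lt_trans (metric_triangle _ (proj s) _) _; lra.
by move: sv vy'; rewrite !ltr_norml; lra.
Qed.

(** The functions come close to y1 and to y2 near x; on the lifted interval between these two places
    they also take the value y. *)
Lemma approx_interval x y1 y2 y : Xi x y1 -> Xi x y2 -> y1 <= y <= y2 -> Xi x y.
Proof.
move=> X1 X2 y12; apply: (closed_graph BXi) => d d0.
(* If y is within d of y1 or y2, that graph point already serves. Otherwise y lies strictly between
   the values taken near y1 and y2. *)
have [y1y|y1y] := ltP y (y1 + d).
  by exists x, y1; split=> //; rewrite ?mdistxx// ltr_norml; lra.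
have [y2y|y2y] := ltP (y2 - d) y.
  by exists x, y2; split=> //; rewrite ?mdistxx// ltr_norml; lra.
have d2 : 0 < d / 2 by lra.
have [eps [v [_ [cv _] _ [v1 v2]]]] := aXi d2.
have [x1 xx1 vx1] := v2 _ _ X1; have [x2 xx2 vx2] := v2 _ _ X2.
have [s1 s1x s1d] := proj_lift x x1; have [s2 s2x s2d] := proj_lift x x2.
have [s sx sy] : exists2 s, `|s - rep x| < d / 2 & v (proj s) = y.
  have cV := comp_proj_cont cv.
  have h1 : v (proj s1) < y by rewrite s1x; move: vx1; rewrite ltr_norml; lra.
  have h2 : y < v (proj s2) by rewrite s2x; move: vx2; rewrite ltr_norml; lra.
  have [s12|s21] := leP s1 s2.
    have [|s] := IVT (v := y) s12 (continuous_subspaceT cV).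
      by rewrite ge_min le_max /=; apply/andP; split; apply/orP; [left|right]; lra.
    rewrite in_itv /= => sI <-; exists s => //.
    by move: s1d s2d; rewrite ltr_norml !ler_norml; lra.
  have [|s] := IVT (v := y) (ltW s21) (continuous_subspaceT cV).
    by rewrite ge_min le_max /=; apply/andP; split; apply/orP; [right|left]; lra.
  rewrite in_itv /= => sI <-; exists s => //.
  by move: s1d s2d; rewrite ltr_norml !ler_norml; lra.
have [x' [y' [xy' xx' vy']]] := v1 (proj s).
exists x', y'; split=> //; last by rewrite -sy; lra.
apply: le_lt_trans (metric_triangle _ (proj s) _) _.
have md : mdist x (proj s) < d / 2.
  rewrite -{1}(proj_rep x); apply: le_lt_trans (proj_lip _ _ _) _.
  by rewrite distrC.
lra.
Qed.

Lemma approx_itv x : Xi x = `[inf (Xi x), sup (Xi x)]%classic /\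
  inf (Xi x) <= 1 <= sup (Xi x).
Proof.
have X1 := approx_one x; have cX := BXi.1 x.
have ne : Xi x !=set0 by exists 1.
have [ii si b] := compact_inf_sup cX ne.
split; last exact: b.
apply/seteqP; split=> y /=; rewrite in_itv /=; first exact: b.
exact: approx_interval.
Qed.

End approx.
End liminf.

Lemma fin_small (R : realType) (T : eqType) (s : seq T) (P : T -> R -> Prop) :
  (forall x, x \in s -> exists2 d, 0 < d & forall rho, 0 < rho < d -> P x rho) ->
  exists2 d, 0 < d & forall rho, 0 < rho < d -> forall x, x \in s -> P x rho.
Proof.
elim: s => [_|x s IH H]; first by exists 1.
have [|d d0 Hd] := IH; first by move=> y ys; apply: H; rewrite inE ys orbT.
have [d' d'0 Hd'] := H x (mem_head _ _).
exists (Num.min d d') => [|rho]; first by rewrite lt_min d0.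
rewrite lt_min => /andP[r0 /andP[rd rd']] y; rewrite inE => /predU1P[->|ys].
  by apply: Hd'; rewrite r0.
by apply: Hd => //; rewrite r0.
Qed.

(** Induction along the sorted sequence, A being moved to the right end of the first window. *)
Lemma disjoint_increments (R : realType) (K : R -> R) (rho A B : R) (s : seq R) :
  0 < rho -> (forall x y, x <= y -> K x <= K y) -> A <= B -> uniq s ->
  (forall x, x \in s -> A <= x - rho /\ x + rho <= B) ->
  (forall x y, x \in s -> y \in s -> x < y -> x + 2 * rho <= y) ->
  \sum_(x <- s) (K (x + rho) - K (x - rho)) <= K B - K A.
Proof.
move=> r0 Km + us Hin Hsep.
have ps : perm_eq (sort <=%O s) s by rewrite perm_sort.
rewrite -(perm_big _ ps) /=.
have {Hin} : forall x, x \in sort <=%O s -> A <= x - rho /\ x + rho <= B.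
  by move=> x; rewrite mem_sort; exact: Hin.
have {Hsep} : forall x y, x \in sort <=%O s -> y \in sort <=%O s -> x < y ->
    x + 2 * rho <= y.
  by move=> x y; rewrite !mem_sort; exact: Hsep.
have : sorted <%O (sort <=%O s) by rewrite sort_lt_sorted.
move: (sort _ s) => {ps us}t; elim: t A => [|x t IH] A.
  by move=> _ _ _ AB; rewrite big_nil subr_ge0 Km.
rewrite /= (path_sortedE lt_trans) => /andP[/allP xt st] Hsep Hin AB.
have [Ax xB] := Hin _ (mem_head _ _).
have IHt : \sum_(y <- t) (K (y + rho) - K (y - rho)) <= K B - K (x + rho).
  apply: IH => //.
  - by move=> y z yt zt; apply: Hsep; rewrite inE ?yt ?zt orbT.
  - move=> y yt; have ys : y \in x :: t by rewrite inE yt orbT.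
    have [_ yB] := Hin _ ys; split=> //.
    by have := Hsep _ _ (mem_head _ _) ys (xt _ yt); lra.
rewrite big_cons; have := Km _ _ Ax; lra.
Qed.

(** * Cost of one jump *)

(** The variables are values of H o v at four successive times: near H(1) = 0, near the two ends in
    either order, near 0 again. The three legs cost gm, gm + gp and gp (or gp, gm + gp and gm), each
    up to 2 e. *)
Lemma zigzag_cost (R : realType) (e gm gp ht hm hp ht' : R) : 0 <= gm -> 0 <= gp ->
  `|ht| < e -> `|hm + gm| < e -> `|hp - gp| < e -> `|ht'| < e ->
  2 * (gm + gp) - 6 * e <= `|hm - ht| + `|hp - hm| + `|ht' - hp| /\
  2 * (gm + gp) - 6 * e <= `|hp - ht| + `|hm - hp| + `|ht' - hm|.
Proof.
move=> gm0 gp0; rewrite !ltr_norml => /andP[? ?] /andP[? ?] /andP[? ?] /andP[? ?].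
have := ler_norm (hp - hm); have := ler_norm (- (hm - ht)).
have := ler_norm (- (ht' - hp)); rewrite !normrN.
have := ler_norm (hp - ht); have := ler_norm (- (hm - hp)).
by have := ler_norm (ht' - hm); rewrite !normrN; lra.
Qed.

(** With one return to 0 only, there remain the crossing gm + gp and one leg, at least the smaller
    of gm and gp; and gm + gp plus the minimum is 2 (gm + gp) minus the maximum. *)
Lemma half_zigzag_cost (R : realType) (e gm gp hm hp ht : R) : 0 <= gm -> 0 <= gp ->
  `|hm + gm| < e -> `|hp - gp| < e -> `|ht| < e ->
  2 * (gm + gp) - Num.max gm gp - 6 * e <= `|hp - hm| + `|ht - hp| /\
  2 * (gm + gp) - Num.max gm gp - 6 * e <= `|hp - hm| + `|ht - hm|.
Proof.
move=> gm0 gp0.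
have : gm <= Num.max gm gp by rewrite le_max lexx.
have : gp <= Num.max gm gp by rewrite le_max lexx orbT.
rewrite !ltr_norml => ? ? /andP[? ?] /andP[? ?] /andP[? ?].
have := ler_norm (hp - hm); have := ler_norm (ht - hm).
have := ler_norm (- (ht - hp)); rewrite !normrN; lra.
Qed.

Lemma maxr_leD (R : realType) (x y : R) : 0 <= x -> 0 <= y -> Num.max x y <= x + y.
Proof. by move=> x0 y0; rewrite ge_max lerDl lerDr x0 y0. Qed.

Lemma half_radius (R : realType) (r rho : R) : 0 < rho ->
  [/\ 0 < rho / 2, r - rho < r - rho / 2 & r + rho / 2 < r + rho].
Proof. by move=> rho0; split; lra. Qed.

Section zigzag.
Context (R : realType) (h K : R -> R) (gm gp r rho eta s1 s2 t1 t2 : R).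
Hypotheses (gm0 : 0 <= gm) (gp0 : 0 <= gp) (rho0 : 0 < rho).
Hypotheses (s1r : `|s1 - r| < rho / 2) (s2r : `|s2 - r| < rho / 2).
Hypotheses (hs1 : `|h s1 + gm| < eta / 6) (hs2 : `|h s2 - gp| < eta / 6).
Hypothesis HK : forall s t, s <= t -> `|h t - h s| <= K t - K s.

Let mono s t : s <= t -> K s <= K t.
Proof. by move=> st; rewrite -subr_ge0; apply: le_trans (HK st). Qed.

Lemma zigzag_path : r - rho <= t1 <= r - rho / 2 -> `|h t1| < eta / 6 ->
  r + rho / 2 <= t2 <= r + rho -> `|h t2| < eta / 6 ->
  2 * (gm + gp) - eta <= K (r + rho) - K (r - rho).
Proof.
move=> /andP[t1l t1r] ht1 /andP[t2l t2r] ht2.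
have K1 := mono t1l; have K2 := mono t2r.
move: s1r s2r; rewrite !ltr_norml => /andP[s1l s1u] /andP[s2l s2u].
have [c1 c2] := zigzag_cost gm0 gp0 ht1 hs1 hs2 ht2.
have [s12|s21] := leP s1 s2.
  have t1s : t1 <= s1 by lra.
  have st2 : s2 <= t2 by lra.
  by have := HK t1s; have := HK s12; have := HK st2; lra.
have t1s : t1 <= s2 by lra.
have st2 : s1 <= t2 by lra.
by have := HK t1s; have := HK (ltW s21); have := HK st2; lra.
Qed.

Lemma half_zigzag_right :
  r + rho / 2 <= t2 <= r + rho -> `|h t2| < eta / 6 ->
  2 * (gm + gp) - Num.max gm gp - eta <= K (r + rho) - K (r - rho).
Proof.
move=> /andP[t2l t2r] ht2; have K2 := mono t2r.
move: s1r s2r; rewrite !ltr_norml => /andP[s1l s1u] /andP[s2l s2u].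
have [c1 c2] := half_zigzag_cost gm0 gp0 hs1 hs2 ht2.
have [s12|s21] := leP s1 s2.
  have st2 : s2 <= t2 by lra.
  have ls1 : r - rho <= s1 by lra.
  by have := HK s12; have := HK st2; have := mono ls1; lra.
have st2 : s1 <= t2 by lra.
have ls1 : r - rho <= s2 by lra.
rewrite distrC in c2.
by have := HK (ltW s21); have := HK st2; have := mono ls1; lra.
Qed.

Lemma half_zigzag_left :
  r - rho <= t1 <= r - rho / 2 -> `|h t1| < eta / 6 ->
  2 * (gm + gp) - Num.max gm gp - eta <= K (r + rho) - K (r - rho).
Proof.
move=> /andP[t1l t1r] ht1; have K2 := mono t1l.
move: s1r s2r; rewrite !ltr_norml => /andP[s1l s1u] /andP[s2l s2u].
have [c1 c2] := half_zigzag_cost gm0 gp0 hs1 hs2 ht1.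
have [s12|s21] := leP s1 s2.
  have st2 : t1 <= s1 by lra.
  have ls1 : s2 <= r + rho by lra.
  rewrite (distrC (h t1)) in c2.
  by have := HK s12; have := HK st2; have := mono ls1; lra.
have st2 : t1 <= s2 by lra.
have ls1 : s1 <= r + rho by lra.
rewrite distrC (distrC (h t1)) in c1.
by have := HK (ltW s21); have := HK st2; have := mono ls1; lra.
Qed.

End zigzag.

Section liminf_cost.
Context (R : realType) (M : domain R) (F : R -> R).
Hypothesis F_cont : continuous F.
Hypothesis F_ge0 : forall v, 0 <= F v.
Hypothesis F_eq0 : forall v, F v = 0 <-> v = 1.
Hypothesis F_infty : (0 < limf_einf (fun v => (F v)%:E) (@abs_infty R))%E.
Notation lo := (lo M).
Notation hi := (hi M).
Notation proj := (proj M).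
Notation Hp := (Hp F).
Notation G := (G F).
Implicit Types (Xi : pt M -> set R) (v : pt M -> R) (x : pt M).

Lemma graph_close_le v Xi (d d' : R) : d <= d' ->
  graph_close v Xi d -> graph_close v Xi d'.
Proof.
move=> dd [h1 h2]; split=> [x|x y Xxy].
  have [x' [y' [? ? ?]]] := h1 x; exists x', y'; split=> //; lra.
by have [x' ? ?] := h2 _ _ Xxy; exists x'; lra.
Qed.

(** A local lower bound for the energy accumulated in the window of radius rho around x. It is
    required for every K dominating the increments, so that one K can serve all points at once. *)
Definition pays (C : R) Xi x (c rho d : R) : Prop :=
  forall eps v (K : R -> R), 0 < eps < d -> in_H1 v -> (E_eps F eps v <= C%:E)%E ->
    graph_close v Xi d ->
    (forall s t, s <= t -> `|Hp (v (proj t)) - Hp (v (proj s))| <= K t - K s) ->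
    c <= K (rep x + rho) - K (rep x - rho).

(** The ends of Xi(x) are nearly attained within rho/2 of x, and values near 1 are sought at
    distance rho/2 to rho, so the order of these times is known. The radius comes before the
    closeness d because the windows of several points must first be made disjoint. *)
Lemma local_cost (C : R) Xi x (xm xp eta : R) : Xi x xm -> Xi x xp ->
  xm <= 1 -> 1 <= xp -> 0 < eta ->
  exists2 rho0, 0 < rho0 & forall rho, 0 < rho < rho0 -> exists2 d, 0 < d &
    pays C Xi x (2 * (G xm + G xp) - (on_bdry x)%:R * Num.max (G xm) (G xp) - eta) rho d.
Proof.
move=> Xm Xp xm1 xp1 eta0.
have eta6 : 0 < eta / 6 by lra.
have [dm dm0 Hm] := cont_delta (Hp_cont F_cont (x := xm)) eta6.
have [dp dp0 Hpp] := cont_delta (Hp_cont F_cont (x := xp)) eta6.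
have [d1 d10 H1] := cont_delta (Hp_cont F_cont (x := 1)) eta6.
have Gm0 := G_ge0 F xm; have Gp0 := G_ge0 F xp.
rewrite (Hp_GN F_cont xm1) in Hm; rewrite (Hp_G F xp1) in Hpp; rewrite Hp1 in H1.
have [rho0 rho00 Hrho] := inner_near x.
exists rho0 => // rho rr; have r0 : 0 < rho by case/andP: rr.
(* On each side of [x] lying in the domain, [v] comes close to 1. *)
have side p q : p < q -> inner M p q -> exists2 d, 0 < d & forall eps v,
    0 < eps < d -> in_H1 v -> (E_eps F eps v <= C%:E)%E ->
    exists2 t, p <= t <= q & `|Hp (v (proj t))| < eta / 6.
  move=> pq pqi; have [d d0 Hd] := near_one F_cont F_ge0 F_eq0 F_infty C pq pqi d10.
  exists d => // eps v ed vH vE; have [t tpq vt] := Hd _ _ ed vH vE.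
  by exists t => //; rewrite -[X in `|X|]subr0; exact: H1.
have spikes d v : d <= dm -> d <= dp -> d <= rho / 2 -> graph_close v Xi d ->
    exists s1 s2, [/\ `|s1 - rep x| < rho / 2, `|s2 - rep x| < rho / 2,
      `|Hp (v (proj s1)) + G xm| < eta / 6 & `|Hp (v (proj s2)) - G xp| < eta / 6].
  move=> ddm ddp drho [_ v2].
  have [x1 xx1 vx1] := v2 _ _ Xm; have [x2 xx2 vx2] := v2 _ _ Xp.
  have [s1 s1x s1d] := proj_lift x x1; have [s2 s2x s2d] := proj_lift x x2.
  exists s1, s2; split.
  - exact: le_lt_trans s1d (lt_le_trans xx1 drho).
  - exact: le_lt_trans s2d (lt_le_trans xx2 drho).
  - by rewrite s1x -[G xm]opprK; apply: Hm; exact: lt_le_trans vx1 ddm.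
  - by rewrite s2x; apply: Hpp; exact: lt_le_trans vx2 ddp.
have min4 (a b c e : R) : 0 < a -> 0 < b -> 0 < c -> 0 < e ->
    exists d, [/\ 0 < d, d <= a, d <= b, d <= c & d <= e].
  move=> a0 b0 c0 e0; exists (Num.min (Num.min a b) (Num.min c e)).
  by split; rewrite ?lt_min ?a0 ?b0 ?c0 ?e0 // !ge_min lexx ?orbT.
have [rho2 rl rr'] := half_radius (rep x) r0.
have := Hrho rho rr => /=.
case=> [[/negPf -> [il ir]]|[-> _ ir]|[-> _ il]]; rewrite ?mul1r ?mul0r ?subr0.
- have [dl dl0 Hl] := side _ _ rl il; have [dr dr0 Hr] := side _ _ rr' ir.
  have [d' [d'0 d'm d'p d'r d'l]] := min4 _ _ _ _ dm0 dp0 rho2 dl0.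
  exists (Num.min d' dr) => [|eps v K]; first by rewrite lt_min d'0.
  rewrite lt_min => /andP[e0 /andP[ed edr]] vH vE vc HK.
  have {}vc : graph_close v Xi d' by apply: graph_close_le vc; rewrite ge_min lexx.
  have [s1 [s2 [s1r s2r hs1 hs2]]] := spikes d' v d'm d'p d'r vc.
  have [|t1 t1I ht1] := Hl eps v _ vH vE; first by rewrite e0 (lt_le_trans ed).
  have [|t2 t2I ht2] := Hr eps v _ vH vE; first by rewrite e0.
  exact: (@zigzag_path _ (fun s => Hp (v (proj s))) K _ _ _ _ _ s1 s2 t1 t2).
- have [dr dr0 Hr] := side _ _ rr' ir.
  have [d' [d'0 d'm d'p d'r d'l]] := min4 _ _ _ _ dm0 dp0 rho2 dr0.
  exists d' => // eps v K /andP[e0 ed] vH vE vc HK.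
  have [s1 [s2 [s1r s2r hs1 hs2]]] := spikes d' v d'm d'p d'r vc.
  have [|t2 t2I ht2] := Hr eps v _ vH vE; first by rewrite e0 (lt_le_trans ed).
  exact: (@half_zigzag_right _ (fun s => Hp (v (proj s))) K _ _ _ _ _ s1 s2 t2).
- have [dr dr0 Hr] := side _ _ rl il.
  have [d' [d'0 d'm d'p d'r d'l]] := min4 _ _ _ _ dm0 dp0 rho2 dr0.
  exists d' => // eps v K /andP[e0 ed] vH vE vc HK.
  have [s1 [s2 [s1r s2r hs1 hs2]]] := spikes d' v d'm d'p d'r vc.
  have [|t2 t2I ht2] := Hr eps v _ vH vE; first by rewrite e0 (lt_le_trans ed).
  exact: (@half_zigzag_left _ (fun s => Hp (v (proj s))) K _ _ _ _ _ s1 s2 t2).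
Qed.

End liminf_cost.

(** * Sum over the jumps *)

Section liminf_sum.
Context (R : realType) (M : domain R) (F : R -> R).
Hypothesis F_cont : continuous F.
Hypothesis F_ge0 : forall v, 0 <= F v.
Hypothesis F_eq0 : forall v, F v = 0 <-> v = 1.
Hypothesis F_infty : (0 < limf_einf (fun v => (F v)%:E) (@abs_infty R))%E.
Notation lo := (lo M).
Notation hi := (hi M).
Notation proj := (proj M).
Notation Hp := (Hp F).
Notation G := (G F).
Implicit Types (Xi : pt M -> set R) (v : pt M -> R) (x : pt M).

Lemma pays_le (C : R) Xi x (c rho d d' : R) : d' <= d ->
  pays F C Xi x c rho d -> pays F C Xi x c rho d'.
Proof.
move=> dd Hd eps v K /andP[e0 ed] vH vE vc HK; apply: (Hd eps v) => //.
  by rewrite e0 (lt_le_trans ed).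
exact: graph_close_le vc.
Qed.

(** On the torus the total energy bounds the accumulated energy only over a length at most 1. As rep
    x < 1, small windows fit into [-rho, 1 - rho], the one around 0 straddling the cut. *)
Lemma window (s : seq (pt M)) : exists2 d, 0 < d & forall rho, 0 < rho < d ->
  exists B, [/\ lo - rho <= B, forall x, x \in s -> rep x + rho <= B
    & M = Torus -> B <= lo - rho + 1].
Proof.
have [MT|nM] := pselect (M = Torus).
  have [|d d0 Hd] := @fin_small R _ s (fun x rho => rep x + rho <= 1 - rho).
    move=> x _; have x1 : rep x < 1.
      case: M x MT => [l r lr|] x // _.
      by have := repP x; rewrite /= in_itv => /andP[].
    exists ((1 - rep x) / 2) => [|rho]; lra.
  exists (Num.min d 1) => [|rho]; first by rewrite lt_min d0 ltr01.
  rewrite lt_min => /andP[r0 /andP[rd r1]]; exists (1 - rho); split.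
  - by rewrite /lo MT; lra.
  - by move=> x xs; apply: Hd => //; rewrite r0.
  - by rewrite /lo MT => _; lra.
exists 1 => // rho /andP[r0 r1]; exists (hi + rho); split=> //.
- by have := lo_hi M; lra.
- by move=> x _; have /andP[? ?] := rep_itv x; lra.
Qed.

(** First the radius is fixed, so that the windows are disjoint and fit into one period, then the
    closeness. A single v then pays at every point of s, with a loss eta at each and at most e in
    all. *)
Lemma approx_sum (C : R) Xi (s : seq (pt M)) : in_B Xi -> approximable F C Xi ->
  uniq s -> \sum_(x <- s) jump_cost F Xi x <= C.
Proof.
move=> BXi aXi us.
have itvXi := approx_itv F_cont F_ge0 F_eq0 F_infty BXi aXi.
apply/ler_addgt0Pr => e e0.
pose eta := e / ((size s)%:R + 1).
have sz0 : 0 < (size s)%:R + 1 :> R by rewrite ltr_wpDl.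
have eta0 : 0 < eta by rewrite divr_gt0.
have eta_s : eta * (size s)%:R <= e.
  by rewrite /eta mulrAC ler_pdivrMr// ler_wpM2l ?(ltW e0)//; lra.
have [|d1 d10 H1] := @fin_small R _ s (fun x rho => exists2 d, 0 < d &
    pays F C Xi x (jump_cost F Xi x - eta) rho d).
  move=> x _; have [E b] := itvXi x; have /andP[b1 b2] := b.
  have Xm : `[inf (Xi x), sup (Xi x)]%classic (inf (Xi x)) by rewrite /= in_itv /=; lra.
  have Xp : `[inf (Xi x), sup (Xi x)]%classic (sup (Xi x)) by rewrite /= in_itv /=; lra.
  rewrite -E in Xm Xp.
  exact: local_cost.
have [|d2 d20 H2] := @fin_small R _ s (fun x rho =>
    forall y, y \in s -> y != x -> 2 * rho <= `|rep x - rep y|).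
  move=> x xs.
  have [|d d0 Hd] := @fin_small R _ s (fun y rho => y != x -> 2 * rho <= `|rep x - rep y|).
    move=> y ys; have [->|yx] := eqVneq y x; first by exists 1.
    exists (`|rep x - rep y| / 2) => [|rho /andP[_ ?] _]; last lra.
    by rewrite divr_gt0// normr_gt0 subr_eq0 (inj_eq val_inj) eq_sym.
  by exists d => // rho rd y ys; exact: Hd.
have [d3 d30 H3] := window s.
pose rho := Num.min d1 (Num.min d2 d3) / 2.
have m0 : 0 < Num.min d1 (Num.min d2 d3) by rewrite !lt_min d10 d20.
have rho0 : 0 < rho by rewrite /rho; lra.
have : rho < Num.min d1 (Num.min d2 d3) by rewrite /rho; lra.
rewrite !lt_min => /and3P[r1 r2 r3].
have [|B [AB sB TB]] := H3 rho; first by rewrite rho0.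
have [|d4 d40 H4] := @fin_small R _ s
    (fun x d => pays F C Xi x (jump_cost F Xi x - eta) rho d).
  move=> x xs; have [|d d0 Hd] := H1 rho _ x xs; first by rewrite rho0.
  by exists d => // d' /andP[_ d'd]; apply: pays_le Hd; exact: ltW.
have [|eps [v [/andP[eps0 epsd] vH vE vc]]] := aXi (d4 / 2); first by lra.
have d4' : 0 < d4 / 2 < d4 by lra.
have [K [K1 K2 _]] := energy_primitive F_cont F_ge0 eps0 vH.
have Km (a b : R) : a <= b -> K a <= K b.
  by move=> xy; rewrite -subr_ge0; apply: le_trans (K1 _ _ xy).
have KC : K B - K (lo - rho) <= C.
  by rewrite -lee_fin; apply: le_trans vE; apply: K2.
apply: (@le_trans _ _ (\sum_(x <- s) ((K (rep x + rho) - K (rep x - rho)) + eta))).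
  rewrite big_seq [leRHS]big_seq; apply: ler_sum => x xs.
  by rewrite -lerBlDr; apply: (H4 _ d4' x xs eps v) => //; rewrite eps0.
rewrite big_split /= big_const_seq count_predT iter_addr addr0 -mulr_natr.
apply: lerD => //; apply: le_trans KC.
rewrite -(big_map (@rep R M) xpredT (fun r => K (r + rho) - K (r - rho))).
apply: disjoint_increments => //.
- by rewrite map_inj_uniq//; exact: val_inj.
- move=> _ /mapP[x xs ->]; split; last exact: sB.
  by have /andP[? ?] := rep_itv x; lra.
- move=> _ _ /mapP[x xs ->] /mapP[y ys ->] xy.
  have := H2 rho _ x xs y ys; rewrite rho0 r2 => /(_ isT).
  have yx : y != x by apply/eqP => yx; move: xy; rewrite yx ltxx.
  by move=> /(_ yx); rewrite ltr0_norm; lra.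
Qed.

Lemma jump_cost_ge Xi x : G (inf (Xi x)) + G (sup (Xi x)) <= jump_cost F Xi x.
Proof.
rewrite /jump_cost; have g1 := G_ge0 F (inf (Xi x)); have g2 := G_ge0 F (sup (Xi x)).
have mx1 := maxr_leD g1 g2.
by case: (on_bdry x); rewrite ?mul1r ?mul0r; lra.
Qed.

Lemma jump_cost_gt0 Xi x : Xi x = `[inf (Xi x), sup (Xi x)]%classic ->
  inf (Xi x) <= 1 <= sup (Xi x) -> Xi x <> [set 1] -> 0 < jump_cost F Xi x.
Proof.
move=> E /andP[i1 s1] n1; apply: lt_le_trans (jump_cost_ge _ _).
have [i1'|i1'] := eqVneq (inf (Xi x)) 1; last first.
  by rewrite ltr_pwDl ?G_ge0// G_gt0.
have [s1'|s1'] := eqVneq (sup (Xi x)) 1; last first.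
  by rewrite ltr_wpDl ?G_ge0// G_gt0.
by rewrite i1' s1' set_itv1 in E.
Qed.

Lemma approx_A0 (C : R) Xi : in_B Xi -> approximable F C Xi -> in_A0 Xi.
Proof.
move=> BXi aXi.
have itvXi := approx_itv F_cont F_ge0 F_eq0 F_infty BXi aXi.
split.
  split=> // x; have [E b] := itvXi x.
  by exists (inf (Xi x)), (sup (Xi x)); split=> //; lra.
exists (sing_set Xi); split; last 2 first.
- by move=> x /contrapT.
- move=> x nx; have [E b] := itvXi x; exists (inf (Xi x)), (sup (Xi x)); split=> //.
  rewrite lt_neqAle; apply/andP; split; last lra.
  apply/eqP => is_; apply: nx; rewrite is_ set_itv1 in E.
  rewrite E; have -> // : sup (Xi x) = 1 by lra.
have -> : sing_set Xi = \bigcup_n [set x | sing_set Xi x /\ n.+1%:R^-1 < jump_cost F Xi x].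
  apply/seteqP; split=> [x nx|x [n _ []]//].
  have [E b] := itvXi x; have c0 := jump_cost_gt0 E b nx.
  exists (Num.truncn (jump_cost F Xi x)^-1) => //; split=> //=.
  rewrite invf_plt ?posrE//; exact: truncnS_gt.
apply: bigcup_countable => [|n _]; first exact: countableP.
apply: finite_set_countable; apply: contrapT => inf_.
(* More than |C| (n + 1) points, each of cost above 1 / (n + 1), would violate the bound C. *)
have [B BX Bsz] := infinite_set_fset (Num.truncn (`|C| * n.+1%:R)).+1 inf_.
have := approx_sum BXi aXi (finmap.fset_uniq B).
apply/negP; rewrite -ltNge.
apply: (@lt_le_trans _ _ (\sum_(x <- finmap.enum_fset B) n.+1%:R^-1)).
  rewrite big_const_seq count_predT iter_addr addr0 -(mulr_natr (n.+1%:R^-1)) mulrC.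
  rewrite ltr_pdivlMr//; apply: (@le_lt_trans _ _ (`|C| * n.+1%:R)).
    by rewrite ler_wpM2r// ler_norm.
  apply: lt_le_trans (truncnS_gt _) _; by rewrite ler_nat.
rewrite big_seq [leRHS]big_seq; apply: ler_sum => x xB.
by have [_ /ltW] := BX x xB.
Qed.

End liminf_sum.

(** * Graph convergence *)

Section hausdorff.
Context (R : realType) (M : domain R).
Implicit Types (Xi : pt M -> set R) (v : pt M -> R) (x : pt M).

Lemma prod_dist_bounds (z w : pt M * R) :
  [/\ mdist z.1 w.1 <= prod_dist z w, `|z.2 - w.2| <= prod_dist z w &
    prod_dist z w <= mdist z.1 w.1 + `|z.2 - w.2|].
Proof.
rewrite /prod_dist; set a := mdist _ _; set b := `|_|.
have a0 : 0 <= a by exact: mdist_ge0.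
have b0 : 0 <= b by exact: normr_ge0.
have a2 := sqr_ge0 a; have b2 := sqr_ge0 b; have ab := mulr_ge0 a0 b0.
have p0 := sqrtr_ge0 (a ^+ 2 + b ^+ 2).
split.
- by rewrite -[leLHS]ger0_norm// -sqrtr_sqr ler_sqrt ?lerDl ?addr_ge0.
- by rewrite -[leLHS]ger0_norm// -sqrtr_sqr ler_sqrt ?lerDr ?addr_ge0.
- rewrite -[leRHS]ger0_norm ?addr_ge0// -sqrtr_sqr ler_sqrt ?sqr_ge0// sqrrD.
  by lra.
Qed.

Lemma close_of_dist v Xi (d : R) : (graph_dist (single v) Xi < d%:E)%E ->
  graph_close v Xi d.
Proof.
rewrite /graph_dist /hausdorff_dist gt_max => /andP[h1 h2]; split.
  move=> x.
  have : (ereal_inf [set (prod_dist (x, v x) w)%:E | w in graph Xi] < d%:E)%E.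
    apply: le_lt_trans h1; apply: ereal_sup_ubound => /=.
    by exists (x, v x).
  move=> /ereal_inf_lt[_ [[x' y'] Xi' <-]]; rewrite lte_fin => hd.
  have [/= b1 b2 _] := prod_dist_bounds (x, v x) (x', y').
  by exists x', y'; split=> //; [exact: le_lt_trans b1 hd|exact: le_lt_trans b2 hd].
move=> x y Xxy.
have : (ereal_inf [set (prod_dist z (x, y))%:E | z in graph (single v)] < d%:E)%E.
  apply: le_lt_trans h2; apply: ereal_sup_ubound => /=.
  by exists (x, y).
move=> /ereal_inf_lt[_ [[x' y'] E <-]]; rewrite lte_fin.
have {E}-> : y' = v x' by exact: E.
move=> hd.
have [/= b1 b2 _] := prod_dist_bounds (x', v x') (x, y).
exists x'; [rewrite metric_sym|]; [exact: le_lt_trans b1 hd|exact: le_lt_trans b2 hd].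
Qed.

Lemma dist_of_close v Xi (d : R) : graph_close v Xi d ->
  (graph_dist (single v) Xi <= (2 * d)%:E)%E.
Proof.
move=> [c1 c2]; rewrite /graph_dist /hausdorff_dist ge_max; apply/andP; split.
  apply: ge_ereal_sup => _ [[x y] E <-]; have {E}-> : y = v x by exact: E.
  have [x' [y' [Xi' xx' vy']]] := c1 x.
  apply: ereal_inf_le; exists (prod_dist (x, v x) (x', y'))%:E; first by exists (x', y').
  have [/= _ _ b3] := prod_dist_bounds (x, v x) (x', y').
  by rewrite lee_fin; lra.
apply: ge_ereal_sup => _ [[x y] Xxy <-].
have [x' xx' vy] := c2 _ _ Xxy.
apply: ereal_inf_le; exists (prod_dist (x', v x') (x, y))%:E; first by exists (x', v x').
have [/= _ _ b3] := prod_dist_bounds (x', v x') (x, y).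
by rewrite lee_fin; rewrite metric_sym in xx'; lra.
Qed.

Lemma graph_dist_ge0 v Xi (x : pt M) : (0 <= graph_dist (single v) Xi)%E.
Proof.
rewrite /graph_dist /hausdorff_dist le_max; apply/orP; left.
apply: (@le_trans _ _ (ereal_inf [set (prod_dist (x, v x) w)%:E | w in graph Xi])).
  by apply: le_ereal_inf_tmp => _ [w _ <-]; rewrite lee_fin sqrtr_ge0.
by apply: ereal_sup_ubound; exists (x, v x).
Qed.

Lemma graph_cvgP (v : R -> pt M -> R) Xi : graph_cvg v Xi <->
  forall d, 0 < d -> \forall eps \near 0^'+, graph_close (v eps) Xi d.
Proof.
split=> [|H].
  move=> /fine_cvgP[fin /cvgrPdist_lt c] d d0; near=> eps.
  apply: close_of_dist.
  have f : graph_dist (single (v eps)) Xi \is a fin_num by near: eps; exact: fin.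
  rewrite -(fineK f) lte_fin.
  have : `|0 - fine (graph_dist (single (v eps)) Xi)| < d.
    by near: eps; exact: c.
  by rewrite sub0r normrN; apply: le_lt_trans; exact: ler_norm.
have x0 := proj M 0.
have fin (eps d : R) : graph_close (v eps) Xi d ->
    graph_dist (single (v eps)) Xi \is a fin_num.
  move=> /dist_of_close h; rewrite ge0_fin_numE ?graph_dist_ge0//.
  by apply: le_lt_trans h _; rewrite ltry.
apply/fine_cvgP; split.
  by near=> eps; apply: (fin eps 1); near: eps; exact: H.
apply/cvgrPdist_le => e e0; near=> eps.
have c : graph_close (v eps) Xi (e / 2) by near: eps; apply: H; rewrite divr_gt0.
rewrite sub0r normrN ger0_norm; last by apply: fine_ge0; exact: graph_dist_ge0.
rewrite -lee_fin fineK; last exact: fin c.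
by apply: le_trans (dist_of_close c) _; rewrite lee_fin; lra.
Unshelve. all: by end_near. Qed.

Lemma frequently_lt (f : R -> \bar R) (C : R) (P : set R) :
  (limf_einf f 0^'+ < C%:E)%E -> (\forall eps \near 0^'+, P eps) ->
  exists2 eps, P eps & (f eps < C%:E)%E.
Proof.
rewrite limf_einfE => h hP.
have : (ereal_inf (f @` P) < C%:E)%E.
  by apply: le_lt_trans h; apply: ereal_sup_ubound; exists P.
by move=> /ereal_inf_lt[_ [eps Peps <-] ?]; exists eps.
Qed.

(** Lower semicontinuity of min Xi at a, by compactness of the graph. Near a graph point over a the
    height exceeds min Xi(a) - e; near one over x <> a the premise fails as soon as d is below half
    the distance from a to x. *)
Lemma inf_usc Xi (a : pt M) (e : R) : in_B Xi -> Xi a !=set0 -> 0 < e ->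
  exists2 d, 0 < d & forall x y, mdist a x < d -> Xi x y -> inf (Xi a) - e < y.
Proof.
move=> [cX cG] Xa e0.
have [_ _ infP] := compact_inf_sup (cX a) Xa.
pose P (d : R) (z : pt M * R) := mdist a z.1 < d -> inf (Xi a) - e < z.2.
have H : forall z, graph Xi z -> \forall z' \near z & d \near 0^'+, P d z'.
  move=> [x y] /= Xxy.
  have [ax|ax] := eqVneq a x.
    have yi : inf (Xi a) - e < y.
      rewrite -ax in Xxy; have /andP[yi _] := infP y Xxy.
      by rewrite ltrBlDr; apply: le_lt_trans yi _; rewrite ltrDl.
    exists ([set z | inf (Xi a) - e < z.2], setT); last by move=> [z d] [/= ? _] _.
    split; last exact: filterT.
    have : \forall y' \near y, inf (Xi a) - e < y' by exact: lt_nbhsr.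
    move=> ?; exists (setT, [set y' | inf (Xi a) - e < y']) => [|[? ?] []//].
    by split=> //; exact: filterT.
  have r0 : 0 < mdist a x by rewrite mdist_gt0.
  exists ([set z | mdist x z.1 < mdist a x / 2], [set d | d < mdist a x / 2]).
    split=> /=; last by apply: nbhs_right_lt; lra.
    exists ([set x' | mdist x x' < mdist a x / 2], setT) => [|[? ?] []//].
    split; last exact: filterT.
    apply/nbhs_ballP; exists (mdist a x / 2) => /=; first lra.
    by move=> x' ; rewrite ballEmdist.
  move=> [[x' y'] d] [/= h1 h2] h3.
  have := metric_triangle a x' x; rewrite (metric_sym x' x); lra.
move/compact_near_coveringP: cG => /(_ R (0 : R)^'+ P _ H) HP.
near ((0 : R)^'+) => d.
have HPd : graph Xi `<=` P d by near: d; exact: HP.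
by exists d => // x y axd Xxy; exact: (HPd (x, y)).
Unshelve. all: by end_near. Qed.

End hausdorff.

(** * The lower bound with the term b v(a)^2 *)

Section liminf_inequality.
Context (R : realType) (M : domain R) (F : R -> R).
Hypothesis F_cont : continuous F.
Hypothesis F_ge0 : forall v, 0 <= F v.
Hypothesis F_eq0 : forall v, F v = 0 <-> v = 1.
Hypothesis F_infty : (0 < limf_einf (fun v => (F v)%:E) (@abs_infty R))%E.
Variables (a : pt M) (b : R).
Hypothesis b_ge0 : 0 <= b.
Implicit Types (Xi : pt M -> set R) (v : pt M -> R) (x : pt M).

Lemma sum_E0 (C : R) Xi : in_A0 Xi ->
  (forall s : seq (pt M), uniq s -> \sum_(x <- s) jump_cost F Xi x <= C) ->
  (E_0 F Xi <= C%:E)%E.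
Proof.
move=> XA0 H; rewrite /E_0; case: asboolP => // _.
apply: ge_ereal_sup => _ [X [finX _] <-].
by rewrite fsbig_finite//= sumEFin lee_fin; apply: H; exact: finmap.fset_uniq.
Qed.

Lemma approx_E0 (C : R) Xi : in_B Xi -> approximable F C Xi -> (E_0 F Xi <= C%:E)%E.
Proof.
move=> BXi aXi; apply: sum_E0; first exact: approx_A0 aXi.
by move=> s us; apply: approx_sum.
Qed.

Definition approximable_b (C : R) Xi : Prop := forall d, 0 < d -> exists eps v,
  [/\ 0 < eps < d, in_H1 v, (E_eps_b F b a eps v <= C%:E)%E & graph_close v Xi d].

Lemma approximable_of_b (C : R) Xi : approximable_b C Xi -> approximable F C Xi.
Proof.
move=> H d d0; have [eps [v [ed vH vE vc]]] := H d d0; exists eps, v; split=> //.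
apply: le_trans vE; rewrite /E_eps_b leeDl// lee_fin mulr_ge0//; exact: sqr_ge0.
Qed.

(** With i = min Xi(a) >= 0 and v(a) > i - e one has v(a)^2 >= i^2 - 2 i e. So the term in b moves
    to the right-hand side: Xi is approximable without it at the level C - b i^2 + eta. For i < 0
    the bound v(a) > i - e would allow v(a) = 0. *)
Lemma approx_E0b (C : R) Xi : in_B Xi -> approximable_b C Xi ->
  (0 < b -> (E_0 F Xi < +oo)%E -> 0 <= inf (Xi a)) -> (E_0_b F b a Xi <= C%:E)%E.
Proof.
move=> BXi aXi Hb; have aXi' := approximable_of_b aXi.
have E0C := approx_E0 BXi aXi'; rewrite /E_0_b.
have [b0|b0] := eqVneq b 0; first by rewrite b0 mul0r adde0.
have {}b0 : 0 < b by rewrite lt_neqAle eq_sym b0.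
have i0 : 0 <= inf (Xi a) by apply: Hb => //; apply: le_lt_trans E0C _; rewrite ltry.
have Xa : Xi a !=set0 by exists 1; apply: (approx_one F_cont F_ge0 F_eq0 F_infty BXi aXi').
set i := inf (Xi a) in i0 *.
suff H : forall eta, 0 < eta -> (E_0 F Xi <= (C - b * i ^+ 2 + eta)%:E)%E.
  rewrite -leeBrDr// -EFinB; apply/lee_addgt0Pr => eta eta0.
  by rewrite -EFinD; exact: H.
move=> eta eta0; apply: approx_E0 => // d d0.
pose e := eta / (2 * b * (i + 1)).
have e0 : 0 < e by rewrite divr_gt0// !mulr_gt0//; lra.
have e2 : 0 < e / 2 by lra.
have [d' d'0 Hd'] := inf_usc BXi Xa e2.
pose d1 := Num.min d (Num.min d' (e / 2)).
have [|eps [v [/andP[eps0 epsd] vH vE vc]]] := aXi d1.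
  by rewrite !lt_min d0 d'0.
have [dd dd' de] : [/\ d1 <= d, d1 <= d' & d1 <= e / 2].
  by split; rewrite /d1 !ge_min lexx ?orbT.
exists eps, v; split=> //; [by rewrite eps0 (lt_le_trans epsd)| |exact: graph_close_le vc].
have [x' [y' [Xi' ax' vy']]] := vc.1 a.
have yi := Hd' _ _ (lt_le_trans ax' dd') Xi'; rewrite -/i in yi.
have va : i - e < v a by move: vy'; rewrite ltr_norml; lra.
(* For i <= e the left side is at most 0; otherwise v a > i - e > 0 may be squared. *)
have v2 : i ^+ 2 - 2 * i * e <= v a ^+ 2.
  have [ie|ie] := leP i e; first by have := sqr_ge0 (v a); nra.
  nra.
move: vE; rewrite /E_eps_b -leeBrDr// -EFinB => /le_trans; apply; rewrite lee_fin.
have ee : 2 * b * (i + 1) * e = eta by rewrite /e; field; rewrite !gt_eqF//; lra.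
nra.
Qed.

Lemma liminf_inequality (v : R -> pt M -> R) Xi :
  (forall eps, 0 < eps < 1 -> in_H1 (v eps)) -> in_B Xi -> graph_cvg v Xi ->
  ((0 < b -> (E_0 F Xi < +oo)%E -> 0 <= inf (Xi a)) ->
     (E_0_b F b a Xi <=
        limf_einf (fun eps => E_eps_b F b a eps (v eps)) 0^'+)%E) /\
  ((limf_einf (fun eps => E_eps_b F b a eps (v eps)) 0^'+ < +oo)%E -> in_A0 Xi).
Proof.
move=> vH BXi /graph_cvgP gc; set L := limf_einf _ _.
have aL (C : R) : (L < C%:E)%E -> approximable_b C Xi.
  move=> LC d d0.
  have [|eps [ed e1 vc] vE] := frequently_lt (P := [set eps | [/\ 0 < eps < d, eps < 1 &
    graph_close (v eps) Xi d]]) LC.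
    near=> eps; split; [apply/andP; split| |]; near: eps.
    - exact: nbhs_right_gt.
    - exact: nbhs_right_lt.
    - exact: nbhs_right_lt.
    - exact: gc.
  have [eps0 _] := andP ed.
  exists eps, (v eps); split=> //; last exact: ltW.
  by apply: vH; rewrite eps0.
split.
- move=> Hb; move: aL; case: (L) => [l| |] aL.
  + apply/lee_addgt0Pr => e e0; rewrite -EFinD; apply: approx_E0b => //.
    by apply: aL; rewrite lte_fin ltrDl.
  + by rewrite leey.
  (* A lower limit equal to -oo would allow C = -1, against the bound for the empty sum. *)
  + have /approximable_of_b aXi := aL (- 1) (ltNyr _).
    have := approx_sum F_cont F_ge0 F_eq0 F_infty BXi aXi (isT : uniq [::]).
    by rewrite big_nil => h; exfalso; move: h; lra.
- move: aL; case: (L) => [l| |] aL // _.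
  + apply: (approx_A0 F_cont F_ge0 F_eq0 F_infty BXi (C := l + 1)).
    by apply/approximable_of_b/aL; rewrite lte_fin ltrDl.
  + apply: (approx_A0 F_cont F_ge0 F_eq0 F_infty BXi (C := 0)).
    by apply/approximable_of_b/aL; rewrite ltNyr.
Unshelve. all: by end_near. Qed.

End liminf_inequality.

(** * Recovery sequences *)

Section glue.
Context (R : realType).

Definition glue (y : R) (f1 f2 : R -> R) (t : R) : R := if t <= y then f1 t else f2 t.

Lemma glue_cont (y : R) (f1 f2 : R -> R) : continuous f1 -> continuous f2 ->
  f1 y = f2 y -> continuous (glue y f1 f2).
Proof.
move=> c1 c2 e.
(* In this form continuity at y needs no case distinction. *)
have -> : glue y f1 f2 = fun t => f1 (Num.min t y) + f2 (Num.max t y) - f1 y.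
  apply/funext => t; rewrite /glue; case: (leP t y) => h; first by rewrite e; ring.
  by ring.
have cmin : continuous (fun t : R => Num.min t y).
  by move=> t; apply: continuous_min => //; exact: cvg_cst.
have cmax : continuous (fun t : R => Num.max t y).
  by move=> t; apply: continuous_max => //; exact: cvg_cst.
move=> t; apply: cvgB; last exact: cvg_cst.
apply: cvgD.
  by apply: (@continuous_comp _ _ _ (fun t : R => Num.min t y) f1); [exact: cmin|exact: c1].
by apply: (@continuous_comp _ _ _ (fun t : R => Num.max t y) f2); [exact: cmax|exact: c2].
Qed.

Lemma glue_measurable (x y z : R) (g1 g2 : R -> R) : x <= y -> y <= z ->
  measurable_fun `[x, y] g1 -> measurable_fun `[y, z] g2 ->
  measurable_fun `[x, z] (glue y g1 g2).
Proof.
move=> xy yz m1 m2.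
have -> : `[x, z]%classic = `[x, y]%classic `|` `]y, z]%classic.
  apply/seteqP; split=> t /=; rewrite !in_itv /=.
    by move=> /andP[-> ->]; case: (leP t y) => ?; [left|right].
  by case=> /andP[? ?]; lra.
apply/measurable_funU => //; split.
  apply: eq_measurable_fun m1 => t /set_mem /=; rewrite in_itv /= => /andP[_ h].
  by rewrite /glue h.
have m2' : measurable_fun `]y, z] g2.
  by apply: measurable_funS m2 => // t /=; rewrite !in_itv /=; lra.
apply: eq_measurable_fun m2' => t /set_mem /=; rewrite in_itv /= => /andP[h _].
by rewrite /glue leNgt h.
Qed.

End glue.

(** * Paths of controlled energy *)

Section paths.
Context (R : realType) (F : R -> R).
Hypothesis F_cont : continuous F.
Hypothesis F_ge0 : forall v, 0 <= F v.
Notation Hp := (Hp F).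

Definition C1 (phi : R -> R) : Prop :=
  (forall t : R, derivable phi t 1) /\ continuous (derive1 phi).

(** Integration by parts with its boundary terms, against C^1 functions that need not vanish at the
    ends. Unlike the weak derivative it is additive under gluing; on M the boundary terms disappear
    at the end. *)
Definition ibp (w g : R -> R) (x y : R) : Prop := forall phi, C1 phi ->
  itg (fun t => w t * derive1 phi t + g t * phi t) x y = w y * phi y - w x * phi x.

Definition ppath (eps x y : R) (w g : R -> R) (e : R) : Prop :=
  [/\ x <= y, continuous w,
     measurable_fun `[x, y] g /\ (exists c, forall t, x <= t <= y -> `|g t| <= c),
     ibp w g x y & itg (dens F eps w g) x y <= e].

Lemma C1_cont phi : C1 phi -> continuous phi.
Proof. by move=> [d _] t; apply: differentiable_continuous; apply/derivable1_diffP. Qed.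

Lemma ppath_ible (eps x y : R) (w g : R -> R) (e : R) : ppath eps x y w g e ->
  [/\ ible g x y, ible (fun t => g t ^+ 2) x y, ible (dens F eps w g) x y &
   forall phi, C1 phi -> ible (fun t => w t * derive1 phi t) x y /\
     ible (fun t => g t * phi t) x y].
Proof.
move=> [xy cw [mg [c gc]] _ _].
have ig : ible g x y by exact: ible_bounded gc.
have i2 : ible (fun t => g t ^+ 2) x y.
  apply: (@ible_bounded _ _ (c ^+ 2)); first exact: measurable_funX.
  by move=> t /gc h; rewrite normrX ler_sqr ?nnegrE// (le_trans _ h).
split=> //.
  apply: ibleD; apply: ibleZ => //.
  by apply: ible_cont => t; apply: (@continuous_comp _ _ _ w F); [exact: cw|exact: F_cont].
move=> phi Cphi; split.
  by apply: ible_cont => t; apply: cvgM; [exact: cw|exact: Cphi.2].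
apply: (@ibleM_bounded _ _ _ c) => //.
by apply: ible_cont; exact: C1_cont.
Qed.

Lemma ppath_le (eps x y : R) (w g : R -> R) (e e' : R) : e <= e' ->
  ppath eps x y w g e -> ppath eps x y w g e'.
Proof. by move=> ee [? ? ? ? h]; split=> //; exact: le_trans h ee. Qed.

Lemma ppath_glue (eps x y z : R) (w1 g1 w2 g2 : R -> R) (e1 e2 : R) :
  ppath eps x y w1 g1 e1 -> ppath eps y z w2 g2 e2 -> w1 y = w2 y ->
  ppath eps x z (glue y w1 w2) (glue y g1 g2) (e1 + e2).
Proof.
move=> p1 p2 E.
have [i1 _ d1 f1] := ppath_ible p1; have [i2 _ d2 f2] := ppath_ible p2.
have [xy c1 [m1 [k1 b1]] h1 en1] := p1; have [yz c2 [m2 [k2 b2]] h2 en2] := p2.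
have xz : x <= z by exact: le_trans yz.
have w1E t : x <= t <= y -> glue y w1 w2 t = w1 t by rewrite /glue => /andP[_ ->].
have g1E t : x <= t <= y -> glue y g1 g2 t = g1 t by rewrite /glue => /andP[_ ->].
have w2E t : y < t < z -> w2 t = glue y w1 w2 t.
  by rewrite /glue leNgt => /andP[-> _].
have g2E t : y < t < z -> g2 t = glue y g1 g2 t.
  by rewrite /glue leNgt => /andP[-> _].
have wz : glue y w1 w2 z = w2 z.
  by rewrite /glue; case: leP => // zy; have -> : z = y by lra.
(* The integrand of [ibp] and the energy density both depend pointwise on w and g, so one additivity
   statement serves both. *)
have cat (A : (R -> R) -> (R -> R) -> R -> R) :
    ible (A w1 g1) x y -> ible (A w2 g2) y z ->
    (forall w g w' g' t, w t = w' t -> g t = g' t -> A w g t = A w' g' t) ->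
    itg (A (glue y w1 w2) (glue y g1 g2)) x z = itg (A w1 g1) x y + itg (A w2 g2) y z.
  move=> iA1 iA2 HA.
  have [iz <-] := eq_itg_oo yz iA2 (fun t ht => HA _ _ _ _ t (w2E t ht) (g2E t ht)).
  have E1 t : x <= t <= y -> A w1 g1 t = A (glue y w1 w2) (glue y g1 g2) t.
    by move=> ht; apply: HA; rewrite ?w1E ?g1E.
  rewrite (eq_itg E1); apply: itg_cat => //.
  by apply: ible_cat iz => //; apply: eq_ible iA1.
split=> //.
- exact: glue_cont.
- split; first exact: glue_measurable.
  exists (Num.max k1 k2) => t txz; rewrite /glue; case: (leP t y) => ty; rewrite le_max.
    by rewrite b1 ?orTb//; lra.
  by rewrite b2 ?orbT//; lra.
- move=> phi Cphi; have [f11 f12] := f1 phi Cphi; have [f21 f22] := f2 phi Cphi.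
  rewrite (cat (fun w g t => w t * derive1 phi t + g t * phi t)).
  + rewrite h1// h2// wz w1E ?lexx// E; lra.
  + exact: ibleD.
  + exact: ibleD.
  + by move=> w g w' g' t -> ->.
- rewrite (cat (dens F eps)) ?lerD// => w g w' g' t ww gg.
  by rewrite /dens ww gg.
Qed.

Lemma affine_ibp (p s x0 x y : R) : x <= y ->
  ibp (fun t => p + s * (t - x0)) (fun=> s) x y.
Proof.
move=> xy phi [dphi cphi].
have dw (t : R) : is_derive t (1 : R) (fun t => p + s * (t - x0)) s.
  have h : is_derive t (1 : R) (fun t => p + s * (t - x0)) (0 + s *: (1 - 0)).
    by apply: is_deriveD.
  by move: h; rewrite add0r subr0 /GRing.scale /= mulr1.
have cw : continuous (fun t : R => p + s * (t - x0)).
  by move=> t; apply: differentiable_continuous; apply/derivable1_diffP; have [] := dw t.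
have cD : continuous (fun t => (p + s * (t - x0)) * derive1 phi t + s * phi t).
  move=> t; apply: cvgD; apply: cvgM.
  - exact: cw.
  - exact: cphi.
  - exact: cvg_cst.
  - exact: (C1_cont (conj dphi cphi)).
have dD (t : R) : is_derive t (1 : R) (fun t => (p + s * (t - x0)) * phi t)
    ((p + s * (t - x0)) * derive1 phi t + s * phi t).
  have dp : is_derive t (1 : R) phi (derive1 phi t).
    by apply: DeriveDef; [exact: dphi|rewrite derive1E].
  have := is_deriveM (dw t) dp.
  by rewrite /GRing.scale /= => h; rewrite (mulrC (phi t)) in h; exact: h.
exact: (itg_FTC xy cD dD).
Qed.

Lemma ppath_affine (eps p s x y m : R) : 0 < eps -> x <= y ->
  (forall t, x <= t <= y -> F (p + s * (t - x)) <= m) ->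
  ppath eps x y (fun t => p + s * (t - x)) (fun=> s)
    ((eps / 2 * s ^+ 2 + 1 / (2 * eps) * m) * (y - x)).
Proof.
move=> eps0 xy Fm.
have cw : continuous (fun t : R => p + s * (t - x)).
  move=> t; apply: cvgD; first exact: cvg_cst.
  apply: cvgMr; apply: cvgB => //; exact: cvg_cst.
split=> //.
- by split; [exact: measurable_cst|exists `|s|].
- exact: affine_ibp.
rewrite -itg_cst//; apply: itg_le.
- apply: ibleD; apply: ibleZ; first by apply: ible_cont => ?; exact: cvg_cst.
  apply: ible_cont => t; apply: (@continuous_comp _ _ _ (fun t : R => p + s * (t - x)) F).
    exact: cw.
  exact: F_cont.
- by apply: ible_cont => ?; exact: cvg_cst.
move=> t txy; rewrite /dens lerD2l ler_wpM2l ?Fm//.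
by rewrite divr_ge0//; lra.
Qed.

(* From p to q in time eps * tau with energy at most e, staying in [l, h] and visiting D;
   tau does not depend on eps since the energy is invariant under rescaling by eps. *)
Definition conn (D : set R) (l h p q e : R) : Prop :=
  exists2 tau, 0 <= tau & forall eps x, 0 < eps -> exists w g,
    [/\ ppath eps x (x + eps * tau) w g e, w x = p, w (x + eps * tau) = q,
       forall t, x <= t <= x + eps * tau -> l <= w t <= h
     & forall v, D v -> exists2 t, x <= t <= x + eps * tau & w t = v].

Lemma conn_le (D D' : set R) (l h l' h' p q e e' : R) :
  D' `<=` D -> l' <= l -> h <= h' -> e <= e' ->
  conn D l h p q e -> conn D' l' h' p q e'.
Proof.
move=> DD ll hh ee [tau tau0 H]; exists tau => // eps x eps0.
have [w [g [P wx wy rg vis]]] := H eps x eps0; exists w, g; split=> //.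
- exact: ppath_le P.
- by move=> t /rg; lra.
- by move=> v /DD; exact: vis.
Qed.

Lemma conn_refl (D : set R) (l h p : R) : D `<=` [set p] -> l <= p -> p <= h ->
  conn D l h p p 0.
Proof.
move=> DD lp ph; exists 0 => // eps x eps0.
rewrite mulr0 addr0; exists (fun t => p + 0 * (t - x)), (fun=> 0).
rewrite mul0r addr0; split=> //.
- have := @ppath_affine eps p 0 x x (F p) eps0 (lexx x).
  rewrite subrr mulr0; apply=> t _; by rewrite mul0r addr0.
- by move=> t _; rewrite mul0r addr0 lp ph.
- by move=> v /DD ->; exists x; rewrite ?lexx// mul0r addr0.
Qed.

Lemma conn_cat (D D' : set R) (l h p q r e e' : R) :
  conn D l h p q e -> conn D' l h q r e' -> conn (D `|` D') l h p r (e + e').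
Proof.
move=> [tau tau0 H] [tau' tau'0 H']; exists (tau + tau'); first exact: addr_ge0.
move=> eps x eps0; have [w [g [P wx wy rg vis]]] := H eps x eps0.
have [w' [g' [P' wx' wy' rg' vis']]] := H' eps (x + eps * tau) eps0.
have t1 : 0 <= eps * tau by rewrite mulr_ge0// ltW.
have t2 : 0 <= eps * tau' by rewrite mulr_ge0// ltW.
have e1 : x + eps * (tau + tau') = x + eps * tau + eps * tau' by ring.
rewrite e1; set y := x + eps * tau in P wy rg vis P' wx' wy' rg' vis' *.
have xy : x <= y by rewrite /y lerDl.
have yz : y <= y + eps * tau' by rewrite lerDl.
have gl1 t : t <= y -> glue y w w' t = w t by rewrite /glue => ->.
have gl2 t : y <= t -> glue y w w' t = w' t.
  rewrite /glue => yt; case: ifP => // ty.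
  have -> : t = y by apply/eqP; rewrite eq_le ty yt.
  by rewrite wy wx'.
exists (glue y w w'), (glue y g g'); split.
- by apply: ppath_glue P P' _; rewrite wy wx'.
- by rewrite gl1.
- by rewrite gl2.
- move=> t tI; have [ty|/ltW ty] := leP t y.
    by rewrite gl1// rg//; lra.
  by rewrite gl2// rg'//; lra.
- move=> v [/vis|/vis'] [t tI <-]; exists t; [lra| |lra|].
    by rewrite gl1//; lra.
  by rewrite gl2//; lra.
Qed.

(** At constant speed m / eps the kinetic term equals m^2 / (2 eps) and the potential term is at
    most that; the duration is eps |q - p| / m. *)
Lemma conn_step (p q m : R) : p != q -> 0 < m ->
  (forall z, Num.min p q <= z <= Num.max p q -> F z <= m ^+ 2) ->
  conn [set p; q] (Num.min p q) (Num.max p q) p q (m * `|q - p|).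
Proof.
move=> pq m0 Fm.
have d0 : 0 < `|q - p| by rewrite normr_gt0 subr_eq0 eq_sym.
exists (`|q - p| / m); first by rewrite divr_ge0// ltW.
move=> eps x eps0.
have t0 : 0 < eps * (`|q - p| / m) by rewrite mulr_gt0// divr_gt0.
set T := eps * (`|q - p| / m) in t0 *.
pose s := (q - p) / T.
have sE : s * T = q - p by rewrite /s divfK// gt_eqF.
have rg t : x <= t <= x + T -> Num.min p q <= p + s * (t - x) <= Num.max p q.
  move=> tI; pose k := (t - x) / T.
  have kE : t - x = k * T by rewrite /k divfK// gt_eqF.
  have k0 : 0 <= k by rewrite /k divr_ge0//; lra.
  have k1 : k <= 1 by rewrite /k ler_pdivrMr// mul1r; lra.
  rewrite kE (_ : s * (k * T) = k * (q - p)); last by rewrite -sE; ring.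
  by case: (leP p q) => ?; nra.
exists (fun t => p + s * (t - x)), (fun=> s); split.
- have := @ppath_affine eps p s x (x + T) (m ^+ 2) eps0 ltac:(lra) (fun t ht => Fm _ (rg t ht)).
  apply: ppath_le; have -> : x + T - x = T by ring.
  have -> : eps / 2 * s ^+ 2 + 1 / (2 * eps) * m ^+ 2 = m ^+ 2 / eps.
    have : s ^+ 2 = m ^+ 2 / eps ^+ 2.
      have -> : s ^+ 2 = (q - p) ^+ 2 * m ^+ 2 / (eps ^+ 2 * `|q - p| ^+ 2).
        by rewrite /s /T; field; rewrite !gt_eqF.
      have qp0 : q - p != 0 by rewrite subr_eq0 eq_sym.
      by rewrite real_normK ?num_real//; field; rewrite qp0 gt_eqF.
    by move=> ->; field; rewrite gt_eqF.
  by rewrite /T le_eqVlt; apply/orP; left; apply/eqP; field; rewrite !gt_eqF.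
- by rewrite subrr mulr0 addr0.
- by rewrite addrAC subrr add0r sE addrC subrK.
- exact: rg.
- move=> v [->|->]; first by exists x; rewrite ?subrr ?mulr0 ?addr0// lexx; lra.
  by exists (x + T); [lra|rewrite addrAC subrr add0r sE addrC subrK].
Qed.

End paths.

(** * Transitions between values *)

Section curves.
Context (R : realType) (F : R -> R).
Hypothesis F_cont : continuous F.
Hypothesis F_ge0 : forall v, 0 <= F v.
Hypothesis F1 : F 1 = 0.
Notation Hp := (Hp F).
Notation G := (G F).
Notation conn := (conn F).
Notation ppath := (ppath F).

(** Near t the root of F varies by less than c/2, so m = sqrt(F t) + c/2 exceeds the average slope
    of H by at most c. The added c/2 also keeps the speed positive at the zero of F. *)
Lemma conn_local (t c : R) : 0 < c -> exists2 r, 0 < r & forall s s',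
  t - r < s -> s < s' -> s' < t + r ->
  conn [set s; s'] s s' s s' (Hp s' - Hp s + c * (s' - s)) /\
  conn [set s; s'] s s' s' s (Hp s' - Hp s + c * (s' - s)).
Proof.
move=> c0; have c2 : 0 < c / 2 by lra.
have [r r0 Hr] := cont_delta (sqrtF_cont F_cont (x := t)) c2.
exists r => // s s' ts ss' s't.
have Wt := sqrtr_ge0 (F t).
have m0 : 0 < Num.sqrt (F t) + c / 2 by lra.
have near z : s <= z <= s' -> `|Num.sqrt (F z) - Num.sqrt (F t)| < c / 2.
  by move=> zI; apply: Hr; rewrite ltr_norml; lra.
have Fm z : s <= z <= s' -> F z <= (Num.sqrt (F t) + c / 2) ^+ 2.
  move=> /near; rewrite ltr_norml => /andP[_ h].
  rewrite -(sqr_sqrtr (F_ge0 z)) ler_sqr ?nnegrE ?sqrtr_ge0 ?(ltW m0)//; lra.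
have low : (Num.sqrt (F t) - c / 2) * (s' - s) <= Hp s' - Hp s.
  rewrite HpB//; last exact: ltW.
  rewrite -(itg_cst _ (ltW ss')); apply: itg_le.
  - by apply: ible_cont => ?; exact: cvg_cst.
  - exact: ible_cont (sqrtF_cont F_cont).
  - by move=> z /near; rewrite ltr_norml; lra.
have cost : (Num.sqrt (F t) + c / 2) * (s' - s) <= Hp s' - Hp s + c * (s' - s).
  by apply: le_trans (lerD low (lexx (c * (s' - s)))); rewrite -mulrDl; lra.
have mn : Num.min s s' = s by rewrite min_l// ltW.
have mx : Num.max s s' = s' by rewrite max_r// ltW.
split.
- have := @conn_step R F F_cont s s' _ (negbT (lt_eqF ss')) m0.
  rewrite mn mx gtr0_norm ?subr_gt0// => /(_ Fm); exact: conn_le.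
- have := @conn_step R F F_cont s' s _ (negbT (gt_eqF ss')) m0.
  rewrite minC maxC mn mx distrC gtr0_norm ?subr_gt0// setUC => /(_ Fm).
  exact: conn_le.
Qed.

(** Real induction on the values, not on the domain, with both directions carried along. The excess
    c per unit of length adds up to at most eta. *)
Lemma conn_monotone (p q eta : R) : p <= q -> 0 < eta ->
  conn [set p; q] p q p q (Hp q - Hp p + eta) /\
  conn [set p; q] p q q p (Hp q - Hp p + eta).
Proof.
move=> pq eta0; pose c := eta / (q - p + 1).
have c0 : 0 < c by rewrite divr_gt0//; lra.
have cq : c * (q - p) <= eta.
  by rewrite /c mulrAC ler_pdivrMr ?ler_pM2l//; lra.
pose e s := Hp s - Hp p + c * (s - p).
suff [h1 h2] : conn [set p; q] p q p q (e q) /\ conn [set p; q] p q q p (e q).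
  by split; [apply: conn_le h1|apply: conn_le h2] => //; rewrite /e; lra.
apply: (@real_induction R p q (fun s => conn [set p; s] p q p s (e s) /\
  conn [set p; s] p q s p (e s))) => //.
  have -> : e p = 0 by rewrite /e !subrr mulr0 addr0.
  by rewrite setUid; split; apply: conn_refl.
move=> t tpq; have [r r0 Hr] := conn_local t c0; exists r => // s s' ps st ts' s'q tr s'r.
have [->//|ss'] := eqVneq s s'.
have {}ss' : s < s' by rewrite lt_neqAle ss'; lra.
have [k1 k2] := Hr s s' tr ss' s'r.
have wk D x y z : conn D s s' x y z -> conn D p q x y z by apply: conn_le => //; lra.
have eE : e s' = e s + (Hp s' - Hp s + c * (s' - s)) by rewrite /e; ring.
move=> [h1 h2]; split.
- apply: conn_le (conn_cat F_cont h1 (wk _ _ _ _ k1)) => //; last by rewrite eE.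
  by move=> v [->|->]; [left; left|right; right].
- apply: conn_le (conn_cat F_cont (wk _ _ _ _ k2) h2) => //; last by rewrite eE addrC.
  by move=> v [->|->]; [right; left|left; right].
Qed.

Lemma conn_pair (l h p q eta : R) : l <= p <= h -> l <= q <= h -> 0 < eta ->
  conn [set p; q] l h p q (`|Hp q - Hp p| + eta).
Proof.
move=> ph qh eta0; have [pq|qp] := leP p q.
  have [k _] := conn_monotone pq eta0.
  by apply: conn_le k => //; [lra|lra|rewrite lerD2r ler_norm].
have [_ k] := conn_monotone (ltW qp) eta0; rewrite setUC.
by apply: conn_le k => //; [lra|lra|rewrite lerD2r distrC ler_norm].
Qed.

Lemma excursion_cost (a c eta : R) :
  a + eta / 3 + (a + eta / 3) + (c + eta / 3) <= 2 * a + c + eta /\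
  c + eta / 3 + (a + eta / 3) + (a + eta / 3) <= 2 * a + c + eta.
Proof. by split; lra. Qed.

Lemma end_cost (a c eta : R) :
  2 * a + c + eta <= 2 * (a + c) - c + eta /\ 2 * a + c + eta <= 2 * (c + a) - c + eta.
Proof. by split; lra. Qed.

Section blocks.
Variables (m x eta : R).
Hypotheses (m1 : m <= 1) (x1 : 1 <= x) (eta0 : 0 < eta).

Let mI : m <= m <= x. Proof. by rewrite lexx (le_trans m1 x1). Qed.
Let xI : m <= x <= x. Proof. by rewrite lexx (le_trans m1 x1). Qed.
Let oI : m <= 1 <= x. Proof. by rewrite m1. Qed.
Let eta3 : 0 < eta / 3. Proof. exact: divr_gt0. Qed.

Let dm : `|Hp m - Hp 1| = G m.
Proof. by rewrite Hp1 subr0 Hp_GN// normrN ger0_norm ?G_ge0. Qed.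
Let dx : `|Hp x - Hp 1| = G x.
Proof. by rewrite Hp1 subr0 Hp_G// ger0_norm ?G_ge0. Qed.

Lemma conn_from (p : R) : m <= p <= x -> conn set0 m x p 1 (`|Hp p - Hp 1| + eta).
Proof.
by move=> pI; have := conn_pair pI oI eta0; rewrite distrC; exact: conn_le.
Qed.

(** The route is 1 -> q -> 1 -> p or its reverse: it visits both ends, q at double price and p at
    single price. *)
Lemma conn_excursion (p q : R) : p = m /\ q = x \/ p = x /\ q = m ->
  conn [set m; x] m x 1 p (2 * `|Hp q - Hp 1| + `|Hp p - Hp 1| + eta) /\
  conn [set m; x] m x p 1 (2 * `|Hp q - Hp 1| + `|Hp p - Hp 1| + eta).
Proof.
move=> pq.
have pI : m <= p <= x by case: pq => -[-> _].
have qI : m <= q <= x by case: pq => -[_ ->].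
have sub : [set m; x] `<=` [set 1; q] `|` [set q; 1] `|` [set 1; p].
  by case: pq => -[-> ->] v [->|->]; [right; right|left; left; right|
    left; left; right|right; right].
have sub' : [set m; x] `<=` [set p; 1] `|` [set 1; q] `|` [set q; 1].
  by case: pq => -[-> ->] v [->|->]; [left; left; left|left; right; right|
    left; right; right|left; left; left].
have [c1 c2] := excursion_cost `|Hp q - Hp 1| `|Hp p - Hp 1| eta.
have oq := conn_pair oI qI eta3; have qo := conn_pair qI oI eta3.
have op := conn_pair oI pI eta3; have po := conn_pair pI oI eta3.
rewrite (distrC (Hp 1)) in qo; rewrite (distrC (Hp 1)) in po.
split.
- exact: (conn_le sub (lexx m) (lexx x) c1 (conn_cat F_cont (conn_cat F_cont oq qo) op)).
- exact: (conn_le sub' (lexx m) (lexx x) c2 (conn_cat F_cont (conn_cat F_cont po oq) qo)).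
Qed.

(** Right and left refer to the place of a block in the gap between two nodes. The block on arrival
    at a node makes the whole excursion to x and stops at m, so that [left_block], on departure,
    only returns to 1. *)
Lemma right_block : conn [set m; x] m x 1 m (2 * G x + G m + eta).
Proof. by have [] := @conn_excursion m x (or_introl (conj erefl erefl)); rewrite dm dx. Qed.

Lemma left_block : conn set0 m x m 1 (G m + eta).
Proof. by have := conn_from mI; rewrite dm. Qed.

(** At an end of a segment there is a single block. It has the end of larger G as its extremity, so
    that this one is reached only once. *)
Lemma end_block : exists A, [/\ A = (if G m < G x then x else m),
  conn [set m; x] m x 1 A (2 * (G m + G x) - Num.max (G m) (G x) + eta) &
  conn [set m; x] m x A 1 (2 * (G m + G x) - Num.max (G m) (G x) + eta)].
Proof.
have [k1 k2] := @conn_excursion x m (or_intror (conj erefl erefl)).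
have [k3 k4] := @conn_excursion m x (or_introl (conj erefl erefl)).
have [c1 _] := end_cost (G m) (G x) eta; have [_ c2] := end_cost (G x) (G m) eta.
rewrite dm dx in k1 k2 k3 k4.
have S := @subset_refl _ [set m; x].
eexists; split; first by [].
  by case: (ltP (G m) (G x)) => h; [exact: (conn_le S (lexx m) (lexx x) c1 k1)|
    exact: (conn_le S (lexx m) (lexx x) c2 k3)].
by case: (ltP (G m) (G x)) => h; [exact: (conn_le S (lexx m) (lexx x) c1 k2)|
  exact: (conn_le S (lexx m) (lexx x) c2 k4)].
Qed.

End blocks.

(** Both connections take a time proportional to eps, so for small eps they fit into the margins of
    width delta and do not overlap. In between the path rests at 1, free of charge since F 1 = 0. *)
Lemma conn_gap (D1 D2 : set R) (l1 h1 l2 h2 p q e1 e2 x y delta : R) :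
  conn D1 l1 h1 p 1 e1 -> conn D2 l2 h2 1 q e2 -> x < y -> 0 < delta ->
  exists2 eps0, 0 < eps0 & forall eps, 0 < eps < eps0 -> exists w g,
  [/\ ppath eps x y w g (e1 + e2), w x = p /\ w y = q,
   forall t, x <= t <= y -> [\/ t <= x + delta /\ l1 <= w t <= h1, w t = 1 |
     y - delta <= t /\ l2 <= w t <= h2],
   forall v, D1 v -> exists t, [/\ x <= t <= y, t <= x + delta & w t = v] &
   forall v, D2 v -> exists t, [/\ x <= t <= y, y - delta <= t & w t = v]].
Proof.
move=> [tau1 tau10 H1] [tau2 tau20 H2] xy d0.
pose m := Num.min delta ((y - x) / 2).
have m0 : 0 < m by rewrite lt_min d0 divr_gt0//; lra.
have [md mxy] : m <= delta /\ m <= (y - x) / 2 by rewrite /m !ge_min !lexx orbT.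
have T0 : 0 < tau1 + tau2 + 1 by lra.
exists (m / (tau1 + tau2 + 1)) => [|eps /andP[eps0 epsm]]; first by rewrite divr_gt0.
rewrite ltr_pdivlMr// in epsm.
have a1 : 0 <= eps * tau1 by rewrite mulr_ge0// ltW.
have a2 : 0 <= eps * tau2 by rewrite mulr_ge0// ltW.
have b1 : eps * tau1 <= m by nra.
have b2 : eps * tau2 <= m by nra.
have [w1 [g1 [P1 w1x w1y r1 v1]]] := H1 eps x eps0.
have [w2 [g2 [P2 w2x w2y r2 v2]]] := H2 eps (y - eps * tau2) eps0.
rewrite subrK in P2 w2y r2 v2.
set x' := x + eps * tau1 in P1 w1y r1 v1 *; set y' := y - eps * tau2 in P2 w2x r2 v2 *.
have xx' : x <= x' by rewrite /x'; lra.
have x'y' : x' <= y' by rewrite /x' /y'; lra.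
have y'y : y' <= y by rewrite /y'; lra.
have Pc : ppath eps x' y' (fun t => 1 + 0 * (t - x')) (fun=> 0) 0.
  have := @ppath_affine R F F_cont eps 1 0 x' y' 0 eps0 x'y'.
  rewrite expr0n /= mulr0 add0r mulr0 mul0r; apply=> t _.
  by rewrite mul0r addr0 F1.
have c1 t : 1 + 0 * (t - x') = 1 by rewrite mul0r addr0.
have Pa := ppath_glue F_cont P1 Pc ltac:(by rewrite w1y c1).
have E : glue x' w1 (fun t => 1 + 0 * (t - x')) y' = w2 y'.
  rewrite /glue w2x; case: ifP => [h|_]; last exact: c1.
  by have -> : y' = x' by lra.
have Pb := ppath_glue F_cont Pa P2 E; rewrite addr0 in Pb.
set w := glue y' _ _ in Pb.
have wl t : t <= x' -> w t = w1 t.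
  by move=> h; rewrite /w /glue h; have -> : t <= y' by lra.
have wm t : x' <= t <= y' -> w t = 1.
  move=> /andP[h1' h2']; rewrite /w /glue h2'; case: ifP => h; last exact: c1.
  by have -> : t = x' by lra.
have wr t : y' <= t -> w t = w2 t.
  move=> h; rewrite /w {1}/glue; case: ifP => // h'.
  by have -> : t = y' by lra.
exists w; eexists; split; first exact: Pb.
- by rewrite wl// w1x wr// w2y.
- move=> t txy; have [h|h] := leP t x'.
    by apply: Or31; rewrite wl//; split; [rewrite /x' in h; lra|apply: r1; lra].
  have [h'|h'] := leP t y'; first by apply: Or32; apply: wm; lra.
  apply: Or33; rewrite wr; last lra.
  by split; [rewrite /y' in h'; lra|apply: r2; lra].
- move=> v /v1[t tI wt]; exists t; split; [lra|rewrite /x' in tI; lra|].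
  by rewrite wl//; lra.
- move=> v /v2[t tI wt]; exists t; split; [lra|rewrite /y' in tI; lra|].
  by rewrite wr//; lra.
Qed.

End curves.

(** * Concatenation over the nodes *)

Section assemble.
Context (R : realType) (F : R -> R).
Hypothesis F_cont : continuous F.
Hypothesis F_ge0 : forall v, 0 <= F v.
Hypothesis F1 : F 1 = 0.
Variables (val mm pp : R -> R) (DL DR : R -> set R) (cL cR : R -> R).
Notation conn := (conn F).
Notation ppath := (ppath F).

(** Induction on the nodes, with [conn_gap] between neighbours that share the prescribed values. The
    entries of t have a gap on their left, hence a block on arrival; those of [belast x t] have one
    on their right, hence a block on departure. *)
Lemma assemble (t : seq R) (x delta : R) : 0 < delta -> path <%R x t ->
  (forall r, r \in x :: t -> mm r <= val r <= pp r) ->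
  (forall r, r \in t -> conn (DR r) (mm r) (pp r) 1 (val r) (cR r)) ->
  (forall r, r \in belast x t -> conn (DL r) (mm r) (pp r) (val r) 1 (cL r)) ->
  exists2 eps0, 0 < eps0 & forall eps, 0 < eps < eps0 -> exists w g,
  [/\ ppath eps x (last x t) w g (\sum_(r <- t) cR r + \sum_(r <- belast x t) cL r),
   forall r, r \in x :: t -> w r = val r,
   forall s, x <= s <= last x t ->
     w s = 1 \/ exists r, [/\ r \in x :: t, `|s - r| <= delta & mm r <= w s <= pp r],
   forall r v, r \in t -> DR r v ->
     exists s, [/\ x <= s <= last x t, `|s - r| <= delta & w s = v] &
   forall r v, r \in belast x t -> DL r v ->
     exists s, [/\ x <= s <= last x t, `|s - r| <= delta & w s = v]].
Proof.
move=> d0; elim: t x => [|y t IH] x /=.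
  move=> _ vI _ _; exists 1 => // eps /andP[eps0 _].
  exists (fun s => val x + 0 * (s - x)), (fun=> 0); split=> //.
  - rewrite !big_nil addr0.
    have := @ppath_affine R F F_cont eps (val x) 0 x x (F (val x)) eps0 (lexx x).
    by rewrite subrr mulr0; apply=> s _; rewrite mul0r addr0.
  - by move=> r; rewrite inE => /eqP ->; rewrite mul0r addr0.
  - move=> s sx; right; exists x; rewrite mem_head mul0r addr0 vI ?mem_head//.
    by split=> //; rewrite ler_norml; lra.
move=> /andP[xy pt] vI HR HL.
have [| | |e2 e20 H2] := IH y pt.
- by move=> r rt; apply: vI; rewrite inE rt orbT.
- by move=> r rt; apply: HR; rewrite inE rt orbT.
- by move=> r rt; apply: HL; rewrite inE rt orbT.
have [e1 e10 H1] := conn_gap F_cont F1 (HL x (mem_head _ _)) (HR y (mem_head _ _)) xy d0.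
exists (Num.min e1 e2) => [|eps]; first by rewrite lt_min e10.
rewrite lt_min => /andP[eps0 /andP[l1 l2]].
have [|w1 [g1 [P1 [w1x w1y] rg1 vis1 vis1']]] := H1 eps; first by rewrite eps0.
have [|w2 [g2 [P2 w2v rg2 vis2 vis2']]] := H2 eps; first by rewrite eps0.
have w2y := w2v y (mem_head _ _).
have yl : y <= last y t by have [] := P2.
have wl s : s <= y -> glue y w1 w2 s = w1 s by rewrite /glue => ->.
have wr s : y <= s -> glue y w1 w2 s = w2 s.
  move=> ys; rewrite /glue; case: ifP => // sy.
  have -> : s = y by lra.
  by rewrite w1y w2y.
have yt r : r \in t -> y <= r.
  by move=> rt; have /allP := order_path_min lt_trans pt; move=> /(_ r rt)/ltW.
exists (glue y w1 w2), (glue y g1 g2); split.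
- apply: ppath_le (ppath_glue F_cont P1 P2 _); last by rewrite w1y w2y.
  by rewrite !big_cons; lra.
- move=> r; rewrite inE => /predU1P[->|]; first by rewrite wl ?ltW.
  move=> ryt; rewrite wr ?w2v//.
  by move: ryt; rewrite inE => /predU1P[->//|/yt].
- move=> s sI; have [sy|/ltW ys] := leP s y.
    rewrite wl//; have [|[a1 a2]||[a1 a2]] := rg1 s; first lra.
    + right; exists x; rewrite mem_head; split=> //; rewrite ler_norml; lra.
    + by left.
    + right; exists y; rewrite !inE eqxx orbT; split=> //; rewrite ler_norml; lra.
  rewrite wr//; have [||[r [rt h1 h2]]] := rg2 s; [lra|by left|].
  by right; exists r; rewrite inE rt orbT.
- move=> r v; rewrite inE => /predU1P[->|rt] Dv.
    have [s [sI h1 h2]] := vis1' v Dv; exists s; rewrite wl; last lra.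
    by split=> //; [lra|rewrite ler_norml; lra].
  have [s [sI h1 h2]] := vis2 r v rt Dv; exists s; rewrite wr; last lra.
  by split=> //; lra.
- move=> r v; rewrite inE => /predU1P[->|rt] Dv.
    have [s [sI h1 h2]] := vis1 v Dv; exists s; rewrite wl; last lra.
    by split=> //; [lra|rewrite ler_norml; lra].
  have [s [sI h1 h2]] := vis2' r v rt Dv; exists s; rewrite wr; last lra.
  by split=> //; lra.
Qed.

End assemble.

(** * From paths to functions on M *)

Section recovery.
Context (R : realType) (M : domain R) (F : R -> R).
Hypothesis F_cont : continuous F.
Hypothesis F_ge0 : forall v, 0 <= F v.
Hypothesis F1 : F 1 = 0.
Notation lo := (lo M).
Notation hi := (hi M).
Notation proj := (proj M).
Notation G := (G F).
Implicit Types (Xi : pt M -> set R) (v : pt M -> R) (x : pt M).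

Lemma test_C1 (phi : R -> R) : test_function M phi ->
  C1 phi /\ (M = Torus -> phi hi = phi lo) /\ (M <> Torus -> phi hi = 0 /\ phi lo = 0).
Proof.
move=> [d c per]; split; first exact: (conj d c).
move: per; rewrite /hi /lo; case: M => [l r lr|] per.
  split=> [MT|_]; first by discriminate MT.
  move: per => [c' [d' [lc dr H]]].
  split; apply: H; rewrite in_itv /= negb_and -!ltNge; first by rewrite dr orbT.
  by rewrite lc.
split=> [_|MT]; last by case: MT.
by have := per 0; rewrite add0r.
Qed.

Lemma rep_proj (w : R -> R) s : (M = Torus -> w lo = w hi) -> lo <= s <= hi ->
  w (rep (proj s)) = w s.
Proof.
move=> wT /=; rewrite /projr; move: wT; rewrite /lo /hi; case: M => [l r lr|] wT sI.
  by congr w; rewrite min_r ?max_r//; lra.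
have [s1|s1] := ltP s 1.
  by rewrite (@floor_def _ _ 0) ?subr0// add0r; lra.
have -> : s = 1 by lra.
by rewrite floor1 subrr wT.
Qed.

Lemma H1_of_path (eps e : R) (w g : R -> R) : 0 < eps ->
  (M = Torus -> w lo = w hi) -> ppath F eps lo hi w g e ->
  in_H1 (fun p : pt M => w (rep p)) /\
  (E_eps F eps (fun p : pt M => w (rep p)) <= e%:E)%E.
Proof.
move=> eps0 wT P; have [_ cw [mg [c gc]] ibpw en] := P.
have [ig i2 iD iphi] := ppath_ible F_cont P.
set v := fun p : pt M => w (rep p).
have cv : continuous v by apply: comp_rep_cont => // MT; move: (wT MT); rewrite /lo /hi MT.
have vE s : lo <= s <= hi -> v (proj s) = w s by exact: rep_proj.
have wd : weak_derivative v g.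
  split.
    split; first exact/measurable_span.
    rewrite integral_span; last exact: measurable_funX.
    case/integrableP: i2 => _; apply: le_lt_trans.
    apply: ge0_le_integral => //=.
    - by move=> t _; rewrite lee_fin sqr_ge0.
    - by apply/measurable_EFinP; exact: measurable_funX.
    - by apply/measurable_EFinP; apply: measurableT_comp => //; exact: measurable_funX.
    - by move=> t _; rewrite lee_fin ler_norm.
  move=> phi tphi; have [Cphi [pT pS]] := test_C1 tphi.
  have [-> ->] := test_bridge cv mg Cphi.1 Cphi.2.
  have [j1 j2] := iphi _ Cphi.
  rewrite (@eq_itg _ _ (fun t => w t * derive1 phi t)); last by move=> t tI; rewrite vE.
  have := ibpw _ Cphi; rewrite itgD// => h.
  (* Only the boundary terms are left: they cancel by periodicity on the torus, and on a segment phi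
     vanishes at both ends. *)
  apply/eqP; rewrite -addr_eq0 h; apply/eqP.
  have [MT|nT] := pselect (M = Torus); first by rewrite pT// wT// subrr.
  by have [-> ->] := pS nT; rewrite !mulr0 subrr.
have vH : in_H1 v by split=> //; exists g.
split=> //; rewrite E_epsE// lee_fin; apply: le_trans en.
have [_ k2 _] := L2_ible (wderivP vH).1.
have iF : ible (fun t => F (v (proj t))) lo hi.
  apply: ible_cont => t; apply: (@continuous_comp _ _ _ (v \o proj) F).
    exact: comp_proj_cont.
  exact: F_cont.
have iF' : ible (fun t => F (w t)) lo hi.
  apply: ible_cont => t; apply: (@continuous_comp _ _ _ w F); [exact: cw|exact: F_cont].
rewrite /dens itgD; [|exact: ibleZ|exact: ibleZ].
rewrite [leRHS]itgD; [|exact: ibleZ|exact: ibleZ].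
rewrite !itgZ//.
rewrite (weak_derivative_sqr cv (wderivP vH) wd).
have -> // : itg (fun t => F ((v \o proj) t)) lo hi = itg (fun t => F (w t)) lo hi.
by apply: eq_itg => t tI; rewrite /= vE.
Qed.

End recovery.

Section recovery.
Context (R : realType) (M : domain R) (F : R -> R).
Hypothesis F_cont : continuous F.
Hypothesis F_ge0 : forall v, 0 <= F v.
Hypothesis F1 : F 1 = 0.
Notation lo := (lo M).
Notation hi := (hi M).
Notation proj := (proj M).
Notation G := (G F).
Implicit Types (Xi : pt M -> set R) (v : pt M -> R) (x : pt M).

Lemma A0_itv Xi x : in_A0 Xi -> Xi x = `[inf (Xi x), sup (Xi x)]%classic /\
  inf (Xi x) <= 1 <= sup (Xi x).
Proof.
move=> [_ [Sigma [_ H1 H2]]].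
have itv (l h : R) : l <= 1 <= h -> Xi x = `[l, h]%classic ->
    Xi x = `[inf (Xi x), sup (Xi x)]%classic /\ inf (Xi x) <= 1 <= sup (Xi x).
  move=> lh E; have l_h : l <= h by lra.
  by rewrite E inf_itv// sup_itv.
have [/H2[l [h [_ lh E]]]|nS] := pselect (Sigma x); first exact: itv lh E.
by apply: (itv 1 1); rewrite ?lexx// set_itv1; exact: H1.
Qed.

(* The common value at [x] of the left and right blocks: min Xi(x) in the interior; at a
   boundary point the end of Xi(x) of larger G, which is then paid for only once. *)
Definition nval Xi x : R :=
  if on_bdry x && (G (inf (Xi x)) < G (sup (Xi x))) then sup (Xi x) else inf (Xi x).
Definition rcost Xi x : R :=
  if on_bdry x then jump_cost F Xi x else 2 * G (sup (Xi x)) + G (inf (Xi x)).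
Definition lcost Xi x : R := if on_bdry x then jump_cost F Xi x else G (inf (Xi x)).

Lemma block_costs Xi x : ~~ on_bdry x -> rcost Xi x + lcost Xi x = jump_cost F Xi x.
Proof. by move=> /negPf nb; rewrite /rcost /lcost /jump_cost nb /= mul0r subr0; lra. Qed.

Lemma node_blocks Xi x (eta : R) : in_A0 Xi -> 0 < eta ->
  conn F [set inf (Xi x); sup (Xi x)] (inf (Xi x)) (sup (Xi x)) 1 (nval Xi x)
    (rcost Xi x + eta) /\
  conn F (if on_bdry x then [set inf (Xi x); sup (Xi x)] else set0)
    (inf (Xi x)) (sup (Xi x)) (nval Xi x) 1 (lcost Xi x + eta).
Proof.
move=> XA0 eta0; have [_ /andP[i1 s1]] := A0_itv x XA0.
rewrite /nval /rcost /lcost /jump_cost; case: (on_bdry x) => /=.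
  by rewrite mul1r; have [A [-> k1 k2]] := end_block F_cont F_ge0 i1 s1 eta0.
by split; [exact: right_block|exact: left_block].
Qed.

Lemma on_bdryE x : M <> Torus -> on_bdry x = (rep x == lo) || (rep x == hi).
Proof.
by rewrite /on_bdry /lo /hi; case: M x => [l r lr|] x MT //; exfalso; exact: MT.
Qed.

Lemma on_bdry_torus x : M = Torus -> on_bdry x = false.
Proof. by rewrite /on_bdry; case: M x. Qed.

Lemma on_bdry_interior x : lo < rep x < hi -> on_bdry x = false.
Proof.
move=> /andP[x1 x2]; have [MT|nT] := pselect (M = Torus); first exact: on_bdry_torus.
by rewrite on_bdryE// gt_eqF// lt_eqF.
Qed.

(** The nodes are S, [a] and the ends of [lo, hi], whether or not Xi jumps there. On the torus the
    two ends are one point, with its arrival block at hi and its departure block at lo, so its cost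
    is counted once. *)
Lemma recovery Xi (a : pt M) (S : seq (pt M)) : in_A0 Xi -> ~~ on_bdry a ->
  exists T : seq (pt M), [/\ uniq T, {subset S <= T} &
    forall eta delta, 0 < eta -> 0 < delta -> exists2 eps0, 0 < eps0 &
      forall eps, 0 < eps < eps0 -> exists v, [/\ in_H1 v, v a = inf (Xi a),
        (E_eps F eps v <= (\sum_(x <- T) jump_cost F Xi x + eta)%:E)%E,
        forall x, exists2 x', mdist x x' <= delta & Xi x' (v x) &
        forall x y, x \in T -> Xi x y -> exists2 x', mdist x x' <= delta & v x' = y]].
Proof.
move=> XA0 na.
pose mid := [seq x <- undup (a :: S) | lo < rep x < hi].
(* On the torus both entries coincide, and [undup] keeps one. *)
pose ends := undup [:: proj lo; proj hi].
have lh := lo_hi M.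
have rlo : rep (proj lo) = lo.
  rewrite /= /projr /lo; case: M => [l r lr|]; last by rewrite floor0 subr0.
  by rewrite min_r ?max_l// ltW.
have rhi : M <> Torus /\ rep (proj hi) = hi \/ M = Torus /\ proj hi = proj lo.
  rewrite /proj /hi /lo; have [MT|nT] := pselect (M = Torus); last first.
    left; split=> //; rewrite /= /projr; case: M nT => [l r lr|] // _.
    by rewrite min_l// max_r// ltW.
  right; split=> //; apply: val_inj; rewrite /= /projr MT.
  by rewrite floor1 floor0 !subrr.
have bdryE p := @on_bdryE p.
pose T := ends ++ mid.
have subT x : x \in a :: S -> x \in T.
  move=> xS; rewrite /T mem_cat; have [xm|xm] := boolP (lo < rep x < hi).
    by rewrite mem_filter xm mem_undup xS orbT.
  have /andP[x1 x2] := rep_itv x.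
  rewrite mem_undup !inE; apply/orP; left; rewrite -(proj_rep x).
  have [->|->] : rep x = lo \/ rep x = hi.
    move: xm; rewrite negb_and -!leNgt => /orP[h|h]; [left|right]; lra.
    by rewrite eqxx.
  by rewrite eqxx orbT.
exists T; split.
- rewrite cat_uniq undup_uniq filter_uniq ?undup_uniq// andbT /=.
  apply/hasPn => x; rewrite mem_filter => /andP[/andP[x1 x2] _].
  apply/negP; rewrite /ends mem_undup !inE => /orP[]/eqP xE; move: x1 x2; rewrite xE.
    by rewrite rlo ltxx.
  by case: rhi => -[_ ->]; rewrite ?rlo ltxx.
- by move=> x xS; apply: subT; rewrite inE xS orbT.
move=> eta delta eta0 delta0.
pose m := sort <=%O [seq rep x | x <- mid].
have mP r : r \in m -> exists2 x, x \in mid & r = rep x.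
  by rewrite mem_sort => /mapP[x xm ->]; exists x.
have mI r : r \in m -> lo < r < hi.
  by move=> /mP[x]; rewrite mem_filter => /andP[h _] ->.
pose t := rcons m hi.
have pt_ : path <%R lo t.
  rewrite rcons_path; apply/andP; split.
    rewrite (path_sortedE lt_trans); apply/andP; split.
      by apply/allP => r /mI /andP[].
    by rewrite sort_lt_sorted map_inj_uniq ?filter_uniq ?undup_uniq//; exact: val_inj.
  by have := mem_last lo m; rewrite inE => /predU1P[->//|/mI/andP[]].
(* The number of blocks: two at each inner node and one at each end of the path. *)
pose n : R := 2 * ((size mid)%:R + 1).
have n0 : 0 < n by rewrite mulr_gt0// ltr_wpDl.
pose eta1 := eta / n.
have eta10 : 0 < eta1 by rewrite divr_gt0.
have sumE : \sum_(r <- t) (rcost Xi (proj r) + eta1) +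
    \sum_(r <- belast lo t) (lcost Xi (proj r) + eta1) =
    \sum_(x <- T) jump_cost F Xi x + eta.
  rewrite /t belast_rcons big_cons -cats1 big_cat big_seq1 /=.
  have pm : perm_eq m [seq rep x | x <- mid] by rewrite perm_sort.
  rewrite !(perm_big _ pm) /= !big_map.
  have pr (f : pt M -> R) : \sum_(x <- mid) (f (proj (rep x)) + eta1) =
      \sum_(x <- mid) f x + eta1 * (size mid)%:R.
    rewrite big_split /= big_const_seq count_predT iter_addr addr0 mulr_natr.
    by congr (_ + _); apply: eq_bigr => x _; rewrite proj_rep.
  rewrite !pr /T big_cat /=.
  have <- : \sum_(x <- mid) rcost Xi x + \sum_(x <- mid) lcost Xi x =
      \sum_(x <- mid) jump_cost F Xi x.
    rewrite -big_split big_seq [RHS]big_seq; apply: eq_bigr => x.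
    by rewrite mem_filter => /andP[xI _]; rewrite /= block_costs// on_bdry_interior.
  have -> : \sum_(x <- ends) jump_cost F Xi x = rcost Xi (proj hi) + lcost Xi (proj lo).
    rewrite /ends; case: rhi => -[MT h].
      rewrite /= inE; case: eqP => [E|_].
        by exfalso; move: lh; rewrite -h -{1}rlo E ltxx.
      by rewrite big_cons big_seq1 addrC /rcost /lcost !bdryE// h rlo !eqxx orbT.
    rewrite h /= inE eqxx big_seq1 -block_costs//.
    by rewrite on_bdry_torus.
  have e1 : eta = eta1 * n by rewrite /eta1 divfK// gt_eqF.
  by rewrite [in RHS]e1 /n; ring.
(* Away from the boundary the arrival block visits both ends of Xi, so nothing is asked of the
   departure block. The left end of a segment has a departure block only. *)
have [| | |eps0 eps00 H] := @assemble R F F_cont F1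
  (fun r => nval Xi (proj r)) (fun r => inf (Xi (proj r)))
  (fun r => sup (Xi (proj r))) (fun r => if on_bdry (proj r) then
      [set inf (Xi (proj r)); sup (Xi (proj r))] else set0)
  (fun r => [set inf (Xi (proj r)); sup (Xi (proj r))])
  (fun r => lcost Xi (proj r) + eta1) (fun r => rcost Xi (proj r) + eta1)
  t lo delta delta0 pt_.
- move=> r _; have [_ b] := A0_itv (proj r) XA0.
  by rewrite /nval; case: ifP => _; rewrite lexx; lra.
- by move=> r _; have [] := node_blocks (proj r) XA0 eta10.
- by move=> r _; have [] := node_blocks (proj r) XA0 eta10.
exists eps0 => // eps epsI; have eps_gt0 : 0 < eps by case/andP: epsI.
have [w [g [P wv rg visR visL]]] := H eps epsI.
rewrite sumE last_rcons in P; rewrite last_rcons in rg visR visL.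
have ht : hi \in lo :: t by rewrite inE mem_rcons mem_head orbT.
have wT : M = Torus -> w lo = w hi.
  move=> MT; rewrite (wv lo (mem_head _ _)) (wv hi ht).
  by case: rhi => -[MT' h]; [case: MT'|rewrite h].
have [vH vE] := H1_of_path F_cont F_ge0 eps_gt0 wT P.
have cw : continuous w by have [] := P.
have lift s : lo <= s <= hi -> w (rep (proj s)) = w s by exact: (@rep_proj R M).
have near r s : `|s - r| <= delta -> mdist (proj r) (proj s) <= delta.
  by apply: le_trans; rewrite distrC; exact: proj_lip.
exists (fun p => w (rep p)); split=> //.
(* As a node off the boundary, [a] receives exactly min Xi(a). *)
- have ra : rep a \in lo :: t.
    have [am|am] := boolP (lo < rep a < hi).
      rewrite inE mem_rcons inE mem_sort; apply/orP; right; apply/orP; right.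
      by apply: map_f; rewrite mem_filter am mem_undup mem_head.
    have /andP[x1 x2] := rep_itv a.
    have [->|->//] : rep a = lo \/ rep a = hi; last exact: mem_head.
    by move: am; rewrite negb_and -!leNgt => /orP[h|h]; [left|right]; lra.
  by rewrite (wv _ ra) proj_rep /nval (negPf na).
- move=> x; have [h|[r [_ h1 h2]]] := rg (rep x) (rep_itv x).
    exists x; first by rewrite mdistxx ltW.
    by have [E b] := A0_itv x XA0; rewrite h E /= in_itv.
  exists (proj r); first by rewrite metric_sym -(proj_rep x); exact: near.
  by have [E b] := A0_itv (proj r) XA0; rewrite E /= in_itv.
- move=> x y xT Xxy.
  have [r [prx vis]] : exists r, proj r = x /\ forall u,
      [set inf (Xi x); sup (Xi x)] u ->
      exists s, [/\ lo <= s <= hi, `|s - r| <= delta & w s = u].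
    have visH : proj hi = x -> exists r, proj r = x /\ forall u,
        [set inf (Xi x); sup (Xi x)] u ->
        exists s, [/\ lo <= s <= hi, `|s - r| <= delta & w s = u].
      move=> hx; exists hi; split=> // u; rewrite -hx.
      by apply: visR; rewrite mem_rcons mem_head.
    move: xT; rewrite /T mem_cat => /orP[|xm].
      rewrite mem_undup !inE => /orP[]/eqP xE; last exact: visH.
      case: rhi => -[MT h]; last by apply: visH; rewrite h.
      exists lo; split=> // u; rewrite xE => Du; apply: visL.
        by rewrite belast_rcons mem_head.
      by rewrite bdryE// rlo eqxx.
    exists (rep x); rewrite proj_rep; split=> // u Du; apply: visR.
      by rewrite mem_rcons inE mem_sort map_f ?orbT.
    by rewrite proj_rep.
  have [s1 [s1I s1r w1]] := vis _ (or_introl erefl).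
  have [s2 [s2I s2r w2]] := vis _ (or_intror erefl).
  have [E b] := A0_itv x XA0; rewrite E /= in_itv /= in Xxy.
  (* Both ends of Xi x are attained within delta of r, hence so is every value between them. *)
  have [s sI ws] : exists2 s, (lo <= s <= hi) && (`|s - r| <= delta) & w s = y.
    have ivt (p q : R) : p <= q -> lo <= p -> q <= hi -> `|p - r| <= delta ->
        `|q - r| <= delta -> Num.min (w p) (w q) <= y <= Num.max (w p) (w q) ->
        exists2 s, (lo <= s <= hi) && (`|s - r| <= delta) & w s = y.
      move=> pq lp qh; rewrite !ler_norml => pr qr /(IVT pq (continuous_subspaceT cw)).
      by move=> [s]; rewrite in_itv /= => sI ws; exists s => //; rewrite ler_norml; lra.
    have [l1 h1] := andP s1I; have [l2 h2] := andP s2I.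
    have [s12|/ltW s21] := leP s1 s2.
      by apply: (ivt s1 s2) => //; rewrite w1 w2 ge_min le_max;
        move/andP: Xxy => [-> ->]; rewrite orbT.
    by apply: (ivt s2 s1) => //; rewrite w1 w2 ge_min le_max;
        move/andP: Xxy => [-> ->]; rewrite orbT.
  have /andP[sI' sr] := sI.
  by exists (proj s); [rewrite -prx; exact: near|rewrite lift].
Qed.

End recovery.

(** * Diagonal argument and convergence of the energies *)

Section limsup.
Context (R : realType) (M : domain R) (F : R -> R).
Hypothesis F_cont : continuous F.
Hypothesis F_ge0 : forall v, 0 <= F v.
Hypothesis F_eq0 : forall v, F v = 0 <-> v = 1.
Hypothesis F_infty : (0 < limf_einf (fun v => (F v)%:E) (@abs_infty R))%E.
Variables (a : pt M) (b : R).
Hypotheses (a_int : ~~ on_bdry a) (b_ge0 : 0 <= b).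
Implicit Types (Xi : pt M -> set R) (v : pt M -> R) (x : pt M).

(** Nodes where Xi is {1} cost G(1) = 0, so the sum may be restricted to the singular set. *)
Lemma sum_le_E0 Xi (T : seq (pt M)) : in_A0 Xi -> uniq T ->
  ((\sum_(x <- T) jump_cost F Xi x)%:E <= E_0 F Xi)%E.
Proof.
move=> XA0 uT; rewrite /E_0 asboolT//.
pose T' := [seq x <- T | `[< sing_set Xi x >]].
have -> : \sum_(x <- T) jump_cost F Xi x = \sum_(x <- T') jump_cost F Xi x.
  rewrite big_filter [RHS]big_mkcond; apply: eq_bigr => x _.
  case: asboolP => // /contrapT E; rewrite /jump_cost E inf1 sup1.
  have -> : G F 1 = 0 by rewrite -Hp_G// Hp1.
  by rewrite maxxx !(addr0, mulr0) subr0.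
apply: esum_ge; exists [set` T'].
  split; first exact: finite_seq.
  by move=> x /=; rewrite mem_filter => /andP[/asboolP].
by rewrite -sumEFin fsbig_seq ?filter_uniq.
Qed.

(** Compactness in its near-covering form, along the filter of finite lists of graph points ordered
    by inclusion: a list containing z serves all points near z, hence some list serves the whole
    graph. *)
Lemma graph_net Xi (d : R) : in_B Xi -> 0 < d -> exists S : seq (pt M * R),
  (forall z, z \in S -> graph Xi z) /\
  forall x y, Xi x y -> exists2 z, z \in S & mdist x z.1 < d /\ `|y - z.2| < d.
Proof.
move=> [_ /compact_near_coveringP cG] d0.
pose base (s0 : seq (pt M * R)) := [set s : seq (pt M * R) |
  {subset s0 <= s} /\ forall z, z \in s -> graph Xi z].
pose FF := filter_from [set s0 : seq (pt M * R) | forall z, z \in s0 -> graph Xi z] base.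
have fFF : Filter FF.
  apply: filter_from_filter; first by exists [::].
  move=> s1 s2 h1 h2; exists (s1 ++ s2).
    by move=> z; rewrite mem_cat => /orP[/h1|/h2].
  move=> s [s12 hs]; split; split=> // z zs; apply: s12; rewrite mem_cat zs ?orbT//.
pose P (s : seq (pt M * R)) (z : pt M * R) :=
  exists2 z', z' \in s & mdist z.1 z'.1 < d /\ `|z.2 - z'.2| < d.
have [|s0 h0 H] := cG _ FF P fFF.
  move=> z Xz; exists (ball z d, base [:: z]).
    split; first exact: nbhsx_ballx.
    by exists [:: z] => // z'; rewrite inE => /eqP ->.
  move=> [z' s] [/= [h1 h2] [zs _]]; exists z; first by apply: zs; exact: mem_head.
  split; first by rewrite metric_sym; move: h1; rewrite ballEmdist.
  by move: h2; rewrite /ball/= distrC.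
exists s0; split=> // x y Xxy.
by have [z zs zd] := H s0 (conj (fun _ h => h) h0) (x, y) Xxy; exists z.
Qed.

(** Level 0 asks only for H^1, so that every eps has some level and a largest one can be
    selected. *)
Definition good Xi (n : nat) (eps : R) v : Prop := in_H1 v /\ ((0 < n)%N ->
  [/\ v a = inf (Xi a), graph_close v Xi n%:R^-1 &
    (E_eps F eps v <= E_0 F Xi + (n%:R^-1)%:E)%E]).

Lemma good_near Xi (n : nat) : in_A0 Xi ->
  \forall eps \near 0^'+, exists v, good Xi n.+1 eps v.
Proof.
move=> XA0; have BXi := XA0.1.1; pose d : R := n.+1%:R^-1.
have d0 : 0 < d by rewrite invr_gt0.
have d2 : 0 < d / 2 by lra.
have d4 : 0 < d / 4 by lra.
have [S [SX net]] := graph_net BXi d2.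
have F1 : F 1 = 0 by apply/F_eq0.
have [T [uT ST H]] := recovery F_cont F_ge0 F1 [seq z.1 | z <- S] XA0 a_int.
have [eps0 eps00 {}H] := H d (d / 4) d0 d4.
near=> eps.
have [|v [vH va vE c1 c2]] := H eps.
  by apply/andP; split; near: eps; [exact: nbhs_right_gt|exact: nbhs_right_lt].
exists v; split=> // _; split=> //.
- change (graph_close v Xi d); split=> [x|x y Xxy].
    have [x' xx' Xv] := c1 x; exists x', (v x); split=> //; first lra.
    by rewrite subrr normr0.
  have [z zS [xz yz]] := net _ _ Xxy.
  have zT : z.1 \in T by apply: ST; exact: map_f.
  have [x' zx' vx'] := c2 _ _ zT (SX z zS); exists x'.
    by apply: le_lt_trans (metric_triangle _ z.1 _) _; lra.
  by rewrite vx' distrC; lra.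
- apply: le_trans vE _; rewrite EFinD leeD2r//; exact: sum_le_E0.
Unshelve. all: by end_near. Qed.

Lemma good_le Xi (m n : nat) (eps : R) v : (0 < m <= n)%N ->
  good Xi n eps v -> good Xi m eps v.
Proof.
move=> /andP[m0 mn] [vH /(_ (leq_trans m0 mn))[va vc vE]]; split=> // _.
have mn' : n%:R^-1 <= m%:R^-1 :> R.
  by rewrite lef_pV2 ?posrE ?ltr0n ?ler_nat// (leq_trans m0).
split=> //; first exact: graph_close_le vc.
by apply: le_trans vE _; rewrite leeD2l// lee_fin.
Qed.

Lemma H1_exists : exists v : pt M -> R, in_H1 v.
Proof.
have P := @ppath_affine R F F_cont 1 1 0 (lo M) (hi M) (F 1) ltr01 (ltW (lo_hi M)).
have {}P := P (fun t _ => ltac:(by rewrite mul0r addr0)).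
have wT : M = Torus -> 1 + 0 * (lo M - lo M) = 1 + 0 * (hi M - lo M) by rewrite !mul0r.
by have [vH _] := H1_of_path F_cont F_ge0 ltr01 wT P; eexists; exact: vH.
Qed.

(* w eps has the best approximation level not exceeding 1/eps. *)
Lemma diagonal Xi : in_A0 Xi -> exists w : R -> pt M -> R,
  (forall eps, in_H1 (w eps)) /\
  forall n, \forall eps \near 0^'+, good Xi n.+1 eps (w eps).
Proof.
move=> XA0; have [v0 v0H] := H1_exists.
pose Q (eps : R) (n : nat) := `[< (n <= Num.truncn eps^-1)%N /\ exists v, good Xi n eps v >].
have Q0 eps : exists n, Q eps n.
  by exists 0; apply/asboolP; split=> //; exists v0.
have Qb eps n : Q eps n -> (n <= Num.truncn eps^-1)%N by move=> /asboolP[].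
have ex eps : exists v, exists2 n, good Xi n eps v & forall m, Q eps m -> (m <= n)%N.
  case: (ex_maxnP (Q0 eps) (Qb eps)) => n /asboolP[_ [v gv]] nmax.
  by exists v, n.
have [w wP] := choice ex.
exists w; split=> [eps|n]; first by have [? []] := wP eps.
have gn := good_near n XA0.
near=> eps.
have [N gN maxN] := wP eps.
apply: good_le gN; apply/andP; split=> //; apply: maxN.
apply/asboolP; split; last by near: eps.
have eps0 : 0 < eps by near: eps; exact: nbhs_right_gt.
rewrite truncn_ge_nat; last by rewrite invr_ge0 ltW.
rewrite -[leLHS]invrK lef_pV2 ?posrE ?invr_gt0//.
by near: eps; apply: nbhs_right_le; rewrite invr_gt0.
Unshelve. all: by end_near. Qed.

Lemma near_gt_liminf (f : R -> \bar R) (C : R) : (C%:E < limf_einf f 0^'+)%E ->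
  \forall eps \near 0^'+, (C%:E < f eps)%E.
Proof.
rewrite limf_einfE => /ereal_sup_gt[_ [V V0 <-]] CV.
apply: filterS V0 => eps Ve; apply: lt_le_trans CV _.
by apply: ereal_inf_lbound; exists eps.
Qed.

Lemma limsup_inequality Xi : in_A0 Xi -> exists w : R -> pt M -> R,
  [/\ forall eps, 0 < eps < 1 -> in_H1 (w eps), graph_cvg w Xi
    & E_eps_b F b a eps (w eps) @[eps --> 0^'+] --> E_0_b F b a Xi].
Proof.
move=> XA0; have [w [wH wg]] := diagonal XA0.
have gc : graph_cvg w Xi.
  apply/graph_cvgP => d d0.
  pose n := Num.truncn d^-1.
  near=> eps.
  have [_ /(_ isT)[_ c _]] : good Xi n.+1 eps (w eps) by near: eps; exact: wg.
  apply: graph_close_le c.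
  by rewrite invf_ple ?posrE// ltW// truncnS_gt.
exists w; split=> //.
(* The liminf inequality is applied with b = 0, which makes its condition on min Xi(a) vacuous; the
   term in b is constant along w. *)
have low : (E_0 F Xi <= limf_einf (fun eps => E_eps F eps (w eps)) 0^'+)%E.
  have [h _] := liminf_inequality (b := 0) F_cont F_ge0 F_eq0 F_infty a (lexx 0)
    (fun eps _ => wH eps) XA0.1.1 gc.
  have {h} := h (fun h => ltac:(by rewrite ltxx in h)).
  rewrite /E_0_b mul0r adde0; congr (_ <= _)%E; congr (limf_einf _ _).
  by apply/funext => eps; rewrite /E_eps_b mul0r adde0.
have E00 : (0 <= E_0 F Xi)%E.
  by have := @sum_le_E0 Xi [::] XA0 isT; rewrite big_nil.
set c := b * inf (Xi a) ^+ 2.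
have c0 : 0 <= c by rewrite mulr_ge0// sqr_ge0.
have Eb : \forall eps \near 0^'+, E_eps_b F b a eps (w eps) = (E_eps F eps (w eps) + c%:E)%E.
  near=> eps.
  have [_ /(_ isT)[va _ _]] : good Xi 1 eps (w eps) by near: eps; exact: wg.
  by rewrite /E_eps_b va.
rewrite /E_0_b -/c.
case E : (E_0 F Xi) => [r| |]; last by rewrite E in E00.
- apply/fine_cvgP; split.
    near=> eps.
    have Ee : E_eps_b F b a eps (w eps) = (E_eps F eps (w eps) + c%:E)%E by near: eps.
    rewrite /= Ee.
    by rewrite E_epsE//; near: eps; exact: nbhs_right_gt.
  apply/cvgrPdist_le => e e0.
  pose n := Num.truncn e^-1.
  have ne : n.+1%:R^-1 <= e by rewrite invf_ple ?posrE// ltW// truncnS_gt.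
  near=> eps.
  have Ee : E_eps_b F b a eps (w eps) = (E_eps F eps (w eps) + c%:E)%E by near: eps.
  rewrite /= Ee.
  have [_ /(_ isT)[_ _ up]] : good Xi n.+1 eps (w eps) by near: eps; exact: wg.
  have lw : ((r - e)%:E < E_eps F eps (w eps))%E.
    near: eps; apply: near_gt_liminf; apply: lt_le_trans low.
    by rewrite E lte_fin; lra.
  have eps0 : 0 < eps by near: eps; exact: nbhs_right_gt.
  have [K EK] : exists K, E_eps F eps (w eps) = K%:E by rewrite E_epsE//; eexists.
  move: up lw; rewrite E EK -EFinD lee_fin lte_fin => up lw.
  rewrite -EFinD /= ler_norml; have := le_trans up (lerD (lexx r) ne); lra.
(* With infinite limit energy the upper bounds in [good] are void, and the lower bound alone gives
   divergence. *)
- rewrite addye//; apply/cvgeyPge => A; near=> eps.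
  have Ee : E_eps_b F b a eps (w eps) = (E_eps F eps (w eps) + c%:E)%E by near: eps.
  rewrite /= Ee.
  have : (A%:E < E_eps F eps (w eps))%E.
    near: eps; apply: near_gt_liminf; apply: lt_le_trans low.
    by rewrite E ltry.
  by move=> /ltW /le_trans; apply; rewrite leeDl// lee_fin.
Unshelve. all: by end_near. Qed.

End limsup.

(** The condition on [inf (Xi a)] excludes the failure of lower semicontinuity described at [E_0_b].
    Membership in A_0 is asserted for finite lower limits: energies tending to infinity do not
    constrain Xi, as the constant functions v = 2 show. *)
Theorem theorem2p1 (R : realType) (M : domain R) (F : R -> R)
    (F_cont : continuous F)
    (F_ge0 : forall v, 0 <= F v)
    (F_eq0 : forall v, F v = 0 <-> v = 1)
    (F_infty : (0 < limf_einf (fun v => (F v)%:E) (@abs_infty R))%E)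
    (a : pt M) (a_int : ~~ on_bdry a) (b : R) (b_ge0 : 0 <= b) :
  (forall (v : R -> pt M -> R) (Xi : pt M -> set R),
     (forall eps, 0 < eps < 1 -> in_H1 (v eps)) ->
     in_B Xi -> graph_cvg v Xi ->
     ((0 < b -> (E_0 F Xi < +oo)%E -> 0 <= inf (Xi a)) ->
        (E_0_b F b a Xi <=
           limf_einf (fun eps => E_eps_b F b a eps (v eps)) 0^'+)%E) /\
     ((limf_einf (fun eps => E_eps_b F b a eps (v eps)) 0^'+ < +oo)%E ->
        in_A0 Xi)) /\
  (forall Xi : pt M -> set R, in_A0 Xi ->
     exists w : R -> pt M -> R,
       [/\ forall eps, 0 < eps < 1 -> in_H1 (w eps),
           graph_cvg w Xi
         & E_eps_b F b a eps (w eps) @[eps --> 0^'+] --> E_0_b F b a Xi]).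
Proof.
split=> [v Xi vH BXi gc|Xi XA0].
  exact: liminf_inequality.
exact: limsup_inequality.
Qed.
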